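(* Suppose the conditions (Data Generating Process), (Quasi-Uniform Partition), (Local Basis) and (Approximation Error) stated in the context hold. If $\frac{\log n}{nh^d}=o(1)$, then for a weighting function $w(\mathbf{x})$ that is continuous and bounded away from zero on $\mathcal{X}$, $$\int_{\mathcal{X}}\mathbb{E}\big[(\widehat{\partial^{\mathbf{q}}\mu}_0(\mathbf{x})-\partial^{\mathbf{q}}\mu(\mathbf{x}))^2\,\big|\,\mathbf{X}\big]w(\mathbf{x})\,d\mathbf{x}=\frac1n\Big(\mathscr{V}_{\Delta,\mathbf{q}}+o_{\mathbb{P}}(h^{-d-2[\mathbf{q}]})\Big)+\Big(\mathscr{B}_{\Delta,\mathbf{q}}+o_{\mathbb{P}}(h^{2m-2[\mathbf{q}]})\Big),$$ where $$\mathscr{V}_{\Delta,\mathbf{q}}=\mathrm{trace}\Big(\boldsymbol{\Sigma}_0\int_{\mathcal{X}}\boldsymbol{\gamma}_{\mathbf{q},0}(\mathbf{x})\boldsymbol{\gamma}_{\mathbf{q},0}(\mathbf{x})'w(\mathbf{x})\,d\mathbf{x}\Big)\asymp h^{-d-2[\mathbf{q}]},$$ $$\mathscr{B}_{\Delta,\mathbf{q}}=\int_{\mathcal{X}}\Big(\mathscr{B}_{m,\mathbf{q}}(\mathbf{x})-\boldsymbol{\gamma}_{\mathbf{q},0}(\mathbf{x})'\mathbb{E}[\mathbf{p}(\mathbf{x}_i)\mathscr{B}_{m,\mathbf{0}}(\mathbf{x}_i)]\Big)^2w(\mathbf{x})\,d\mathbf{x}\lesssim h^{2m-2[\mathbf{q}]},$$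 with $\boldsymbol{\Sigma}_0=\mathbb{E}[\boldsymbol{\Pi}_0(\mathbf{x}_i)\boldsymbol{\Pi}_0(\mathbf{x}_i)'\sigma^2(\mathbf{x}_i)]$, $\boldsymbol{\Pi}_0(\mathbf{x}_i)=\mathbf{p}(\mathbf{x}_i)$, and $\boldsymbol{\gamma}_{\mathbf{q},0}(\mathbf{x})'=\partial^{\mathbf{q}}\mathbf{p}(\mathbf{x})'\mathbb{E}[\mathbf{p}(\mathbf{x}_i)\mathbf{p}(\mathbf{x}_i)']^{-1}$.
   Context: **Notation.** All limits are as $n\to\infty$. $d\ge 1$ is fixed. For a multi-index $\mathbf{q}=(q_1,\dots,q_d)\in\mathbb{Z}_+^d$, $[\mathbf{q}]=\sum_j q_j$ and $\partial^{\mathbf{q}}g=\partial^{[\mathbf{q}]}g/\partial x_1^{q_1}\cdots\partial x_d^{q_d}$ (at boundary points of a closed set, derivatives are limits from within the set). $\|\cdot\|$ is the Euclidean norm. $a_n\lesssim b_n$ means $\limsup_n|a_n/b_n|<\infty$; $a_n\gtrsim b_n$ means $b_n\lesssim a_n$; $a_n\asymp b_n$ means both; $a_n=o_{\mathbb{P}}(b_n)$ means $a_n/b_n\to0$ in probability. $\mathbb{E}_n[g(\mathbf{x}_i)]=\frac1n\sum_{i=1}^n g(\mathbf{x}_i)$. $\mathrm{clo}$ is closure, $\mathrm{diam}$ is diameter. $\mathbf{X}=[\mathbf{x}_1,\dots,\mathbf{x}_n]'$. **Model.** $y_i=\mu(\mathbf{x}_i)+\varepsilon_i$, $\mathbb{E}[\varepsilon_i|\mathbf{x}_i]=0$,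 $\mathbb{E}[\varepsilon_i^2|\mathbf{x}_i]=\sigma^2(\mathbf{x}_i)$, $y_i$ scalar, $\mathbf{x}_i\in\mathcal{X}\subset\mathbb{R}^d$. A multi-index $\mathbf{q}$ is fixed. **Partition and basis.** For each $n$, $\Delta=\{\delta_l:1\le l\le\bar\kappa\}$ is a nonrandom collection of open, disjoint polyhedral subsets of $\mathcal{X}$, the closure of whose union is $\mathcal{X}$; $h=\max\{\mathrm{diam}(\delta):\delta\in\Delta\}$. For $\mathbf{x}\in\mathcal{X}$, $\delta_{\mathbf{x}}$ is the element of $\Delta$ whose closure contains $\mathbf{x}$ and $h_{\mathbf{x}}=\mathrm{diam}(\delta_{\mathbf{x}})$. $m\in\mathbb{Z}_+$ is a fixed order and $\mathbf{p}(\mathbf{x})=\mathbf{p}(\mathbf{x};\Delta,m)=(p_1(\mathbf{x}),\dots,p_K(\mathbf{x}))'$ is a vector of $K$ basis functions, with linear span $\mathcal{S}_{\Delta,m}$. A function is active on $\delta\in\Delta$ if it is not identically zero on $\delta$. **(Data Generating Process)** (a) $\{(y_i,\mathbf{x}_i')\}_{i=1}^n$ are i.i.d. from the model; $\mathbf{x}_i$ has compact connected support $\mathcal{X}$ and an absolutely continuous distribution function; its density $f$ and the conditional variance $\sigma^2$ are bounded away from zero and continuous. (b) $\mu$ is $S$-times continuously differentiable, $S\ge[\mathbf{q}]$, and all $\partial^{\boldsymbol{\alpha}}\mu$ with $[\boldsymbol{\alpha}]=S$ are Hölder continuous with exponent $\varrho>0$. **(Quasi-Uniform Partition)** The ratio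 of the sizes of inscribed and circumscribed balls of each $\delta\in\Delta$ is bounded away from zero uniformly in $\delta\in\Delta$; $\max_{\delta\in\Delta}\mathrm{diam}(\delta)/\min_{\delta\in\Delta}\mathrm{diam}(\delta)\lesssim1$; and $h=o(1)$. **(Local Basis)** (a) For each $k$, the union $\mathcal{H}_k$ of elements of $\Delta$ on which $p_k$ is active is connected; for all $k$, the number of elements of $\mathcal{H}_k$ and the number of basis functions active on $\mathcal{H}_k$ are bounded by a constant. (b) For any $\mathbf{a}=(a_1,\dots,a_K)'\in\mathbb{R}^K$, $\mathbf{a}'\int_{\mathcal{H}_k}\mathbf{p}(\mathbf{x})\mathbf{p}(\mathbf{x})'d\mathbf{x}\,\mathbf{a}\gtrsim a_k^2h^d$, $k=1,\dots,K$. (c) $[\mathbf{q}]<m$, and for an integer $\varsigma\in[[\mathbf{q}],m)$: for all $\boldsymbol{\alpha}$ with $[\boldsymbol{\alpha}]\le\varsigma$, $h^{-[\boldsymbol{\alpha}]}\lesssim\inf_{\delta\in\Delta}\inf_{\mathbf{x}\in\mathrm{clo}(\delta)}\|\partial^{\boldsymbol{\alpha}}\mathbf{p}(\mathbf{x})\|\le\sup_{\delta\in\Delta}\sup_{\mathbf{x}\in\mathrm{clo}(\delta)}\|\partial^{\boldsymbol{\alpha}}\mathbf{p}(\mathbf{x})\|\lesssim h^{-[\boldsymbol{\alpha}]}$, and for $[\boldsymbol{\alpha}]=\varsigma+1$, $\sup_{\delta\in\Delta}\sup_{\mathbf{x}\in\mathrm{clo}(\delta)}\|\partial^{\boldsymbol{\alpha}}\mathbf{p}(\mathbf{x})\|\lesssim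 h^{-\varsigma-1}$. **(Approximation Error)** $S\ge m$. There is $s^*\in\mathcal{S}_{\Delta,m}$ such that for all $\boldsymbol{\alpha}$ with $[\boldsymbol{\alpha}]\le\varsigma$, with $\mathscr{B}_{m,\boldsymbol{\alpha}}(\mathbf{x})=-\sum_{\mathbf{u}\in\Lambda_m}\partial^{\mathbf{u}}\mu(\mathbf{x})\,h_{\mathbf{x}}^{m-[\boldsymbol{\alpha}]}B_{\mathbf{u},\boldsymbol{\alpha}}(\mathbf{x})$, one has $\sup_{\mathbf{x}\in\mathcal{X}}|\partial^{\boldsymbol{\alpha}}\mu(\mathbf{x})-\partial^{\boldsymbol{\alpha}}s^*(\mathbf{x})+\mathscr{B}_{m,\boldsymbol{\alpha}}(\mathbf{x})|\lesssim h^{m+\varrho-[\boldsymbol{\alpha}]}$ and $\sup_{\delta\in\Delta}\sup_{\mathbf{x}_1,\mathbf{x}_2\in\mathrm{clo}(\delta)}\frac{|B_{\mathbf{u},\boldsymbol{\alpha}}(\mathbf{x}_1)-B_{\mathbf{u},\boldsymbol{\alpha}}(\mathbf{x}_2)|}{\|\mathbf{x}_1-\mathbf{x}_2\|}\lesssim h^{-1}$, where $B_{\mathbf{u},\boldsymbol{\alpha}}$ are known functions bounded uniformly over $n$, and $\Lambda_m$ is a multi-index set depending on the basis with $[\mathbf{u}]=m$ for all $\mathbf{u}\in\Lambda_m$. **Estimator.** $\widehat{\partial^{\mathbf{q}}\mu}_0(\mathbf{x})=\partial^{\mathbf{q}}\mathbf{p}(\mathbf{x})'\mathbb{E}_n[\mathbf{p}(\mathbf{x}_i)\mathbf{p}(\mathbf{x}_i)']^{-1}\mathbb{E}_n[\mathbf{p}(\mathbf{x}_i)y_i]$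 (the least squares series estimator; the inverse exists with probability approaching one). *)

(* Defs.v *)
From HB Require Import structures.
From mathcomp Require Import all_boot all_order all_algebra finmap.
From mathcomp Require Import all_classical all_reals all_analysis measurable_realfun.
Import Order.TTheory GRing.Theory Num.Theory.
Import numFieldNormedType.Exports.

Set Implicit Arguments.
Unset Strict Implicit.
Unset Printing Implicit Defensive.

Local Open Scope classical_set_scope.
Local Open Scope ring_scope.

(* R^d is 'rV[R]_d. Its topology is the library's; its sigma-algebra is the one
   generated by the coordinates, that is the Borel one when T is a realType. *)
Definition rV_display : measure_display -> measure_display.
Proof. exact. Qed.

Section rV_measurable.
Context {d : measure_display} {T : measurableType d}.
Variable n : nat.

Let coord (i : 'I_n) (v : 'rV[T]_n) : T := v ord0 i.

Let rV_set0 : g_sigma_preimage coord set0.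
Proof. exact: sigma_algebra0. Qed.

Let rV_setC A : g_sigma_preimage coord A -> g_sigma_preimage coord (~` A).
Proof. exact: sigma_algebraC. Qed.

Let rV_bigcup (F : (set 'rV[T]_n)^nat) :
  (forall i, g_sigma_preimage coord (F i)) ->
  g_sigma_preimage coord (\bigcup_i F i).
Proof. exact: sigma_algebra_bigcup. Qed.

HB.instance Definition _ := @isMeasurable.Build (rV_display d) 'rV[T]_n
  (g_sigma_preimage coord) rV_set0 rV_setC rV_bigcup.

Lemma measurable_coord (i : 'I_n) :
  measurable_fun [set: 'rV[T]_n] (fun v : 'rV[T]_n => v ord0 i).
Proof.
move=> _ Y mY; rewrite setTI; apply: sub_sigma_algebra => /=.
rewrite -bigcup_seq/=; exists i => /=; first by rewrite mem_index_enum.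
by exists Y => //; rewrite setTI.
Qed.

Lemma measurable_rowP (d' : measure_display) (S : measurableType d')
    (f : S -> 'rV[T]_n) :
  (forall i, measurable_fun [set: S] (fun s => f s ord0 i)) ->
  measurable_fun [set: S] f.
Proof.
move=> mf _ A mA; rewrite setTI; move: A mA.
suff : measurable `<=` (fun A : set 'rV[T]_n => measurable (f @^-1` A)) by [].
apply: smallest_sub => /=.
  split => /=.
  - by rewrite preimage_set0.
  - by move=> A mA; rewrite setTD preimage_setC; exact: measurableC.
  - by move=> F mF; rewrite preimage_bigcup; exact: bigcup_measurable.
move=> A /=; rewrite -bigcup_seq/= => -[i _ [B mB]].
rewrite setTI => <-; have := mf i measurableT B mB.
by rewrite setTI.
Qed.

End rV_measurable.

Section lebesgue_rV.
Variable R : realType.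

Section succ.
Variables (n : nat) (m : {sigma_finite_measure set 'rV[R]_n -> \bar R}).

Definition rV_cons (p : R * 'rV[R]_n) : 'rV[R]_n.+1 :=
  \row_i if unlift ord0 i is Some j then p.2 ord0 j else p.1.

Lemma measurable_rV_cons : measurable_fun setT rV_cons.
Proof.
apply: measurable_rowP => i.
under eq_fun do rewrite mxE.
case: (unlift ord0 i) => [j|]; last exact: measurable_fst.
exact: (measurableT_comp (measurable_coord j) measurable_snd).
Qed.

Definition rV_uncons (v : 'rV[R]_n.+1) : R * 'rV[R]_n :=
  (v ord0 ord0, \row_j v ord0 (lift ord0 j)).

Lemma measurable_rV_uncons : measurable_fun setT rV_uncons.
Proof.
apply/measurable_fun_pairP; split; first exact: measurable_coord.
apply: measurable_rowP => i; rewrite /comp/=.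
by under eq_fun do rewrite mxE; exact: measurable_coord.
Qed.

Lemma rV_consK : cancel rV_cons rV_uncons.
Proof.
move=> [x v]; rewrite /rV_uncons /rV_cons mxE unlift_none; congr pair.
by apply/rowP => j; rewrite !mxE liftK.
Qed.

Definition lebesgue_rVS : set 'rV[R]_n.+1 -> \bar R :=
  pushforward ((@lebesgue_measure R) \x m)%E rV_cons.

Let lebesgue_rVS0 : lebesgue_rVS set0 = 0%E.
Proof. by rewrite /lebesgue_rVS /pushforward preimage_set0 measure0. Qed.

Let lebesgue_rVS_ge0 A : (0 <= lebesgue_rVS A)%E.
Proof. by rewrite /lebesgue_rVS /pushforward; apply: measure_ge0. Qed.

Let lebesgue_rVS_sigma_additive : semi_sigma_additive lebesgue_rVS.
Proof.
move=> F mF tF mUF; rewrite /lebesgue_rVS /pushforward preimage_bigcup.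
apply: measure_semi_sigma_additive.
- by move=> k; rewrite -[X in measurable X]setTI; exact: measurable_rV_cons.
- apply/trivIsetP => /= i j _ _ ij; rewrite -preimage_setI.
  by move/trivIsetP : tF => /(_ _ _ _ _ ij) ->//; rewrite preimage_set0.
- by rewrite -preimage_bigcup -[X in measurable X]setTI;
    exact: measurable_rV_cons.
Qed.

HB.instance Definition _ := isMeasure.Build _ _ _ lebesgue_rVS
  lebesgue_rVS0 lebesgue_rVS_ge0 lebesgue_rVS_sigma_additive.

Let lebesgue_rVS_sigma_finite : sigma_finite setT lebesgue_rVS.
Proof.
have /sigma_finiteP[F [TF ndF Foo]] := sigma_finiteT (@lebesgue_measure R).
have /sigma_finiteP[G [TG ndG Goo]] := sigma_finiteT m.
have mFG k : measurable (F k `*` G k).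
  by apply: measurableX; [have [] := Foo k|have [] := Goo k].
exists (fun k => rV_uncons @^-1` (F k `*` G k)).
  rewrite -preimage_bigcup (_ : \bigcup_k _ = setT) ?preimage_setT//.
  apply/seteqP; split => // -[x v] _.
  have : setT x by []. rewrite TF => -[i _ Fx].
  have : setT v by []. rewrite TG => -[j _ Gv].
  exists (maxn i j) => //; split.
    by have /subsetPset := ndF _ _ (leq_maxl i j); exact.
  by have /subsetPset := ndG _ _ (leq_maxr i j); exact.
move=> k; split.
  by have := measurable_rV_uncons measurableT (mFG k); rewrite setTI.
rewrite /lebesgue_rVS /pushforward -comp_preimage.
rewrite (_ : _ @^-1` _ = F k `*` G k); last first.
  rewrite (_ : rV_uncons \o rV_cons = id) ?preimage_id//.
  by apply/funext => x /=; rewrite rV_consK.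
have [? ?] := Foo k; have [? ?] := Goo k.
by rewrite product_measure1E// lte_mul_pinfty// ge0_fin_numE.
Qed.

HB.instance Definition _ := Measure_isSigmaFinite.Build _ _ _ lebesgue_rVS
  lebesgue_rVS_sigma_finite.

End succ.

Fixpoint lebesgue_rV (n : nat) :
    {sigma_finite_measure set 'rV[R]_n -> \bar R} :=
  match n with
  | 0%N => \d_(0 : 'rV[R]_0)
  | n'.+1 => lebesgue_rVS (lebesgue_rV n')
  end.

(* Lebesgue measure on R^n: the values on the boxes determine it. *)
Lemma lebesgue_rV_box (n : nat) (A : 'I_n -> set R) :
  (forall i, measurable (A i)) ->
  lebesgue_rV n [set v | forall i, A i (v ord0 i)] =
  (\prod_(i < n) (@lebesgue_measure R) (A i))%E.
Proof.
elim: n A => [|n ih] A mA /=.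
  by rewrite big_ord0 diracE mem_set// => -[].
pose B := [set v : 'rV[R]_n | forall i, A (lift ord0 i) (v ord0 i)].
have mB : measurable B.
  rewrite (_ : B = \bigcap_(i in [set: 'I_n])
      ((fun v : 'rV[R]_n => v ord0 i) @^-1` A (lift ord0 i))).
    apply: fin_bigcap_measurable => // i _.
    by rewrite -[X in measurable X]setTI; exact: measurable_coord.
  by apply/seteqP; split => v vA i; [move=> _|]; exact: vA.
rewrite big_ord_recl -ih// -[X in (_ * lebesgue_rV n X)%E]/B.
rewrite -product_measure1E//.
rewrite /lebesgue_rVS /pushforward; congr (_ _).
apply/seteqP; split => -[x v] /=.
  move=> xvA; split; first by have := xvA ord0; rewrite mxE unlift_none.
  by move=> i; have := xvA (lift ord0 i); rewrite mxE liftK.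
by move=> [Ax Av] i; rewrite mxE; case: unliftP => [j ->|->].
exact: (mA ord0).
Qed.

End lebesgue_rV.

Section multi_index.
Variable d : nat.

Definition multi_index := {ffun 'I_d -> nat}.

Definition mi_order (q : multi_index) : nat := (\sum_(j < d) q j)%N.

Definition mi0 : multi_index := [ffun=> 0%N].

End multi_index.
Arguments mi0 {d}.

Section euclidean.
Context {R : realType}.

(* The library's norm on matrices is the maximum norm. *)
Definition enorm {m n : nat} (A : 'M[R]_(m, n)) : R :=
  Num.sqrt (\sum_(i < m) \sum_(j < n) A i j ^+ 2).

Context {d : nat}.
Implicit Type A : set 'rV[R]_d.

Definition diam A : R := sup [set enorm (x - y) | x in A & y in A].

Definition inradius A : R :=
  sup [set r | exists x, [set y | enorm (y - x) < r] `<=` A].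

Definition circumradius A : R :=
  inf [set r | exists x, A `<=` [set y | enorm (y - x) <= r]].

Definition half_space (H : set 'rV[R]_d) : Prop :=
  exists (a : 'rV[R]_d) (b : R),
    H = [set x | \sum_(i < d) a ord0 i * x ord0 i < b] \/
    H = [set x | \sum_(i < d) a ord0 i * x ord0 i <= b].

(* A finite union of finite intersections of open or closed half-spaces; a
   polyhedral set need not be convex. *)
Definition polyhedral A : Prop :=
  exists (k j : nat) (H : 'I_k -> 'I_j -> set 'rV[R]_d),
    (forall i l, half_space (H i l)) /\
    A = \bigcup_(i in [set: 'I_k]) \bigcap_(l in [set: 'I_j]) H i l.

End euclidean.

Section derivatives.
Context {R : realType} {d : nat}.
Implicit Types (A : set 'rV[R]_d) (g : 'rV[R]_d -> R).

Definition partial1 (j : 'I_d) g : 'rV[R]_d -> R :=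
  fun x => 'D_(delta_mx ord0 j) g x.

Definition partial (q : multi_index d) g : 'rV[R]_d -> R :=
  foldr (fun j => iter (q j) (partial1 j)) g (enum 'I_d).

(* The limit at x of g from within A; at the points of A° where g is
   continuous it is the value of g. *)
Definition inner_lim A g (x : 'rV[R]_d) : R :=
  lim (g y @[y --> within A° (nbhs x)]).

Definition partial_in A (q : multi_index d) g : 'rV[R]_d -> R :=
  inner_lim A (partial q g).

Fixpoint Ck_open (k : nat) A g : Prop :=
  (forall x, A x -> {for x, continuous g}) /\
  match k with
  | 0%N => True
  | k'.+1 => forall j,
      (forall x, A x -> derivable g x (delta_mx ord0 j)) /\
      Ck_open k' A (partial1 j g)
  end.

(* k times continuously differentiable on the closure of A, the derivatives at
   the boundary being the limits from within. *)
Definition Ck (k : nat) A g : Prop :=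
  [/\ {within A, continuous g}, Ck_open k A° g &
      forall q : multi_index d, (mi_order q <= k)%N -> forall x, closure A x ->
        cvg (partial q g y @[y --> within A° (nbhs x)])].

End derivatives.

Section asymptotics.
Context {R : realType}.

(* limsup |a_n / b_n| < oo, without division, so that b_n = 0 forces a_n = 0. *)
Definition lesssim (a b : nat -> \bar R) : Prop :=
  exists M : R, \forall n \near \oo, (`|a n| <= M%:E * `|b n|)%E.

Definition asymp (a b : nat -> \bar R) : Prop := lesssim a b /\ lesssim b a.

Context {disp : measure_display} {Omega : measurableType disp}.
Variable P : probability Omega R.

Definition oP (r : nat -> {RV P >-> R}) (b : nat -> R) : Prop :=
  forall e : R, 0 < e ->
    P [set omega | e * `|b n| < `|r n omega|] @[n --> \oo] --> 0%E.

End asymptotics.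

Section probability.
Context {R : realType} {disp : measure_display} {Omega : measurableType disp}.
Variable P : probability Omega R.
Context {disp' : measure_display} {T : measurableType disp'}.

(* g \o Z is a version of E[U | Z], for U integrable or nonnegative. *)
Definition cond_expectation (Z : Omega -> T) (U : Omega -> \bar R)
    (g : T -> \bar R) : Prop :=
  measurable_fun setT g /\
  forall A, measurable A ->
    (\int[P]_(omega in Z @^-1` A) U omega =
     \int[P]_(omega in Z @^-1` A) g (Z omega))%E.

Definition iid (Z : nat -> Omega -> T) : Prop :=
  (forall (J : {fset nat}) (A : nat -> set T), (forall i, measurable (A i)) ->
    P (\bigcap_(i in [set` J]) (Z i @^-1` A i)) =
    (\prod_(i <- J) P (Z i @^-1` A i))%E) /\
  (forall i A, measurable A -> P (Z i @^-1` A) = P (Z 0%N @^-1` A)).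

End probability.

Section dgp.
Context {R : realType} {d : nat} {disp : measure_display}
  {Omega : measurableType disp}.
Variables (P : probability Omega R) (X : nat -> {RV P >-> 'rV[R]_d})
  (Y eps : nat -> {RV P >-> R}) (mu sigma2 f : 'rV[R]_d -> R)
  (supp : set 'rV[R]_d) (q : multi_index d) (S : nat) (rho : R).

Definition bounded_away_from_zero (g : 'rV[R]_d -> R) : Prop :=
  exists2 c : R, 0 < c & forall x, supp x -> c <= g x.

Record data_generating_process : Prop := {
  dgp_model : forall i omega, Y i omega = mu (X i omega) + eps i omega ;
  dgp_eps_integrable : forall i, P.-integrable setT (EFin \o eps i) ;
  dgp_eps_mean : forall i,
    cond_expectation P (X i) (EFin \o eps i) (cst 0%E) ;
  dgp_eps_variance : forall i,
    cond_expectation P (X i) (fun omega => (eps i omega ^+ 2)%:E)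
      (EFin \o sigma2) ;
  dgp_iid : iid P (fun i omega => (X i omega, Y i omega)) ;
  dgp_support : forall i,
    supp = [set x | forall U, open U -> U x -> (0 < P (X i @^-1` U))%E] ;
  dgp_compact : compact supp ;
  dgp_connected : connected supp ;
  dgp_density_measurable : measurable_fun setT f ;
  dgp_density_ge0 : forall x, 0 <= f x ;
  dgp_density : forall i A, measurable A ->
    P (X i @^-1` A) = (\int[lebesgue_rV R d]_(x in A) (f x)%:E)%E ;
  dgp_density_continuous : {within supp, continuous f} ;
  dgp_density_bounded_away : bounded_away_from_zero f ;
  dgp_variance_continuous : {within supp, continuous sigma2} ;
  dgp_variance_bounded_away : bounded_away_from_zero sigma2 ;
  dgp_smooth : Ck S supp mu ;
  dgp_smooth_order : (mi_order q <= S)%N ;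
  dgp_rho_gt0 : 0 < rho ;
  dgp_holder : forall alpha : multi_index d, mi_order alpha = S ->
    exists C : R, forall x y, supp x -> supp y ->
      `|partial_in supp alpha mu x - partial_in supp alpha mu y|
        <= C * enorm (x - y) `^ rho }.

End dgp.

Section cells.
Context {R : realType} {d k : nat}.
Variable cells : 'I_k -> set 'rV[R]_d.

Definition mesh : R := \big[Num.max/0]_(l < k) diam (cells l).

(* A cell whose closure contains x; at the common boundary points of several
   cells, which form a null set, the first one is taken. *)
Definition cell_of (x : 'rV[R]_d) : option 'I_k :=
  [pick l | `[< closure (cells l) x >]].

Definition cell_diam (x : 'rV[R]_d) : R :=
  if cell_of x is Some l then diam (cells l) else 0.

Definition cell_lim (g : 'rV[R]_d -> R) (x : 'rV[R]_d) : R :=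
  if cell_of x is Some l then inner_lim (cells l) g x else 0.

Definition cell_partial (q : multi_index d) (g : 'rV[R]_d -> R) :
    'rV[R]_d -> R :=
  cell_lim (partial q g).

Definition active_on (g : 'rV[R]_d -> R) (A : set 'rV[R]_d) : Prop :=
  exists2 x, A x & g x != 0.

Definition active_cells (g : 'rV[R]_d -> R) : {pred 'I_k} :=
  [pred l | `[< active_on g (cells l) >]].

Definition active_region (g : 'rV[R]_d -> R) : set 'rV[R]_d :=
  \bigcup_(l in [set` active_cells g]) cells l.

Record is_partition (supp : set 'rV[R]_d) : Prop := {
  partition_open : forall l, open (cells l) ;
  partition_polyhedral : forall l, polyhedral (cells l) ;
  partition_sub : forall l, cells l `<=` supp ;
  partition_disjoint : trivIset setT cells ;
  partition_cover : closure (\bigcup_(l in setT) cells l) = supp }.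

End cells.

Section assumptions.
Context {R : realType} {d : nat} {kappa K : nat -> nat}.
Variables (cells : forall n, 'I_(kappa n) -> set 'rV[R]_d)
  (p : forall n, 'rV[R]_d -> 'cV[R]_(K n)).
Arguments cells : clear implicits.

Local Notation h n := (mesh (cells n)).

Definition quasi_uniform_partition : Prop :=
  [/\ exists2 c : R, 0 < c & \forall n \near \oo, forall l,
        c <= inradius (cells n l) / circumradius (cells n l),
      lesssim (fun n => (h n)%:E)
        (fun n => ereal_inf [set (diam (cells n l))%:E | l in setT]) &
      h n @[n --> \oo] --> 0].

Definition basis_fun n (k : 'I_(K n)) : 'rV[R]_d -> R := fun x => p n x k ord0.

Definition basis_partial_in n (l : 'I_(kappa n)) (alpha : multi_index d)
    (x : 'rV[R]_d) : 'cV[R]_(K n) :=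
  \col_k partial_in (cells n l) alpha (basis_fun k) x.

Definition basis_partial n (alpha : multi_index d) (x : 'rV[R]_d) :
    'cV[R]_(K n) :=
  \col_k cell_partial (cells n) alpha (basis_fun k) x.

Definition sup_basis_partial (alpha : multi_index d) (n : nat) : \bar R :=
  ereal_sup [set ereal_sup [set (enorm (basis_partial_in l alpha x))%:E
    | x in closure (cells n l)] | l in setT].

Definition inf_basis_partial (alpha : multi_index d) (n : nat) : \bar R :=
  ereal_inf [set ereal_inf [set (enorm (basis_partial_in l alpha x))%:E
    | x in closure (cells n l)] | l in setT].

(* The cells are open and disjoint, so that the region on which a basis function
   is active is connected up to the common faces of its cells: this is the
   connectedness of its closure. *)
Record local_basis (q : multi_index d) (m vs : nat) : Prop := {
  basis_measurable : forall n (k : 'I_(K n)),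
    measurable_fun setT (basis_fun k) ;
  basis_connected : forall n (k : 'I_(K n)),
    connected (closure (active_region (cells n) (basis_fun k))) ;
  basis_local : exists C : nat, forall n (k : 'I_(K n)),
    (#|active_cells (cells n) (basis_fun k)| <= C)%N /\
    (#|[pred j : 'I_(K n) | `[< active_on (basis_fun j)
         (active_region (cells n) (basis_fun k)) >]]| <= C)%N ;
  basis_gram : exists2 c : R, 0 < c &
    \forall n \near \oo, forall (k : 'I_(K n)) (a : 'cV[R]_(K n)),
      c * (a k ord0 ^+ 2 * h n ^+ d) <=
      (a^T *m (\matrix_(i, j) \int[lebesgue_rV R d]_(x in
                 active_region (cells n) (basis_fun k))
                 (p n x i ord0 * p n x j ord0)) *m a) ord0 ord0 ;
  basis_order : (mi_order q < m)%N ;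
  basis_vs : (mi_order q <= vs < m)%N ;
  basis_smooth : forall n l (k : 'I_(K n)),
    Ck vs.+1 (cells n l) (basis_fun k) ;
  basis_partial_lower : forall alpha : multi_index d,
    (mi_order alpha <= vs)%N ->
    lesssim (fun n => (h n ^- mi_order alpha)%:E) (inf_basis_partial alpha) ;
  basis_partial_upper : forall alpha : multi_index d,
    (mi_order alpha <= vs.+1)%N ->
    lesssim (sup_basis_partial alpha) (fun n => (h n ^- mi_order alpha)%:E) }.

(* The functions B n u alpha are smooth cell by cell only: on closed cells their
   values are the limits from within the cell, as for the derivatives of p. *)
Section bias.
Variables (supp : set 'rV[R]_d) (mu : 'rV[R]_d -> R) (m : nat)
  (Lambda : {fset multi_index d})
  (B : nat -> multi_index d -> multi_index d -> 'rV[R]_d -> R).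

Definition leading_bias n (alpha : multi_index d) (x : 'rV[R]_d) : R :=
  - \sum_(u <- Lambda) partial_in supp u mu x *
      cell_diam (cells n) x ^+ (m - mi_order alpha) *
      cell_lim (cells n) (B n u alpha) x.

Record approximation_error (S vs : nat) (rho : R) : Prop := {
  approx_order : (m <= S)%N ;
  approx_Lambda : forall u, u \in Lambda -> mi_order u = m ;
  approx_B_bounded : exists C : R, forall n u (alpha : multi_index d) x,
    u \in Lambda -> (mi_order alpha <= vs)%N -> supp x ->
    `|B n u alpha x| <= C ;
  approx_B_lim : forall n u (alpha : multi_index d) l x,
    u \in Lambda -> (mi_order alpha <= vs)%N -> closure (cells n l) x ->
    cvg (B n u alpha y @[y --> within (cells n l)° (nbhs x)]) ;
  approx_B_lipschitz : forall u (alpha : multi_index d),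
    u \in Lambda -> (mi_order alpha <= vs)%N ->
    lesssim (fun n => ereal_sup [set ereal_sup
        [set (`|inner_lim (cells n l) (B n u alpha) x1 -
                inner_lim (cells n l) (B n u alpha) x2| /
              enorm (x1 - x2))%:E
        | x1 in closure (cells n l) & x2 in closure (cells n l)]
        | l in setT])
      (fun n => (h n)^-1%:E) ;
  approx_spline : exists a : forall n, 'cV[R]_(K n),
    forall alpha : multi_index d, (mi_order alpha <= vs)%N ->
    lesssim (fun n => ereal_sup
        [set `|partial_in supp alpha mu x -
               cell_partial (cells n) alpha
                 (fun y => ((a n)^T *m p n y) ord0 ord0) x +
               leading_bias n alpha x|%:E | x in supp])
      (fun n => (h n `^ (m%:R + rho - (mi_order alpha)%:R))%:E) }.

End bias.

Section estimator.
Context {disp : measure_display} {Omega : measurableType disp}.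
Variables (P : probability Omega R) (X : nat -> {RV P >-> 'rV[R]_d})
  (Y : nat -> {RV P >-> R}).

Definition design n (omega : Omega) : n.-tuple 'rV[R]_d :=
  [tuple X i omega | i < n].

(* invmx leaves a singular matrix unchanged; the probability that the sample
   Gram matrix is singular tends to zero. *)
Definition ls_estimator (q : multi_index d) n (x : 'rV[R]_d) (omega : Omega) :
    R :=
  ((basis_partial n q x)^T *m
   invmx (n%:R^-1 *: \sum_(i < n) (p n (X i omega) *m (p n (X i omega))^T)) *m
   (n%:R^-1 *: \sum_(i < n) (Y i omega *: p n (X i omega)))) ord0 ord0.

Definition gram n : 'M[R]_(K n) :=
  \matrix_(i, j) \int[P]_omega
    (p n (X 0%N omega) i ord0 * p n (X 0%N omega) j ord0).

Definition gamma (q : multi_index d) n (x : 'rV[R]_d) : 'cV[R]_(K n) :=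
  ((basis_partial n q x)^T *m invmx (gram n))^T.

Definition Sigma (sigma2 : 'rV[R]_d -> R) n : 'M[R]_(K n) :=
  \matrix_(i, j) \int[P]_omega
    (p n (X 0%N omega) i ord0 * p n (X 0%N omega) j ord0 *
     sigma2 (X 0%N omega)).

Definition imse_variance (supp : set 'rV[R]_d) (w sigma2 : 'rV[R]_d -> R)
    (q : multi_index d) n : R :=
  \tr (Sigma sigma2 n *m
    \matrix_(i, j) \int[lebesgue_rV R d]_(x in supp)
      (gamma q n x i ord0 * gamma q n x j ord0 * w x)).

(* bias n alpha is the leading bias of the derivative of order alpha. *)
Definition imse_bias (supp : set 'rV[R]_d) (w : 'rV[R]_d -> R)
    (bias : forall n : nat, multi_index d -> 'rV[R]_d -> R)
    (q : multi_index d) n : R :=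
  \int[lebesgue_rV R d]_(x in supp)
    ((bias n q x -
      ((gamma q n x)^T *m
       \col_k \int[P]_omega
         (p n (X 0%N omega) k ord0 * bias n mi0 (X 0%N omega))) ord0 ord0) ^+ 2
     * w x).

(* The conditional mean squared errors given the design are determined up to a
   null set for each x; a choice of versions has to be jointly measurable in x
   and the design for its integral over x to make sense. *)
Definition conditional_mse (supp : set 'rV[R]_d) (mu : 'rV[R]_d -> R)
    (q : multi_index d)
    (mse : forall n, 'rV[R]_d * n.-tuple 'rV[R]_d -> \bar R) : Prop :=
  forall n, measurable_fun setT (mse n) /\
    forall x, supp x ->
      cond_expectation P (design n)
        (fun omega =>
           ((ls_estimator q n x omega - partial_in supp q mu x) ^+ 2)%:E)
        (fun t => mse n (x, t)).

End estimator.
End assumptions.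

(* Main.v *)
Require Import Defs.
From HB Require Import structures.
From mathcomp Require Import all_boot all_order all_algebra finmap.
From mathcomp Require Import all_classical all_reals all_analysis measurable_realfun.
From mathcomp Require Import ring lra.
Import Order.TTheory GRing.Theory Num.Theory.
Import numFieldNormedType.Exports.

Set Implicit Arguments.
Unset Strict Implicit.
Unset Printing Implicit Defensive.

Local Open Scope classical_set_scope.
Local Open Scope ring_scope.

(** Given the design, the estimator at x is a linear form in the observations, with
    coefficients that depend on the design. The residuals are centered and
    uncorrelated given the whole design, because each is independent of the other
    observations, so the conditional mean squared error at x is
      n^-1 psi(x)' Gh^-1 Sh Gh^-1 psi(x) + (conditional bias at x)^2,
    where psi is the derivative of the basis, Gh the empirical Gram matrix of the
    basis and Sh the one weighted by the conditional variance
    ([conditional_square], [conditional_square_error]). This holds for each x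
    outside a null set of designs; Tonelli's theorem turns it into a statement on
    almost every x for almost every design ([ae_ae]), which may be integrated
    ([imse_decomposition]). The theorem compares both parts with the expressions in
    which Gh and Sh are replaced by their expectations G and S.

    Everything rests on the locality of the basis. The matrices have boundedly many
    nonzero entries in each row and column, so they are bounded by a multiple of
    h^d ([wgram_bound]), and the local lower bounds on the integrals of p p' add up
    to a bound below by a multiple of h^d ([wgram_coercive]) and to the bound
    K = O(h^-d) on the dimension ([basis_card_bound]). Each entry of Gh and of Sh is
    an average of independent copies of a bounded function that lives on boundedly
    many cells, hence has a variance O(h^d), and a Bernstein inequality bounds the
    probability of a deviation by delta h^d by 2 exp(- a n h^d) with a > 0 depending
    on delta ([local_deviation]). A union bound over O(K^2) entries leaves a
    probability that tends to zero, because log n = o(n h^d) and K = O(n)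
    ([good_design_probability], [exponential_tail]). Entrywise closeness is operator
    closeness, again by locality ([egram_close]).

    On such a good design the variance part differs from V by a factor close to one,
    by perturbation of inverses ([design_variance]). For the bias, least squares
    reproduces the approximating spline exactly; what remains is the leading bias of
    the derivative minus the empirical projection of the leading bias of the
    function, and a remainder that is o(h^m) before differentiation owing to the
    exponent rho > 0 ([spline_error]). The empirical projection is close to the
    projection in expectation, so the integrated squared bias is close to Bias
    ([design_bias_le]). As delta is arbitrary, the differences are of smaller order
    in probability ([good_event], [imse_expansion]).

    The orders of V and Bias follow from the bounds on G and S from above and below
    ([leading_variance_upper], [leading_variance_lower], [bias_upper]).

    Functions are controlled only on the open cells, where one-sided limits of
    derivatives are values. Their union has full measure in the support, because
    polyhedral sets have null boundaries ([uncovered_null]), and regressors are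
    almost surely in it ([design_in_cells]). *)

(** * Integrals: null sets and transfer between spaces *)

Section null_sets.
Context {d : measure_display} {T : measurableType d} {R : realType}.
Variable mu : {measure set T -> \bar R}.
Import HBNNSimple.

Let lower (g : T -> \bar R) := ereal_sup [set sintegral mu h | h in
  [set h : {nnsfun T >-> R} | forall x, ((h x)%:E <= g x)%E]].

Let le_lower_null (N : set T) (g g' : T -> \bar R) :
  measurable N -> mu N = 0%E -> (forall x, 0 <= g' x)%E ->
  (forall x, ~ N x -> g x = g' x) -> (lower g <= lower g')%E.
Proof.
move=> mN N0 g'0 gg'; apply: ge_ereal_sup => _ [h /= hg <-].
pose h' : {nnsfun T >-> R} := proj_nnsfun h (measurableC mN).
apply: ereal_sup_ubound; exists h' => /=.
  move=> x; rewrite mindicE; case: (boolP (x \in ~` N)).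
    by rewrite inE => Nx; rewrite mulr1 -gg'.
  by rewrite mulr0.
rewrite -!integralT_nnsfun; apply: ge0_ae_eq_integral => //.
- by apply/measurable_EFinP; exact: measurable_funP.
- by apply/measurable_EFinP; exact: measurable_funP.
- by move=> x _; rewrite lee_fin.
- by move=> x _; rewrite lee_fin.
exists N; split => // x /= xN; apply: contrapT => Nx; apply: xN => _.
by rewrite mindicE mem_set// mulr1.
Qed.

(** The integral of a function is unaffected by a null set even if the function
    is not measurable, because the simple functions below it may be cut off on
    that set. *)
Lemma integral_off_null (N D D' : set T) (f f' : T -> \bar R) :
  measurable N -> mu N = 0%E ->
  (forall x, ~ N x -> (f \_ D) x = (f' \_ D') x) ->
  (\int[mu]_(x in D) f x = \int[mu]_(x in D') f' x)%E.
Proof.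
move=> mN N0 ff'; rewrite /integral; congr (_ - _)%E.
  by apply/eqP; rewrite eq_le; apply/andP; split;
    apply: (le_lower_null mN N0) => // x Nx; rewrite ?funeposE ?ff'.
by apply/eqP; rewrite eq_le; apply/andP; split;
  apply: (le_lower_null mN N0) => // x Nx; rewrite ?funenegE ?ff'.
Qed.

Lemma Rintegral_off_null (N D D' : set T) (f f' : T -> R) :
  measurable N -> mu N = 0%E ->
  (forall x, ~ N x -> (f \_ D) x = (f' \_ D') x) ->
  \int[mu]_(x in D) f x = \int[mu]_(x in D') f' x.
Proof.
move=> mN N0 ff'; rewrite /Rintegral; congr fine.
apply: (integral_off_null mN N0) => x Nx.
have E (A : set T) (g : T -> R) :
  ((fun z => (g z)%:E) \_ A) x = ((g \_ A) x)%:E :> \bar R.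
  by rewrite !patchE; case: ifP.
by rewrite !E ff'.
Qed.

Lemma Rintegral_setD_null (N D : set T) (f : T -> R) :
  measurable N -> mu N = 0%E ->
  \int[mu]_(x in D) f x = \int[mu]_(x in D `\` N) f x.
Proof.
move=> mN N0; apply: (Rintegral_off_null mN N0) => x Nx.
rewrite !patchE; congr (if _ then _ else _).
by apply/idP/idP => /set_mem H; apply/mem_set => //; case: H.
Qed.

End null_sets.

Section transfer.
Context {d d1 d2 : measure_display} {T : measurableType d}
  {T1 : measurableType d1} {T2 : measurableType d2} {R : realType}.
Variables (mu1 : {measure set T1 -> \bar R}) (mu2 : {measure set T2 -> \bar R}).
Import HBNNSimple.

Let integral_simple d' (T' : measurableType d')
    (mu : {measure set T' -> \bar R}) (phi : T' -> R) (Z : T' -> T)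
    (h : {nnsfun T >-> R}) :
  measurable_fun setT phi -> (forall x, 0 <= phi x) -> measurable_fun setT Z ->
  (\int[mu]_x (phi x * h (Z x))%:E =
   \sum_(y \in range h) y%:E *
     \int[mu]_x (phi x * \1_(h @^-1` [set y]) (Z x))%:E)%E.
Proof.
move=> mphi phi0 mZ.
have mI (y : R) : measurable_fun setT
    (fun x => phi x * \1_(h @^-1` [set y]) (Z x)).
  apply: measurable_funM => //; apply: measurableT_comp => //.
transitivity (\int[mu]_x (\sum_(y \in range h)
    (y * (phi x * \1_(h @^-1` [set y]) (Z x)))%:E))%E.
  apply: eq_integral => x _; rewrite fsumEFin//; congr EFin.
  rewrite {1}(fimfunE h (Z x)) mulr_fsumr//.
  by apply: eq_fsbigr => y _; rewrite mulrCA.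
rewrite ge0_integral_fsum//; last 2 first.
- by move=> y; apply/measurable_EFinP; apply: measurable_funM.
- move=> y x _; rewrite lee_fin.
  have [y0|y0] := leP 0 y; first by rewrite mulr_ge0// mulr_ge0.
  rewrite indicE memNset ?mulr0 ?mulr0// => /= hy.
  by have : 0 <= h (Z x) by []; rewrite hy leNgt y0.
apply: eq_fsbigr => y; rewrite inE => -[z _ <-].
by under eq_integral do rewrite EFinM; rewrite ge0_integralZl_EFin//;
  [move=> x _; rewrite lee_fin mulr_ge0|apply/measurable_EFinP].
Qed.

(** Two weighted laws that agree on measurable sets integrate nonnegative
    functions alike. Changes of variables and factorizations of expectations are
    instances. *)
Lemma integral_transfer (phi1 : T1 -> R) (phi2 : T2 -> R) (Z1 : T1 -> T)
    (Z2 : T2 -> T) (g : T -> R) :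
  measurable_fun setT phi1 -> (forall x, 0 <= phi1 x) -> measurable_fun setT Z1 ->
  measurable_fun setT phi2 -> (forall x, 0 <= phi2 x) -> measurable_fun setT Z2 ->
  (forall A, measurable A ->
    (\int[mu1]_x (phi1 x * \1_A (Z1 x))%:E =
     \int[mu2]_x (phi2 x * \1_A (Z2 x))%:E)%E) ->
  measurable_fun setT g -> (forall x, 0 <= g x) ->
  (\int[mu1]_x (phi1 x * g (Z1 x))%:E = \int[mu2]_x (phi2 x * g (Z2 x))%:E)%E.
Proof.
move=> mphi1 phi10 mZ1 mphi2 phi20 mZ2 H mg g0.
have mg' : measurable_fun setT (EFin \o g) by exact/measurable_EFinP.
pose h := nnsfun_approx measurableT mg'.
have hg x : EFin \o h ^~ x @ \oo --> (g x)%:E.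
  by apply: (cvg_nnsfun_approx measurableT mg') => // y _; rewrite lee_fin.
have lim_h d' (T' : measurableType d') (mu : {measure set T' -> \bar R})
    (phi : T' -> R) (Z : T' -> T) : measurable_fun setT phi ->
    (forall x, 0 <= phi x) -> measurable_fun setT Z ->
    ((\int[mu]_x (phi x * h n (Z x))%:E)%E @[n --> \oo] -->
    (\int[mu]_x (phi x * g (Z x))%:E)%E).
  move=> mphi phi0 mZ.
  rewrite [X in _ --> X](_ : _ = (\int[mu]_x
      (limn (fun n => (phi x * h n (Z x))%:E)))%E).
    apply: cvg_monotone_convergence => //.
    - move=> n; apply/measurable_EFinP; apply: measurable_funM => //.
      by apply: measurableT_comp => //.
    - by move=> n x _; rewrite lee_fin mulr_ge0.
    - move=> x _ m n mn; rewrite lee_fin ler_wpM2l//.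
      by have /lefP := nd_nnsfun_approx measurableT mg' mn; exact.
  apply: eq_integral => x _; apply/esym/cvg_lim => //.
  by have := cvgeZl (y := (phi x)%:E) isT (hg (Z x)).
have /cvg_lim <- // := lim_h _ _ mu1 _ _ mphi1 phi10 mZ1.
have /cvg_lim <- // := lim_h _ _ mu2 _ _ mphi2 phi20 mZ2.
congr (limn _); apply/funext => n; rewrite !integral_simple//.
by apply: eq_fsbigr => y _; rewrite H.
Qed.

End transfer.

(** * Independence: expectations of products *)

Section product_expectation.
Context {R : realType} {disp : measure_display} {Omega : measurableType disp}.
Variable P : probability Omega R.
Context {dT : measure_display} {T : measurableType dT}.
Variable Z : nat -> Omega -> T.
Hypothesis mZ : forall i, measurable_fun setT (Z i).
Hypothesis iidZ : iid P Z.

Let indic_prod (r : seq nat) (A : nat -> set T) : uniq r ->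
  (forall i, measurable (A i)) ->
  (\int[P]_omega (\prod_(i <- r) \1_(A i) (Z i omega) : R)%:E =
   \prod_(i <- r) P (Z i @^-1` A i))%E.
Proof.
move=> ur mA; pose J := [fset x in r]%fset.
have rJ : perm_eq r J.
  by apply: uniq_perm; rewrite ?fset_uniq// => i; rewrite in_fset.
rewrite (perm_big _ rJ)/= -(iidZ.1 J)//.
rewrite -[X in P X]setIT -integral_indic//; last first.
  apply: fin_bigcap_measurable => // i _.
  by rewrite -[X in measurable X]setTI; exact: mZ.
apply: eq_integral => w _; congr EFin.
rewrite indicE; have [|] := boolP (w \in _).
  rewrite inE => H; rewrite (perm_big _ rJ)/= big_seq big1// => i iJ.
  by rewrite indicE mem_set//; exact: H.
move=> H; have [i ir Ni] : exists2 i, i \in r & ~ A i (Z i w).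
  apply: contrapT => H'; move/negP: H; apply; rewrite inE => i /= iJ.
  apply: contrapT => NA; apply: H'; exists i => //.
  by rewrite (perm_mem rJ).
by rewrite (big_rem i)//= indicE memNset// mul0r.
Qed.

Let measurable_prod_seq (s : seq nat) (g : nat -> T -> R) :
  (forall i, measurable_fun setT (g i)) ->
  measurable_fun setT (fun w => \prod_(i <- s) g i (Z i w)).
Proof.
by move=> mg; apply: measurable_prod => i _; exact: measurableT_comp.
Qed.

(** Indicators are replaced by general factors one at a time, each step being a
    transfer between the law of one variable weighted by the other factors and
    the same law with a constant weight. *)
Let expectation_mixed (s r : seq nat) (g : nat -> T -> R) (A : nat -> set T) :
  uniq (s ++ r) -> (forall i, measurable (A i)) ->
  (forall i, measurable_fun setT (g i)) -> (forall i x, 0 <= g i x) ->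
  (forall i, \int[P]_w (g i (Z i w))%:E < +oo)%E ->
  (\int[P]_w ((\prod_(i <- s) g i (Z i w)) * \prod_(i <- r) \1_(A i) (Z i w))%:E =
   (\prod_(i <- s) \int[P]_w g i (Z i w))%:E * \prod_(i <- r) P (Z i @^-1` A i))%E.
Proof.
move=> + + mg g0 goo; elim: s r A => [|i s ih] r A.
  move=> /= ur mA; rewrite big_nil mul1e -indic_prod//.
  by apply: eq_integral => w _; rewrite big_nil mul1r.
rewrite cat_cons cons_uniq mem_cat negb_or => /andP[/andP[si ri] usr] mA.
pose phi w : R := (\prod_(j <- s) g j (Z j w)) * \prod_(j <- r) \1_(A j) (Z j w).
have mphi : measurable_fun setT phi.
  apply: measurable_funM; first exact: measurable_prod_seq.
  by apply: (@measurable_prod_seq r (fun j => \1_(A j))) => j; exact: measurable_indic.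
have phi0 w : 0 <= phi w by rewrite mulr_ge0// prodr_ge0.
have phiE := ih _ _ usr mA.
have phioo : (\int[P]_w (phi w)%:E)%E \is a fin_num.
  by rewrite phiE fin_numM//; apply: prode_fin_num => j _; apply: fin_num_measure;
    rewrite -[X in measurable X]setTI; exact: mZ.
transitivity (\int[P]_w (fine (\int[P]_w (phi w)%:E) * g i (Z i w))%:E)%E.
  transitivity (\int[P]_w (phi w * g i (Z i w))%:E)%E.
    by apply: eq_integral => w _; rewrite big_cons /phi -mulrA mulrC.
  apply: (integral_transfer (phi2 := cst (fine (\int[P]_w (phi w)%:E)%E))) => //.
    by move=> _ /=; rewrite fine_ge0// integral_ge0// => w _; rewrite lee_fin.
  move=> B mB /=; pose A' j := if j == i then B else A j.
  have usir : uniq (s ++ i :: r).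
    by rewrite uniq_catC/= mem_cat negb_or ri si/= uniq_catC.
  have mA' j : measurable (A' j) by rewrite /A'; case: ifP.
  have A'r (h : set T -> nat -> \bar R) :
      (\prod_(j <- r) h (A' j) j = \prod_(j <- r) h (A j) j)%E.
    apply: eq_big_seq => j jr; rewrite /A'; case: eqP => // ji.
    by move: ri; rewrite -ji jr.
  have A'r' w : \prod_(j <- r) \1_(A' j) (Z j w) =
      \prod_(j <- r) \1_(A j) (Z j w) :> R.
    apply: eq_big_seq => j jr; rewrite /A'; case: eqP => // ji.
    by move: ri; rewrite -ji jr.
  have := ih (i :: r) A' usir mA'.
  under eq_integral => w _.
    rewrite big_cons A'r' mulrCA mulrC -/(phi w) {1}/A' eqxx. over.
  move=> ->; rewrite big_cons (A'r (fun B j => P (Z j @^-1` B))) {1}/A' eqxx.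
  rewrite muleCA -phiE.
  under [RHS]eq_integral do rewrite EFinM.
  rewrite ge0_integralZl_EFin//; last 2 first.
  - apply/measurable_EFinP; apply: measurableT_comp => //.
  - by rewrite fine_ge0// integral_ge0// => w _; rewrite lee_fin.
  rewrite fineK// muleC; congr (_ * _)%E.
  rewrite (_ : (fun x => _) = EFin \o \1_(Z i @^-1` B))//.
  rewrite integral_indic// ?setIT//.
  by rewrite -[X in measurable X]setTI; exact: mZ.
under eq_integral do rewrite EFinM.
rewrite ge0_integralZl_EFin//; last 3 first.
- by move=> w _; rewrite lee_fin.
- by apply/measurable_EFinP; exact: measurableT_comp.
- by rewrite fine_ge0// integral_ge0// => w _; rewrite lee_fin.
rewrite fineK// phiE big_cons EFinM [in RHS]/Rintegral fineK; last first.
  by rewrite ge0_fin_numE// integral_ge0// => w _; rewrite lee_fin.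
by rewrite muleC muleA.
Qed.

Lemma expectation_prod (s : seq nat) (g : nat -> T -> R) : uniq s ->
  (forall i, measurable_fun setT (g i)) -> (forall i x, 0 <= g i x) ->
  (forall i, \int[P]_w (g i (Z i w))%:E < +oo)%E ->
  (\int[P]_w (\prod_(i <- s) g i (Z i w))%:E =
   (\prod_(i <- s) \int[P]_w g i (Z i w))%:E)%E.
Proof.
move=> us mg g0 goo.
have := @expectation_mixed s [::] g (fun=> setT); rewrite cats0 => /(_ us).
move=> /(_ (fun=> measurableT) mg g0 goo).
rewrite big_nil mule1 => <-.
by apply: eq_integral => w _; rewrite big_nil mulr1.
Qed.

End product_expectation.

(** * Bounded measurable functions *)

Section bounded_measurable.
Context {d : measure_display} {T : measurableType d} {R : realType}.
Implicit Types (D : set T) (f g : T -> R).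

Definition bounded_measurable D f : Prop :=
  measurable_fun D f /\ exists C : R, forall x, D x -> `|f x| <= C.

Lemma bm_cst D (c : R) : bounded_measurable D (cst c).
Proof. by split => //; exists `|c|. Qed.

Lemma bmD D f g : bounded_measurable D f -> bounded_measurable D g ->
  bounded_measurable D (fun x => f x + g x).
Proof.
move=> [mf [C hC]] [mg [E hE]]; split; first exact: measurable_funD.
exists (C + E) => x Dx; rewrite (le_trans (ler_normD _ _))// lerD//.
  exact: hC.
exact: hE.
Qed.

Lemma bmM D f g : bounded_measurable D f -> bounded_measurable D g ->
  bounded_measurable D (fun x => f x * g x).
Proof.
move=> [mf [C hC]] [mg [E hE]]; split; first exact: measurable_funM.
by exists (C * E) => x Dx; rewrite normrM ler_pM ?hC ?hE.
Qed.

Lemma bmN D f : bounded_measurable D f -> bounded_measurable D (fun x => - f x).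
Proof.
move=> [mf [C hC]]; split; first exact: measurableT_comp.
by exists C => x Dx; rewrite normrN hC.
Qed.

Lemma bmB D f g : bounded_measurable D f -> bounded_measurable D g ->
  bounded_measurable D (fun x => f x - g x).
Proof. by move=> bf bg; apply: bmD => //; exact: bmN. Qed.

Lemma bmX D f k : bounded_measurable D f ->
  bounded_measurable D (fun x => f x ^+ k).
Proof.
move=> bf; elim: k => [|k ih].
  under [X in bounded_measurable D X]eq_fun do rewrite expr0.
  exact: bm_cst.
under [X in bounded_measurable D X]eq_fun do rewrite exprS.
exact: bmM.
Qed.

Lemma bm_sum D (I : Type) (s : seq I) (Q : pred I) (f : I -> T -> R) :
  (forall i, Q i -> bounded_measurable D (f i)) ->
  bounded_measurable D (fun x => \sum_(i <- s | Q i) f i x).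
Proof.
move=> bf; elim: s => [|i s ih].
  under [X in bounded_measurable D X]eq_fun do rewrite big_nil.
  exact: bm_cst.
under [X in bounded_measurable D X]eq_fun do rewrite big_cons.
case: (boolP (Q i)) => // Qi; apply: bmD => //; exact: bf.
Qed.

Lemma bm_eq D f g : (forall x, D x -> f x = g x) -> bounded_measurable D f ->
  bounded_measurable D g.
Proof.
move=> fg [mf [C hC]]; split.
  by apply: eq_measurable_fun mf => x /set_mem; exact: fg.
by exists C => x Dx; rewrite -fg// hC.
Qed.

Lemma bm_subset D D' f : measurable D -> measurable D' -> D' `<=` D ->
  bounded_measurable D f -> bounded_measurable D' f.
Proof.
move=> mD mD' DD' [mf [C hC]]; split; first exact: measurable_funS mf.
by exists C => x /DD'; exact: hC.
Qed.

Variable mu : {measure set T -> \bar R}.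

Lemma bm_integrable D f : measurable D -> (mu D < +oo)%E ->
  bounded_measurable D f -> mu.-integrable D (EFin \o f).
Proof.
move=> mD muD [mf [C hC]]; apply/integrableP; split.
  exact/measurable_EFinP.
have [D0|/set0P[x0 Dx0]] := eqVneq D set0; first by rewrite D0 integral_set0.
have C0 : 0 <= C := le_trans (normr_ge0 _) (hC _ Dx0).
apply: (@le_lt_trans _ _ (C%:E * mu D)%E); last by rewrite lte_mul_pinfty.
apply: integral_le_bound => //; first exact/measurable_EFinP.
by apply: aeW => x Dx; rewrite lee_fin hC.
Qed.

Lemma Rintegral_sum D (I : Type) (s : seq I) (Q : pred I) (f : I -> T -> R) :
  measurable D -> (mu D < +oo)%E -> (forall i, Q i -> bounded_measurable D (f i)) ->
  \int[mu]_(x in D) (\sum_(i <- s | Q i) f i x) =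
  \sum_(i <- s | Q i) \int[mu]_(x in D) f i x.
Proof.
move=> mD muD bf; elim: s => [|i s ih].
  rewrite big_nil; under eq_Rintegral do rewrite big_nil.
  by rewrite Rintegral_cst// mul0r.
rewrite big_cons; under eq_Rintegral do rewrite big_cons.
case: ifP => // Qi; rewrite RintegralD// ?ih//.
  exact/bm_integrable/bf.
exact/bm_integrable/bm_sum.
Qed.

Lemma le_Rintegral_bm D f g : measurable D -> (mu D < +oo)%E ->
  bounded_measurable D f -> bounded_measurable D g ->
  (forall x, D x -> f x <= g x) ->
  \int[mu]_(x in D) f x <= \int[mu]_(x in D) g x.
Proof. by move=> mD muD bf bg; apply: le_Rintegral => //; exact: bm_integrable. Qed.

End bounded_measurable.

Ltac bm := repeat first
  [ assumption | exact: bm_cst | apply: bmX | apply: bmB | apply: bmN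
  | apply: bmD | apply: bmM ].

(** * A Bernstein inequality *)

Lemma expR_le_quadratic {R : realType} (u : R) : `|u| <= 1 / 2 ->
  expR u <= 1 + u + 2 * u ^+ 2.
Proof.
rewrite ler_norml => /andP[u1 u2].
have e0 : 0 < 1 - u by lra.
have : expR u <= (1 - u)^-1.
  rewrite -[expR u]invrK lef_pV2 ?posrE ?invr_gt0 ?expR_gt0//.
  by rewrite -expRN expR_ge1Dx.
move=> /le_trans; apply; rewrite -(ler_pM2r e0) mulVf ?gt_eqF//.
have := sqr_ge0 u; nra.
Qed.

Lemma measurable_lt_set {R : realType} {d : measure_display}
    {T : measurableType d} (f g : T -> R) :
  measurable_fun setT f -> measurable_fun setT g ->
  measurable [set x | f x < g x].
Proof.
move=> mf mg; rewrite -[X in measurable X]setTI.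
have := @measurable_lte _ _ _ setT measurableT (EFin \o f) (EFin \o g).
by apply; exact/measurable_EFinP.
Qed.

Lemma probability_finite {R : realType} {disp : measure_display}
    {Omega : measurableType disp} (P : probability Omega R) : (P setT < +oo)%E.
Proof. by rewrite probability_setT ltry. Qed.

Section bernstein.
Context {R : realType} {disp : measure_display} {Omega : measurableType disp}.
Variable P : probability Omega R.
Context {dT : measure_display} {T : measurableType dT}.
Variable Z : nat -> Omega -> T.
Hypothesis mZ : forall i, measurable_fun setT (Z i).
Hypothesis iidZ : iid P Z.

Let PT := probability_finite P.

Lemma iid_expectation i (g : T -> R) : measurable_fun setT g ->
  (forall x, 0 <= g x) ->
  (\int[P]_w (g (Z i w))%:E = \int[P]_w (g (Z 0%N w))%:E)%E.
Proof.
move=> mg g0.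
transitivity (\int[P]_w (cst 1 w * g (Z i w))%:E)%E.
  by apply: eq_integral => w _; rewrite mul1r.
rewrite (integral_transfer (mu2 := P) (phi2 := cst 1) (Z2 := Z 0%N))//.
  by apply: eq_integral => w _; rewrite mul1r.
move=> A mA.
have E k : (\int[P]_x (cst 1 x * \1_A (Z k x))%:E = P (Z k @^-1` A))%E.
  rewrite -[X in P X]setIT -integral_indic//; last first.
    by rewrite -[X in measurable X]setTI; exact: mZ.
  by apply: eq_integral => w _; rewrite mul1r.
by rewrite !E (iidZ.2 i).
Qed.

Variables (phi : T -> R) (b v lam : R).
Hypotheses (mphi : measurable_fun setT phi) (phib : forall x, `|phi x| <= b).
Hypothesis phiv : \int[P]_w (phi (Z 0%N w)) ^+ 2 <= v.
Hypotheses (lam0 : 0 < lam) (lamb : lam * b <= 1 / 2).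

Let bphi i : bounded_measurable setT (fun w => phi (Z i w)).
Proof. by split; [exact: measurableT_comp|exists b => w _]. Qed.

Let bexp i : bounded_measurable setT (fun w => expR (lam * phi (Z i w))).
Proof.
split.
  apply: measurableT_comp => //; apply: measurable_funM => //.
  exact: measurableT_comp.
exists (expR (lam * b)) => w _; rewrite ger0_norm ?expR_ge0// ler_expR.
by rewrite ler_pM2l// (le_trans (ler_norm _)).
Qed.

Let mgf_le : \int[P]_w expR (lam * phi (Z 0%N w)) <=
  expR (lam * (\int[P]_w phi (Z 0%N w)) + 2 * lam ^+ 2 * v).
Proof.
apply: (@le_trans _ _
  (\int[P]_w (1 + lam * phi (Z 0%N w) + 2 * lam ^+ 2 * (phi (Z 0%N w)) ^+ 2))).
  apply: le_Rintegral_bm => //.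
    by bm.
  move=> w _; rewrite (le_trans (expR_le_quadratic _))//.
    rewrite normrM gtr0_norm// (le_trans _ lamb)// ler_pM2l//.
  by rewrite exprMn mulrA.
rewrite !RintegralD//; first last.
- by apply: bm_integrable => //; bm.
- by apply: bm_integrable => //; bm.
- by apply: bm_integrable => //; bm.
- by apply: bm_integrable => //; bm.
have -> : \int[P]__ (1 : R) = 1.
  transitivity (1 * fine (P setT)); first exact: Rintegral_cst.
  by rewrite probability_setT mul1r.
rewrite RintegralZl//; last exact: bm_integrable.
rewrite RintegralZl//; last by apply: bm_integrable => //; exact: bmX.
apply: le_trans (expR_ge1Dx _); rewrite addrA lerD2l ler_wpM2l//.
by rewrite mulr_ge0// exprn_ge0// ltW.
Qed.

(** Markov's inequality for the exponential of the sum, whose expectation factors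
    by independence; each factor is bounded through the quadratic bound on exp. *)
Lemma chernoff (n : nat) (t : R) : (P [set w |
    (n%:R * (\int[P]_w phi (Z 0%N w) + t) <= \sum_(i < n) phi (Z i w))%R] <=
  (expR (- (n%:R * (lam * t - 2 * lam ^+ 2 * v))))%:E)%E.
Proof.
set E := \int[P]_w phi (Z 0%N w).
set W := fun w => \prod_(i <- iota 0 n) expR (lam * phi (Z i w)).
have WE w : W w = expR (lam * \sum_(i < n) phi (Z i w)).
  rewrite /W -{1}[n]subn0 -/(index_iota 0 n) big_mkord mulr_sumr.
  by rewrite expR_sum.
have mW : measurable_fun setT W.
  by apply: measurable_prod => i _; exact: (bexp i).1.
pose a := expR (lam * (n%:R * (E + t))).
have a0 : 0 < a by exact: expR_gt0.
have := @le_integral_abse _ _ _ P setT measurableT (EFin \o W) a.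
have mEW : measurable_fun setT (EFin \o W) by exact/measurable_EFinP.
move=> /(_ mEW a0); rewrite setTI.
under eq_integral do rewrite /= ger0_norm ?WE ?expR_ge0// -WE.
rewrite (@expectation_prod _ _ _ P _ _ Z mZ iidZ (iota 0 n)
  (fun _ x => expR (lam * phi x)))//; last 3 first.
- exact: iota_uniq.
- move=> _; apply: measurableT_comp => //; exact: measurable_funM.
- move=> i; have /integrableP[_] := bm_integrable measurableT PT (bexp i).
  by under eq_integral do rewrite /= ger0_norm ?expR_ge0//.
have -> : [set w | n%:R * (E + t) <= \sum_(i < n) phi (Z i w)] =
    [set w | (a%:E <= `|(EFin \o W) w|)%E].
  apply/seteqP; split => w /=; rewrite lee_fin ger0_norm ?WE ?expR_ge0//
    ler_expR ler_pM2l//.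
move=> H; rewrite -(@lee_pmul2l _ a%:E)// ?lte_fin//.
apply: (le_trans H); rewrite -EFinM lee_fin.
apply: (@le_trans _ _ (\prod_(i <- iota 0 n)
  expR (lam * E + 2 * lam ^+ 2 * v))).
  apply: ler_prod => i _; rewrite Rintegral_ge0/=; last by move=> ? _; exact: expR_ge0.
  rewrite {1}/Rintegral (@iid_expectation i (fun x => expR (lam * phi x)))//.
  by apply: measurableT_comp => //; exact: measurable_funM.
rewrite -{1}[n]subn0 -/(index_iota 0 n) big_mkord prodr_const card_ord.
rewrite -expRM_natl -expRD ler_expR.
by rewrite le_eqVlt; apply/orP; left; apply/eqP; ring.
Qed.
End bernstein.

Section two_sided.
Context {R : realType} {disp : measure_display} {Omega : measurableType disp}.
Variable P : probability Omega R.
Context {dT : measure_display} {T : measurableType dT}.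

(** The tails of phi and of - phi together. The parameter lam stays free, so that
    an application can balance it against the range b and the second moment v. *)
Lemma bernstein_deviation (Z : nat -> Omega -> T) (phi : T -> R) (b v lam t : R)
    (n : nat) :
  (forall i, measurable_fun setT (Z i)) -> iid P Z ->
  measurable_fun setT phi -> (forall x, `|phi x| <= b) ->
  \int[P]_w (phi (Z 0%N w)) ^+ 2 <= v -> 0 < lam -> lam * b <= 1 / 2 ->
  (0 < n)%N ->
  (P [set w | (t < `|n%:R^-1 * \sum_(i < n) phi (Z i w) -
                    \int[P]_w phi (Z 0%N w)|)%R] <=
   (2 * expR (- (n%:R * (lam * t - 2 * lam ^+ 2 * v))))%:E)%E.
Proof.
move=> mZ iidZ mphi phib phiv lam0 lamb n0.
set E := \int[P]_w phi (Z 0%N w).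
have n0' : 0 < n%:R :> R by rewrite ltr0n.
have U := chernoff mZ iidZ mphi phib phiv lam0 lamb n t.
have mphiN : measurable_fun setT (fun x => - phi x) by exact: measurableT_comp.
have phiNb x : `|- phi x| <= b by rewrite normrN.
have phiNv : \int[P]_w (- phi (Z 0%N w)) ^+ 2 <= v.
  by under eq_Rintegral do rewrite sqrrN.
have L := chernoff mZ iidZ mphiN phiNb phiNv lam0 lamb n t.
have mS : measurable_fun setT (fun w => \sum_(i < n) phi (Z i w)).
  by apply: measurable_sum => i; exact: measurableT_comp.
have intphi : P.-integrable setT (EFin \o (fun w => phi (Z 0%N w))).
  apply: bm_integrable => //; first exact: probability_finite.
  by split; [exact: measurableT_comp|exists b].
have NE : \int[P]_w (- phi (Z 0%N w)) = - E.
  under eq_Rintegral do rewrite -mulN1r.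
  by rewrite RintegralZl// mulN1r.
have mle (a : R) (g : Omega -> R) : measurable_fun setT g ->
    measurable [set w | a <= g w].
  move=> mg; rewrite -[X in measurable X]setTI.
  by apply: (measurable_fun_le measurableT (measurable_cst _) mg).
set A := [set w | n%:R * (E + t) <= \sum_(i < n) phi (Z i w)] in U.
set B := [set w | n%:R * (- E + t) <= \sum_(i < n) - phi (Z i w)].
have mA : measurable A by exact: mle.
have mB : measurable B.
  by apply: mle; apply: measurable_sum => i; apply: measurableT_comp => //;
    exact: measurableT_comp.
rewrite NE -/B in L.
apply: (@le_trans _ _ (P (A `|` B))).
  apply: le_measure; rewrite ?inE.
  - have mdev : measurable_fun setT
        (fun w => `|n%:R^-1 * \sum_(i < n) phi (Z i w) - E|).
      apply: measurableT_comp => //; apply: measurable_funB => //.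
      exact: measurable_funM.
    exact: (measurable_lt_set (f := cst t)).
  - exact: measurableU.
  - move=> w /=; rewrite /A /B /= sumrN.
    set x := n%:R^-1 * _.
    have -> : \sum_(i < n) phi (Z i w) = n%:R * x by rewrite mulVKf// gt_eqF.
    rewrite -mulrN !ler_pM2l//.
    by rewrite ltr_normr => /orP[tx|tx]; [left|right]; lra.
apply: (le_trans (measureU2 _ _ _)) => //.
by rewrite mulr_natl mulr2n EFinD leeD.
Qed.

End two_sided.

(** * Residuals that are centered given the design *)

Section centered.
Context {R : realType} {disp : measure_display} {Omega : measurableType disp}.
Variable P : probability Omega R.
Context {dS : measure_display} {S : measurableType dS}.
Implicit Types (V : Omega -> S) (xi : Omega -> R).

(** This says E[xi | V] = 0; comparing the two parts of xi keeps all integrands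
    nonnegative, as transfer arguments require. *)
Definition centered V xi : Prop :=
  P.-integrable setT (EFin \o xi) /\
  forall A, measurable A ->
    (\int[P]_(w in V @^-1` A) (xi^\+ w)%:E =
     \int[P]_(w in V @^-1` A) (xi^\- w)%:E)%E.

Let measurable_preimage V A : measurable_fun setT V -> measurable A ->
  measurable (V @^-1` A).
Proof. by move=> mV mA; rewrite -[X in measurable X]setTI; exact: mV. Qed.

Let parts_fin xi (B : set Omega) : measurable B ->
  P.-integrable setT (EFin \o xi) ->
  (\int[P]_(w in B) (xi^\+ w)%:E \is a fin_num)%E /\
  (\int[P]_(w in B) (xi^\- w)%:E \is a fin_num)%E.
Proof.
move=> mB ixi; have iB := integrableS measurableT mB (@subsetT _ B) ixi.
split; apply: integrable_fin_num => //.
  exact: integrable_funrpos.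
exact: integrable_funrneg.
Qed.

Lemma centeredP V xi : measurable_fun setT V ->
  P.-integrable setT (EFin \o xi) ->
  (forall A, measurable A -> (\int[P]_(w in V @^-1` A) (xi w)%:E = 0)%E) ->
  centered V xi.
Proof.
move=> mV ixi H; split => // A mA.
have mVA := measurable_preimage mV mA.
have [f1 f2] := parts_fin mVA ixi.
have := H A mA; rewrite integralE.
under eq_integral do rewrite -[(fun x => _)]/(EFin \o xi) funerpos.
under [X in (_ - X)%E]eq_integral do rewrite -[(fun x => _)]/(EFin \o xi) funerneg.
set a := (X in (X - _ = _)%E -> _); set c := (X in (_ - X = _)%E -> _).
rewrite -[X in _ -> X = _]/a -[X in _ -> _ = X]/c.
rewrite -(fineK f1 : _ = a) -(fineK f2 : _ = c) -EFinB.
by move=> -[] /eqP; rewrite subr_eq0 => /eqP ->.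
Qed.

(** The defining identity concerns indicators of events of V; transfer extends it
    to nonnegative psi, and adding a constant makes a bounded psi nonnegative. *)
Lemma centered_integral V xi (psi : S -> R) : measurable_fun setT V ->
  centered V xi -> bounded_measurable setT psi ->
  P.-integrable setT (EFin \o (fun w => psi (V w) * xi w)) /\
  \int[P]_w (psi (V w) * xi w) = 0.
Proof.
move=> mV [ixi H].
have mxi : measurable_fun setT xi by exact/measurable_EFinP/(measurable_int P).
have int_mul (g : S -> R) (zeta : Omega -> R) : bounded_measurable setT g ->
    P.-integrable setT (EFin \o zeta) ->
    P.-integrable setT (EFin \o (fun w => g (V w) * zeta w)).
  move=> [mg [C hC]] izeta.
  have mz : measurable_fun setT zeta by exact/measurable_EFinP/(measurable_int P).
  apply: (@le_integrable _ _ _ P _ measurableT _ (fun w => C%:E * (zeta w)%:E)%E).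
  - apply/measurable_EFinP; apply: measurable_funM => //.
    exact: measurableT_comp.
  - move=> w _ /=; rewrite lee_fin !normrM ler_wpM2r//.
    by rewrite (le_trans (hC _ I))// ler_norm.
  - exact: integrableZl.
have ge0_case (g : S -> R) : bounded_measurable setT g -> (forall x, 0 <= g x) ->
    \int[P]_w (g (V w) * xi w) = 0.
  move=> bg g0.
  have E : (\int[P]_w (xi^\+ w * g (V w))%:E = \int[P]_w (xi^\- w * g (V w))%:E)%E.
    apply: integral_transfer => //.
    - exact: measurable_funrpos.
    - exact: measurable_funrneg.
    - move=> A mA; move: (H A mA); rewrite !(integral_mkcond (V @^-1` A)) => E.
      transitivity (\int[P]_x (((fun w => (xi^\+ w)%:E) \_ (V @^-1` A)) x))%E.
        apply: eq_integral => w _; rewrite patchE indicE.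
        have -> : (w \in V @^-1` A) = (V w \in A) by apply/idP/idP; rewrite !inE.
        by case: (_ \in _); rewrite ?mulr1 ?mulr0.
      rewrite E; apply: eq_integral => w _; rewrite patchE indicE.
      have -> : (w \in V @^-1` A) = (V w \in A) by apply/idP/idP; rewrite !inE.
      by case: (_ \in _); rewrite ?mulr1 ?mulr0.
    - exact: bg.1.
  have -> : (fun w => g (V w) * xi w) =
      (fun w => g (V w) * xi^\+ w - g (V w) * xi^\- w).
    by apply/funext => w; rewrite -mulrBr -[in LHS](funrposBneg xi).
  rewrite RintegralB//; last 2 first.
  - by apply: int_mul => //; exact: integrable_funrpos.
  - by apply: int_mul => //; exact: integrable_funrneg.
  apply/eqP; rewrite subr_eq0 /Rintegral; apply/eqP; congr fine.
  under eq_integral do rewrite mulrC.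
  by under [RHS]eq_integral do rewrite mulrC.
move=> bpsi; split; first exact: int_mul.
have [mpsi [C hC]] := bpsi.
have bp : bounded_measurable setT (fun x => psi x + C) by bm.
have bc : bounded_measurable setT (fun _ : S => C) by bm.
have [x0|noS] := pselect (exists x : S, True); last first.
  rewrite (_ : (fun w => _) = cst 0); first by rewrite /Rintegral integral0.
  by apply/funext => w; exfalso; apply: noS; exists (V w).
have C0 : 0 <= C by case: x0 => x _; exact: le_trans (hC x I).
have := ge0_case _ bp; have /(_ (fun=> C0)) := ge0_case _ bc.
move=> E1 /(_ _)E2.
have {}E2 : \int[P]_w ((psi (V w) + C) * xi w) = 0.
  by apply: E2 => x; have := hC x I; rewrite ler_norml => /andP[]; lra.
have -> : (fun w => psi (V w) * xi w) =
    (fun w => (psi (V w) + C) * xi w - C * xi w).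
  by apply/funext => w; ring.
rewrite RintegralB ?E1 ?E2 ?subrr//.
- exact: (int_mul (fun x => psi x + C)).
- exact: (int_mul (fun x => C)).
Qed.

End centered.

Section rectangles.
Context {R : realType} {disp : measure_display} {Omega : measurableType disp}.
Variable P : probability Omega R.
Context {dS : measure_display} {S : measurableType dS}.
Variable n : nat.

Definition rectangle (B : nat -> set S) : set (n.-tuple S) :=
  [set t | forall l : 'I_n, B l (tnth t l)].

Lemma measurable_rectangle B : (forall l, measurable (B l)) ->
  measurable (rectangle B).
Proof.
move=> mB; rewrite (_ : rectangle B =
    \bigcap_(l in [set: 'I_n]) ((fun t : n.-tuple S => tnth t l) @^-1` B l)).
  apply: fin_bigcap_measurable => // l _.
  rewrite -[X in measurable X]setTI; exact: measurable_tnth.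
by apply/seteqP; split => [t tB l _|t tB l]; [exact: tB|exact: (tB l I)].
Qed.

(** The rectangles generate the sigma-algebra of n-tuples and are stable under
    intersection, and the sets with the required equality form a lambda-system. *)
Lemma centered_rectangles (V : Omega -> n.-tuple S) (xi : Omega -> R) :
  measurable_fun setT V -> P.-integrable setT (EFin \o xi) ->
  (forall B : nat -> set S, (forall l, measurable (B l)) ->
    (\int[P]_(w in V @^-1` rectangle B) (xi^\+ w)%:E =
     \int[P]_(w in V @^-1` rectangle B) (xi^\- w)%:E)%E) ->
  centered P V xi.
Proof.
move=> mV ixi H; split => //.
have mxi : measurable_fun setT xi by exact/measurable_EFinP/(measurable_int P).
have mp : measurable_fun setT (fun w => (xi^\+ w)%:E).
  by apply/measurable_EFinP; exact: measurable_funrpos.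
have mn : measurable_fun setT (fun w => (xi^\- w)%:E).
  by apply/measurable_EFinP; exact: measurable_funrneg.
have mpre A : measurable A -> measurable (V @^-1` A).
  by move=> mA; rewrite -[X in measurable X]setTI; exact: mV.
pose G := [set A : set (n.-tuple S) | measurable A /\
    (\int[P]_(w in V @^-1` A) (xi^\+ w)%:E =
     \int[P]_(w in V @^-1` A) (xi^\- w)%:E)%E].
pose C := [set A : set (n.-tuple S) |
  exists2 B : nat -> set S, (forall l, measurable (B l)) & A = rectangle B].
have CI : setI_closed C.
  move=> _ _ [B1 mB1 ->] [B2 mB2 ->]; exists (fun l => B1 l `&` B2 l).
    by move=> l; exact: measurableI.
  apply/seteqP; split=> [t [t1 t2] l|t t12]; first by split; [exact: t1|exact: t2].
  by split => l; have [] := t12 l.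
have GD : lambda_system setT G.
  split => //.
  - split => //.
    have := H (fun=> setT) (fun=> measurableT).
    by rewrite (_ : rectangle _ = setT)//; apply/seteqP.
  - move=> A B BA [mA EA] [mB EB]; split; first exact: measurableD.
    have mA' := mpre _ mA; have mB' := mpre _ mB.
    have mAB : measurable (V @^-1` (A `\` B)) by apply: mpre; exact: measurableD.
    have split_int (g : Omega -> R) : measurable_fun setT (EFin \o g) ->
        (forall w, 0 <= g w) -> (\int[P]_(w in V @^-1` A) (g w)%:E =
        \int[P]_(w in V @^-1` B) (g w)%:E +
        \int[P]_(w in V @^-1` (A `\` B)) (g w)%:E)%E.
      move=> mg g0; rewrite -ge0_integral_setU//.
      + congr (integral _ _ _); apply/seteqP; split => w /=.
          by move=> Aw; have [Bw|Bw] := pselect (B (V w)); [left|right].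
        by move=> [/BA|[]].
      + exact: measurable_funTS.
      + by move=> w _; rewrite lee_fin.
      + by apply/disj_setPS => w /= [? []].
    move: EA; rewrite !split_int//.
    rewrite EB addeC [in X in _ = X -> _]addeC.
    have fB : (\int[P]_(w in V @^-1` B) (xi^\- w)%:E \is a fin_num)%E.
      apply: integrable_fin_num => //; apply: integrable_funrneg => //.
      exact: integrableS ixi.
    by move=> /(congr1 (fun x => x - \int[P]_(w in V @^-1` B) (xi^\- w)%:E)%E);
      rewrite !addeK.
  - move=> F ndF GF; split; first by apply: bigcup_measurable => k _; have [] := GF k.
    rewrite preimage_bigcup.
    have ndVF : {homo (fun k => V @^-1` F k) : a b / (a <= b)%N >-> (a <= b)%O}.
      move=> a b ab; apply/subsetPset => w /=.
      by have /subsetPset := ndF _ _ ab; exact.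
    have mVF k : measurable (V @^-1` F k) by apply: mpre; have [] := GF k.
    have lim_int (g : Omega -> R) : measurable_fun setT (EFin \o g) ->
        (forall w, 0 <= g w) ->
        ((\int[P]_(w in V @^-1` F k) (g w)%:E)%E @[k --> \oo] -->
         (\int[P]_(w in \bigcup_k (V @^-1` F k)) (g w)%:E)%E).
      move=> mg g0; apply: ge0_nondecreasing_set_cvg_integral => //.
      + by move=> k; exact: measurable_funTS.
      + by move=> k w _; rewrite lee_fin.
    have /cvg_lim <- // := lim_int _ mp (funrpos_ge0 xi).
    have /cvg_lim <- // := lim_int _ mn (funrneg_ge0 xi).
    by congr (limn _); apply/funext => k; have [] := GF k.
have sub : measurable `<=` <<s C >>.
  apply: smallest_sub; first exact: smallest_sigma_algebra.
  move=> A /=; rewrite -bigcup_seq/= => -[i _ [B mB]].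
  rewrite setTI => <-; apply: sub_sigma_algebra.
  exists (fun l : nat => if l == i then B else setT) => [l|].
    by case: ifP.
  apply/seteqP; split => [t tB l|t tB] /=.
    by case: ifPn => // /eqP/val_inj ->.
  by have := tB i; rewrite eqxx.
move=> A mA; suff [] : G A by [].
apply: (lambda_system_subset CI GD) => //; last exact: sub.
by move=> _ [B mB ->]; split; [exact: measurable_rectangle|exact: H].
Qed.

End rectangles.

Section independent_factors.
Context {R : realType} {disp : measure_display} {Omega : measurableType disp}.
Variable P : probability Omega R.
Context {dT dS : measure_display} {T : measurableType dT} {S : measurableType dS}.
Variables (Z : nat -> Omega -> T) (pr : T -> S) (n : nat).
Hypotheses (mZ : forall i, measurable_fun setT (Z i)) (iidZ : iid P Z)
  (mpr : measurable_fun setT pr).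

Definition design_of (w : Omega) : n.-tuple S := [tuple pr (Z i w) | i < n].

Lemma measurable_design_of : measurable_fun setT design_of.
Proof.
apply/measurable_fun_tnthP => i; rewrite /comp /design_of.
under eq_fun do rewrite tnth_mktuple.
exact: measurableT_comp.
Qed.

Let finite_pos (a : T -> R) i : (forall x, 0 <= a x) ->
  P.-integrable setT (EFin \o (fun w => a (Z i w))) ->
  (\int[P]_w (a (Z i w))%:E < +oo)%E.
Proof.
move=> a0 /integrableP[_]; apply: le_lt_trans; rewrite le_eqVlt; apply/orP; left.
by apply/eqP; apply: eq_integral => w _ /=; rewrite ger0_norm.
Qed.

Let prod_indicE (s : seq nat) (C : nat -> set T) (z : nat -> T) :
  \prod_(l <- s) \1_(C l) (z l) = `[< forall l, l \in s -> C l (z l) >]%:R :> R.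
Proof.
elim: s => [|k s ih]; first by rewrite big_nil asboolT.
rewrite big_cons ih indicE; have [/set_mem Ck|Ck] := boolP (z k \in C k).
  rewrite mul1r; congr (nat_of_bool _)%:R; apply/asboolP/asboolP => H l.
    by rewrite inE => /predU1P[->//|]; exact: H.
  by move=> ls; apply: H; rewrite inE ls orbT.
rewrite mul0r asboolF// => H; move/negP: Ck; apply; apply/mem_set.
by apply: H; rewrite inE eqxx.
Qed.

(** On a design rectangle the integral of a product of functions of two distinct
    observations factors, and its dependence on the first function is only
    through an integral over an event of the first regressor. *)
Let factor i j (B : nat -> set S) (b : T -> R) : i != j ->
  (forall l, measurable (B l)) ->
  measurable_fun setT b -> (forall x, 0 <= b x) ->
  P.-integrable setT (EFin \o (fun w => b (Z j w))) ->
  exists2 D : set S, measurable D & exists c : R, forall a : T -> R,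
  measurable_fun setT a -> (forall x, 0 <= a x) ->
  P.-integrable setT (EFin \o (fun w => a (Z i w))) ->
  (\int[P]_(w in design_of @^-1` rectangle B) (a (Z i w) * b (Z j w))%:E =
   (fine (\int[P]_(w in (pr \o Z i) @^-1` D) (a (Z i w))%:E) * c)%:E)%E.
Proof.
move=> ij mB mb b0 ib.
pose C (l : nat) := if (l < n)%N then pr @^-1` B l else setT.
have mC l : measurable (C l).
  rewrite /C; case: ifP => // _; rewrite -[X in measurable X]setTI; exact: mpr.
exists (if (i < n)%N then B i else setT); first by case: ifP.
pose s0 := [seq l <- iota 0 n | (l != i) && (l != j)].
pose s := [:: i, j & s0].
have us : uniq s.
  rewrite /= filter_uniq ?iota_uniq// andbT inE negb_or ij/=.
  by rewrite !mem_filter !eqxx/= !andbF.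
pose u l : T -> R := if l == j then b else cst 1.
have mu_ l : measurable_fun setT (u l) by rewrite /u; case: ifP.
have u0 l x : 0 <= u l x by rewrite /u; case: ifP.
exists (\prod_(l <- j :: s0) \int[P]_w (\1_(C l) (Z l w) * u l (Z l w))).
move=> a ma a0 ia.
have ji : j != i by rewrite eq_sym.
pose v l : T -> R := if l == i then a else u l.
have mv l : measurable_fun setT (v l) by rewrite /v; case: ifP.
have v0 l x : 0 <= v l x by rewrite /v; case: ifP.
pose g l x := \1_(C l) x * v l x.
have mg l : measurable_fun setT (g l).
  by apply: measurable_funM => //; exact: measurable_indic.
have g0 l x : 0 <= g l x by rewrite mulr_ge0.
have g_le l x : g l x <= v l x.
  by rewrite /g ler_piMl// indicE lern1; case: (_ \in _).
have gfin l : (\int[P]_w (g l (Z l w))%:E < +oo)%E.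
  apply: (@le_lt_trans _ _ (\int[P]_w (v l (Z l w))%:E)%E).
    apply: ge0_le_integral => //.
    - by move=> w _; rewrite lee_fin.
    - by apply/measurable_EFinP; exact: measurableT_comp.
    - by apply/measurable_EFinP; exact: measurableT_comp.
    - by move=> w _; rewrite lee_fin.
  rewrite /v; case: eqP => [->|_]; first exact: finite_pos.
  rewrite /u; case: eqP => [->|_]; first exact: finite_pos.
  rewrite -[X in (X < _)%E]/(\int[P]_w cst 1%:E w)%E integral_cst//.
  by rewrite mul1e; exact: probability_finite.
have s0P l : l \in s0 -> (l != i) * (l != j).
  by rewrite mem_filter => /andP[/andP[]].
have vi : v i = a by rewrite /v eqxx.
have vj : v j = b by rewrite /v (negbTE ji) /u eqxx.
have vs0 l : l \in s0 -> v l = cst 1.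
  by move=> ls0; rewrite /v /u !(negbTE (s0P _ ls0).1) (negbTE (s0P _ ls0).2).
have fiber_prod w : \prod_(l <- s) g l (Z l w) =
    \1_(design_of @^-1` rectangle B) w * (a (Z i w) * b (Z j w)).
  rewrite /g big_split/=; congr (_ * _); last first.
    rewrite !big_cons vi vj big_seq big1 ?mulr1// => l ls0.
    by rewrite vs0.
  rewrite (prod_indicE s C (fun l => Z l w)) indicE.
  congr (nat_of_bool _)%:R; apply/asboolP/idP => [H|].
    rewrite inE => l; rewrite /design_of tnth_mktuple.
    have /H : (l : nat) \in s.
      rewrite !inE mem_filter mem_iota ltn_ord/= andbT.
      by case: eqP => //= _; case: eqP.
    by rewrite /C ltn_ord.
  rewrite inE => H l _; rewrite /C; case: ifP => // ln.
  by have := H (Ordinal ln); rewrite /design_of tnth_mktuple.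
transitivity (\int[P]_w (\prod_(l <- s) g l (Z l w))%:E)%E.
  rewrite integral_mkcond; apply: eq_integral => w _.
  by rewrite patchE fiber_prod indicE; case: (_ \in _); rewrite ?mul1r ?mul0r.
rewrite (expectation_prod mZ iidZ)//; congr EFin.
rewrite [LHS]big_cons; congr (_ * _).
  congr fine; rewrite [RHS]integral_mkcond; apply: eq_integral => w _.
  rewrite patchE /g vi indicE /C.
  have -> : (w \in (pr \o Z i) @^-1` (if (i < n)%N then B i else setT)) =
      (Z i w \in (if (i < n)%N then pr @^-1` B i else setT)).
    by apply/idP/idP; rewrite !inE; case: ifP.
  by case: (_ \in _); rewrite ?mul1r ?mul0r.
apply: eq_big_seq => l ls.
by rewrite /g /v; case: eqP => // li; move: us; rewrite /= -{1}li ls.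
Qed.

(** By factorization over the design rectangles, conditioning on the whole design
    reduces to conditioning on the regressor that belongs to the residual; the
    products of the parts of u and v keep all integrands nonnegative. *)
Lemma centered_mul i j (u v : T -> R) : i != j ->
  measurable_fun setT u -> measurable_fun setT v ->
  P.-integrable setT (EFin \o (fun w => v (Z j w))) ->
  centered P (pr \o Z i) (fun w => u (Z i w)) ->
  centered P design_of (fun w => u (Z i w) * v (Z j w)).
Proof.
move=> ij mu_ mv iv [iu cu].
pose up : T -> R := u^\+; pose un : T -> R := u^\-.
pose vp : T -> R := v^\+; pose vn : T -> R := v^\-.
have mup : measurable_fun setT up by exact: measurable_funrpos.
have mun : measurable_fun setT un by exact: measurable_funrneg.
have mvp : measurable_fun setT vp by exact: measurable_funrpos.
have mvn : measurable_fun setT vn by exact: measurable_funrneg.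
have iup : P.-integrable setT (EFin \o (fun w => up (Z i w))).
  exact: (integrable_funrpos measurableT iu).
have iun : P.-integrable setT (EFin \o (fun w => un (Z i w))).
  exact: (integrable_funrneg measurableT iu).
have ivp : P.-integrable setT (EFin \o (fun w => vp (Z j w))).
  exact: (integrable_funrpos measurableT iv).
have ivn : P.-integrable setT (EFin \o (fun w => vn (Z j w))).
  exact: (integrable_funrneg measurableT iv).
have up0 x : 0 <= up x by exact: funrpos_ge0.
have un0 x : 0 <= un x by exact: funrneg_ge0.
have vp0 x : 0 <= vp x by exact: funrpos_ge0.
have vn0 x : 0 <= vn x by exact: funrneg_ge0.
have mD B : (forall l, measurable (B l)) -> measurable (design_of @^-1` rectangle B).
  move=> mB; rewrite -[X in measurable X]setTI.
  by apply: measurable_design_of => //; exact: measurable_rectangle.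
have mprod (a b : T -> R) : measurable_fun setT a -> measurable_fun setT b ->
    measurable_fun setT (fun w => (a (Z i w) * b (Z j w))%:E).
  by move=> ma mb; apply/measurable_EFinP; apply: measurable_funM;
    exact: measurableT_comp.
have swap (b : T -> R) (B : nat -> set S) : measurable_fun setT b ->
    (forall x, 0 <= b x) -> P.-integrable setT (EFin \o (fun w => b (Z j w))) ->
    (forall l, measurable (B l)) ->
    (\int[P]_(w in design_of @^-1` rectangle B) (up (Z i w) * b (Z j w))%:E =
     \int[P]_(w in design_of @^-1` rectangle B) (un (Z i w) * b (Z j w))%:E)%E.
  move=> mb b0 ib mB; have [D mDD [c Hc]] := factor ij mB mb b0 ib.
  by rewrite !Hc// (cu D mDD).
have iuv : P.-integrable setT (EFin \o (fun w => u (Z i w) * v (Z j w))).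
  apply/integrableP; split; first exact: mprod.
  pose g l : T -> R := if l == i then Num.norm \o u else Num.norm \o v.
  have := @expectation_prod _ _ _ P _ _ Z mZ iidZ [:: i; j]
    (fun l => if l == i then Num.norm \o u else
              if l == j then Num.norm \o v else cst 0).
  have -> : uniq [:: i; j] by rewrite /= inE ij.
  move=> /(_ isT) H.
  have -> : (\int[P]_x `|(EFin \o (fun w => u (Z i w) * v (Z j w)))%R x| =
    \int[P]_w (\prod_(l <- [:: i; j]) (if l == i then Num.norm \o u else
              if l == j then Num.norm \o v else cst 0) (Z l w))%:E)%E.
    apply: eq_integral => w _; rewrite !big_cons big_nil eqxx eq_sym (negbTE ij).
    by rewrite eqxx mulr1 /= normrM.
  rewrite H ?ltry//.
  - by move=> l; case: ifP => _; [|case: ifP => // _]; exact: measurableT_comp.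
  - by move=> l x; case: (l == i) => //=; case: (l == j) => /=.
  - move=> l; case: eqP => [->|_]; first by have /integrableP[] := iu.
    case: eqP => [->|_]; first by have /integrableP[] := iv.
    by rewrite integral0.
apply: centered_rectangles => // [|B mB]; first exact: measurable_design_of.
have D0 (x y : R) : Num.max (x * y) 0 =
    Num.max x 0 * Num.max y 0 + Num.max (- x) 0 * Num.max (- y) 0.
  have [x0|/ltW x0] := leP x 0; have [y0|/ltW y0] := leP y 0.
  - by rewrite (max_l (mulr_le0 x0 y0)) mul0r add0r !max_l ?oppr_ge0// mulrNN.
  - rewrite (max_r (mulr_le0_ge0 x0 y0)) (@max_r _ _ (- y)) ?oppr_le0//.
    by rewrite mulr0 mul0r addr0.
  - rewrite (max_r (mulr_ge0_le0 x0 y0)) (@max_r _ _ (- x)) ?oppr_le0//.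
    by rewrite mulr0 mul0r addr0.
  - by rewrite (max_l (mulr_ge0 x0 y0)) (@max_r _ _ (- x)) ?oppr_le0// mul0r addr0.
have D1 (x y : R) : Num.max (- (x * y)) 0 =
    Num.max x 0 * Num.max (- y) 0 + Num.max (- x) 0 * Num.max y 0.
  by rewrite -mulrN D0 opprK.
transitivity (\int[P]_(w in design_of @^-1` rectangle B)
    ((up (Z i w) * vp (Z j w))%:E + (un (Z i w) * vn (Z j w))%:E))%E.
  by apply: eq_integral => w _; rewrite -EFinD; congr EFin; exact: D0.
transitivity (\int[P]_(w in design_of @^-1` rectangle B)
    ((up (Z i w) * vn (Z j w))%:E + (un (Z i w) * vp (Z j w))%:E))%E; last first.
  by apply: eq_integral => w _; rewrite -EFinD; congr EFin; rewrite -D1.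
have ge0 (x y : R) : 0 <= x -> 0 <= y -> (0 <= (x * y)%:E)%E.
  by move=> x0 y0; rewrite lee_fin mulr_ge0.
rewrite !ge0_integralD//; do ?[exact: mD|by move=> w _; exact: ge0|
  by apply: measurable_funTS; exact: mprod].
by rewrite !swap// addeC.
Qed.

End independent_factors.

(** * The conditional second moment of a linear form in the residuals *)

Section conditional_second_moment.
Context {R : realType} {disp : measure_display} {Omega : measurableType disp}.
Variable P : probability Omega R.
Context {dS : measure_display} {S : measurableType dS}.
Variables (V : Omega -> S) (n : nat) (xi : 'I_n -> Omega -> R) (s : 'I_n -> S -> R).
Hypotheses (mV : measurable_fun setT V) (ms : forall i, measurable_fun setT (s i)).
Hypothesis xi1 : forall i, centered P V (xi i).
Hypothesis xi2 : forall i j, centered P V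
  (fun w => xi i w * xi j w - (if i == j then s i (V w) else 0)).

Let mean_zero (f : Omega -> R) :=
  P.-integrable setT (EFin \o f) /\ \int[P]_w f w = 0.

Let mean_zero_sum (I : Type) (r : seq I) (f : I -> Omega -> R) :
  (forall i, mean_zero (f i)) -> mean_zero (fun w => \sum_(i <- r) f i w).
Proof.
move=> f0; elim: r => [|i r [ih ih0]].
  rewrite (_ : (fun w => _) = cst 0); last by apply/funext => w; rewrite big_nil.
  by split; [exact: integrable0|rewrite /Rintegral integral0].
rewrite (_ : (fun w => _) = (fun w => f i w + \sum_(i <- r) f i w)); last first.
  by apply/funext => w; rewrite big_cons.
have [fi fi0] := f0 i; split; last by rewrite RintegralD// fi0 ih0 addr0.
exact: (integrableD measurableT fi ih).
Qed.

Let mean_zeroD (f g : Omega -> R) : mean_zero f -> mean_zero g ->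
  mean_zero (fun w => f w + g w).
Proof.
move=> [fi f0] [gi g0]; split; last by rewrite RintegralD// f0 g0 addr0.
exact: (integrableD measurableT fi gi).
Qed.

Variables (c : 'I_n -> S -> R) (b : S -> R).
Hypotheses (mc : forall i, measurable_fun setT (c i)) (mb : measurable_fun setT b).

Let F t := \sum_(i < n) c i t ^+ 2 * s i t + b t ^+ 2.
Let U w := (\sum_(i < n) c i (V w) * xi i w + b (V w)) ^+ 2.

Let mF : measurable_fun setT F.
Proof.
apply: measurable_funD; last exact: measurable_funX.
by apply: measurable_sum => i; apply: measurable_funM => //; exact: measurable_funX.
Qed.

Let square_expansion w : U w - F (V w) =
  \sum_(i < n) \sum_(j < n) (c i (V w) * c j (V w)) *
    (xi i w * xi j w - (if i == j then s i (V w) else 0)) +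
  \sum_(i < n) (2 * (c i (V w) * b (V w))) * xi i w.
Proof.
transitivity ((\sum_(i < n) c i (V w) * xi i w) ^+ 2 +
  2 * (\sum_(i < n) c i (V w) * xi i w) * b (V w) -
  \sum_(i < n) c i (V w) ^+ 2 * s i (V w)).
  by rewrite /U /F; ring.
rewrite addrAC; congr (_ + _); last first.
  rewrite -mulrA mulr_suml mulr_sumr; apply: eq_bigr => i _; ring.
rewrite expr2 big_distrlr/= -sumrB; apply: eq_bigr => i _.
rewrite [in LHS](bigD1 i)//= [in RHS](bigD1 i)//= eqxx.
rewrite -!addrA [X in _ + X = _]addrC addrA; congr (_ + _); first ring.
by apply: eq_bigr => j ji; rewrite eq_sym (negbTE ji); ring.
Qed.

(** Where the coefficients are bounded the square may be expanded and integrated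
    term by term; the cross terms vanish. *)
Let integral_square_bounded (E : set S) (N : R) : measurable E ->
  (forall t, E t -> `|b t| <= N /\ forall i, `|c i t| <= N /\ `|s i t| <= N) ->
  (\int[P]_(w in V @^-1` E) (U w)%:E = \int[P]_(w in V @^-1` E) (F (V w))%:E)%E.
Proof.
move=> mE EN.
pose e : S -> R := \1_E.
have me : measurable_fun setT e by exact: measurable_indic.
have bmE (g : S -> R) : measurable_fun setT g ->
    (exists C : R, forall t, E t -> `|g t| <= C) ->
    bounded_measurable setT (fun t => e t * g t).
  move=> mg [C hC]; split; first exact: measurable_funM.
  exists `|C| => t _; rewrite /e indicE; have [|_] := boolP (t \in E).
    by rewrite inE => Et; rewrite mul1r (le_trans (hC _ Et))// ler_norm.
  by rewrite mul0r normr0.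
have bF : bounded_measurable setT (fun t => e t * F t).
  apply: bmE => //; exists (\sum_(i < n) `|N| ^+ 2 * `|N| + `|N| ^+ 2) => t Et.
  have [bN cN] := EN t Et.
  have le2 (x : R) : `|x| <= N -> `|x ^+ 2| <= `|N| ^+ 2.
    by move=> xN; rewrite normrX ler_pXn2r ?nnegrE// (le_trans xN)// ler_norm.
  rewrite (le_trans (ler_normD _ _))// lerD ?le2//.
  rewrite (le_trans (ler_norm_sum _ _ _))// ler_sum// => i _.
  have [ciN siN] := cN i; rewrite normrM ler_pM ?le2//.
  by rewrite (le_trans siN)// ler_norm.
have iF : P.-integrable setT (EFin \o (fun w => e (V w) * F (V w))).
  apply: bm_integrable => //; first exact: probability_finite.
  have [mF' [C hC]] := bF; split; last by exists C => w _; exact: hC.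
  exact: (measurableT_comp mF' mV).
have H : mean_zero (fun w => e (V w) * U w - e (V w) * F (V w)).
  rewrite (_ : (fun w => _) = (fun w =>
    \sum_(i < n) \sum_(j < n) (e (V w) * (c i (V w) * c j (V w))) *
      (xi i w * xi j w - (if i == j then s i (V w) else 0)) +
    \sum_(i < n) (e (V w) * (2 * (c i (V w) * b (V w)))) * xi i w)); last first.
    apply/funext => w; rewrite -mulrBr square_expansion mulrDr.
    rewrite 2!mulr_sumr; apply: (congr2 +%R); apply: eq_bigr => i _.
      by rewrite mulr_sumr; apply: eq_bigr => j _; ring.
    by ring.
  apply: mean_zeroD.
    apply: mean_zero_sum => i; apply: mean_zero_sum => j.
    apply: (@centered_integral _ _ _ P _ _ V
      (fun w => xi i w * xi j w - (if i == j then s i (V w) else 0))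
      (fun t => e t * (c i t * c j t))) => //.
    apply: bmE; first exact: measurable_funM.
    exists (N * N) => t Et; have [_ cN] := EN t Et.
    by rewrite normrM ler_pM ?(cN i).1 ?(cN j).1.
  apply: mean_zero_sum => i.
  apply: (@centered_integral _ _ _ P _ _ V (xi i)
    (fun t => e t * (2 * (c i t * b t)))) => //.
  apply: bmE; first by apply: measurable_funM => //; exact: measurable_funM.
  exists (2 * (N * N)) => t Et; have [bN cN] := EN t Et.
  by rewrite normrM (ger0_norm (ler0n _ 2)) ler_pM2l// normrM ler_pM ?(cN i).1.
have [iH H0] := H.
have iU : P.-integrable setT (EFin \o (fun w => e (V w) * U w)).
  rewrite (_ : EFin \o _ = (EFin \o (fun w => e (V w) * U w - e (V w) * F (V w)))
    \+ (EFin \o (fun w => e (V w) * F (V w)))); first exact: integrableD.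
  by apply/funext => w /=; rewrite -EFinD subrK.
have toT (g : Omega -> R) : (\int[P]_(w in V @^-1` E) (g w)%:E =
    \int[P]_w (e (V w) * g w)%:E)%E.
  rewrite integral_mkcond; apply: eq_integral => w _; rewrite patchE /e indicE.
  have -> : (w \in V @^-1` E) = (V w \in E) by apply/idP/idP; rewrite !inE.
  by case: (_ \in _); rewrite ?mul1r ?mul0r.
rewrite !toT; move: H0; rewrite RintegralB// => /eqP; rewrite subr_eq0 => /eqP.
move=> E0; have fU := integrable_fin_num measurableT iU.
have fF := integrable_fin_num measurableT iF.
by rewrite -(fineK fU) -(fineK fF); congr EFin.
Qed.

(** A version of the conditional expectation of the square is determined on each
    of the sets where the coefficients are bounded, and these exhaust the space. *)
Lemma conditional_square (W : Omega -> \bar R) (g : S -> \bar R) :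
  cond_expectation P V W g -> {ae P, forall w, W w = (U w)%:E} ->
  {ae P, forall w, g (V w) = (F (V w))%:E}.
Proof.
move=> [mg Hg] [NW [mNW NW0 WU]].
pose nu_ := (pushforward P V : {measure set S -> \bar R}); pose nu := nu_ mV.
have pushE E (f : S -> \bar R) : measurable E -> measurable_fun setT f ->
    (\int[nu]_(t in E) f t = \int[P]_(w in V @^-1` E) f (V w))%E.
  move=> mE mf; rewrite integralE [RHS]integralE; congr (_ - _)%E.
    rewrite (ge0_integral_pushforward mV)//.
    - by rewrite -funepos_comp.
    - by apply: measurable_funTS; exact: measurable_funepos.
  rewrite (ge0_integral_pushforward mV)//.
  - by rewrite -funeneg_comp.
  - by apply: measurable_funTS; exact: measurable_funeneg.
have WE E : (\int[P]_(w in V @^-1` E) W w = \int[P]_(w in V @^-1` E) (U w)%:E)%E.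
  apply: (integral_off_null mNW NW0) => w nNw; rewrite !patchE; case: ifP => // _.
  by apply: contrapT => nWU; apply: nNw; apply: WU.
pose D (N : nat) := [set t | `|b t| <= N%:R /\
  forall i, `|c i t| <= N%:R /\ `|s i t| <= N%:R].
have mle (f : S -> R) N : measurable_fun setT f -> measurable [set t | `|f t| <= N].
  move=> mf; rewrite -[X in measurable X]setTI.
  by apply: (measurable_fun_le measurableT _ (measurable_cst N));
    exact: measurableT_comp.
have mD N : measurable (D N).
  rewrite (_ : D N = [set t | `|b t| <= N%:R] `&` \bigcap_(i in [set: 'I_n])
    ([set t | `|c i t| <= N%:R] `&` [set t | `|s i t| <= N%:R])).
    apply: measurableI; first exact: mle.
    by apply: fin_bigcap_measurable => // i _; apply: measurableI; exact: mle.
  by apply/seteqP; split => t [bt H]; split => // i; [move=> _|]; have := H i;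
    [|exact].
have ae_D N : ae_eq nu (D N) (EFin \o F) g.
  apply: integral_ae_eq => //.
  - apply: bm_integrable => //.
      apply: (@le_lt_trans _ _ (P setT)); last exact: probability_finite.
      have -> : nu (D N) = P (V @^-1` D N) by [].
      by apply: le_measure; rewrite ?inE//; rewrite -[X in measurable X]setTI; exact: mV.
    split; first exact: measurable_funTS.
    exists (\sum_(i < n) N%:R ^+ 2 * N%:R + N%:R ^+ 2) => t [bN cN].
    have le2 (x : R) : `|x| <= N%:R -> `|x ^+ 2| <= N%:R ^+ 2.
      by move=> xN; rewrite normrX ler_pXn2r ?nnegrE.
    rewrite (le_trans (ler_normD _ _))// lerD ?le2//.
    rewrite (le_trans (ler_norm_sum _ _ _))// ler_sum// => i _.
    by have [ciN siN] := cN i; rewrite normrM ler_pM ?le2.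
  - exact: measurable_funTS.
  - move=> E ED mE; rewrite !pushE//; last exact/measurable_EFinP.
    rewrite -(integral_square_bounded (N := N%:R) mE); last by move=> t /ED [].
    by rewrite -Hg// WE.
have : nu.-negligible (\bigcup_N ~` [set t | D N t -> (EFin \o F) t = g t]).
  by apply: negligible_bigcup => N; exact: ae_D.
move=> [B [mB B0 HB]]; exists (V @^-1` B); split => //.
  by rewrite -[X in measurable X]setTI; exact: mV.
move=> w /= ngF; apply: HB.
have [N DN] : exists N : nat, D N (V w).
  pose M := `|b (V w)| + \sum_(i < n) (`|c i (V w)| + `|s i (V w)|).
  have [N MN] : exists N : nat, M <= N%:R.
    exists (Num.Def.truncn M).+1.
    by rewrite ltW// truncnS_gt.
  exists N; split.
    by rewrite (le_trans _ MN)// /M lerDl sumr_ge0// => i _; rewrite addr_ge0.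
  move=> i; have iM : `|c i (V w)| + `|s i (V w)| <= M.
    rewrite /M (bigD1 i)//= addrCA lerDl addr_ge0// sumr_ge0// => j _.
  split; apply: (le_trans _ MN); apply: (le_trans _ iM).
    by rewrite lerDl.
  by rewrite lerDr.
by exists N => //= H; apply: ngF; rewrite -H.
Qed.

End conditional_second_moment.

Section fubini_ae.
Context {R : realType} {disp : measure_display} {Omega : measurableType disp}.
Variable P : probability Omega R.
Context {dX dS : measure_display} {X : measurableType dX} {S : measurableType dS}.

(** The set of exceptional pairs is null by Tonelli's theorem, because its sections
    in one direction are null; hence so are almost all its sections in the other. *)
Lemma ae_ae (lam : {sigma_finite_measure set X -> \bar R}) (A : set X)
    (V : Omega -> S) (f g : X * S -> \bar R) :
  measurable A -> measurable_fun setT V ->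
  measurable_fun setT f -> measurable_fun setT g ->
  (forall x, A x -> {ae P, forall w, f (x, V w) = g (x, V w)}) ->
  {ae P, forall w, {ae lam, forall x, A x -> f (x, V w) = g (x, V w)}}.
Proof.
move=> mA mV mf mg H.
pose pr (z : X * Omega) := (z.1, V z.2).
have mpr : measurable_fun setT pr.
  apply/measurable_fun_pairP; split; first exact: measurable_fst.
  by apply: (measurableT_comp mV); exact: measurable_snd.
pose E := (A `*` setT) `&` [set z | f (pr z) != g (pr z)].
have mE : measurable E.
  apply: measurable_neqe.
  - exact: measurableX.
  - by apply: measurable_funTS; exact: measurableT_comp.
  - by apply: measurable_funTS; exact: measurableT_comp.
have := indic_fubini_tonelli lam P mE.
rewrite (indic_fubini_tonelli_FE P mE) (indic_fubini_tonelli_GE lam mE).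
rewrite integral0_eq => [/esym H0|x _ /=]; last first.
  have [Ax|nAx] := pselect (A x); last first.
    rewrite (_ : xsection E x = set0)// -subset0 => w.
    by rewrite /xsection /= inE => -[[]].
  have [N [mN N0 HN]] := H x Ax.
  apply: (subset_measure0 _ mN _ N0); first exact: measurable_xsection.
  move=> w; rewrite /xsection /= inE => -[_ /= /eqP neq].
  by apply: HN => /=.
have mG : measurable_fun setT (lam \o ysection E).
  exact: measurable_fun_ysection.
have := (ae_eq_integral_abs P measurableT mG).1.
move=> /(_ _)[].
  by rewrite -[RHS]H0; apply: eq_integral => w _; rewrite gee0_abs.
move=> N [mN N0 HN]; exists N; split => // w /= Hw; apply: HN => /= Hw'.
apply: Hw; exists (ysection E w); split; first exact: measurable_ysection.
  exact: Hw'.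
move=> x /= /not_implyP[Ax neq]; rewrite /ysection /= inE; split => //=.
by apply/eqP.
Qed.

End fubini_ae.

(** * Euclidean norms, sparse matrices and perturbation of inverses *)

Section euclidean_norm.
Context {R : realType}.

Lemma sum_cauchy_schwarz (I : Type) (r : seq I) (Q : pred I) (a b : I -> R) :
  (\sum_(i <- r | Q i) a i * b i) ^+ 2 <=
  (\sum_(i <- r | Q i) a i ^+ 2) * (\sum_(i <- r | Q i) b i ^+ 2).
Proof.
rewrite -subr_ge0 -(pmulr_rge0 _ (ltr0n _ 2)).
suff -> : 2 * ((\sum_(i <- r | Q i) a i ^+ 2) * (\sum_(i <- r | Q i) b i ^+ 2) -
  (\sum_(i <- r | Q i) a i * b i) ^+ 2) =
  \sum_(i <- r | Q i) \sum_(j <- r | Q j) (a i * b j - a j * b i) ^+ 2.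
  by apply: sumr_ge0 => i _; apply: sumr_ge0 => j _; exact: sqr_ge0.
transitivity (\sum_(i <- r | Q i) \sum_(j <- r | Q j) a i ^+ 2 * b j ^+ 2 +
  \sum_(i <- r | Q i) \sum_(j <- r | Q j) b i ^+ 2 * a j ^+ 2 -
  2 * \sum_(i <- r | Q i) \sum_(j <- r | Q j) (a i * b i) * (a j * b j)).
  by rewrite -!big_distrlr/=; ring.
rewrite mulr_sumr -big_split -sumrB; apply: eq_bigr => i _.
by rewrite mulr_sumr -big_split -sumrB; apply: eq_bigr => j _ /=; ring.
Qed.

Context {K : nat}.
Implicit Types (a u v : 'cV[R]_K) (M N : 'M[R]_K).

Definition dotc u v : R := \sum_i u i ord0 * v i ord0.

Lemma dotcE u v : (u^T *m v) ord0 ord0 = dotc u v.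
Proof. by rewrite mxE; apply: eq_bigr => i _; rewrite mxE. Qed.

Lemma dotcC u v : dotc u v = dotc v u.
Proof. by apply: eq_bigr => i _; rewrite mulrC. Qed.

Lemma dotcDr u v w : dotc u (v + w) = dotc u v + dotc u w.
Proof. by rewrite -big_split; apply: eq_bigr => i _; rewrite mxE mulrDr. Qed.

Lemma dotcDl u v w : dotc (v + w) u = dotc v u + dotc w u.
Proof. by rewrite !(dotcC _ u) dotcDr. Qed.

Lemma dotcZr u v (a : R) : dotc u (a *: v) = a * dotc u v.
Proof. by rewrite mulr_sumr; apply: eq_bigr => i _; rewrite mxE mulrCA. Qed.

Lemma dotcNr u v : dotc u (- v) = - dotc u v.
Proof. by rewrite -scaleN1r dotcZr mulN1r. Qed.

Lemma dotcBr u v w : dotc u (v - w) = dotc u v - dotc u w.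
Proof. by rewrite dotcDr dotcNr. Qed.

Lemma dotcBl u v w : dotc (v - w) u = dotc v u - dotc w u.
Proof. by rewrite !(dotcC _ u) dotcBr. Qed.

Lemma dotc_sumr (I : Type) (r : seq I) (Q : pred I) u (v : I -> 'cV[R]_K) :
  dotc u (\sum_(i <- r | Q i) v i) = \sum_(i <- r | Q i) dotc u (v i).
Proof.
rewrite /dotc exchange_big/=; apply: eq_bigr => k _.
by rewrite summxE mulr_sumr.
Qed.

Lemma dotc_trmx M u v : dotc (M *m u) v = dotc u (M^T *m v).
Proof.
by rewrite -!dotcE trmx_mul mulmxA.
Qed.

Lemma dotc_mulmx M u : dotc u (M *m u) =
  \sum_i \sum_j u i ord0 * M i j * u j ord0.
Proof.
apply: eq_bigr => i _; rewrite mxE mulr_sumr.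
by apply: eq_bigr => j _; rewrite mulrA.
Qed.

Lemma enorm_ge0 m n (A : 'M[R]_(m, n)) : 0 <= enorm A.
Proof. exact: sqrtr_ge0. Qed.

Lemma enorm_sqr u : enorm u ^+ 2 = dotc u u.
Proof.
rewrite /enorm sqr_sqrtr.
  by apply: eq_bigr => i _; rewrite big_ord1 expr2.
by apply: sumr_ge0 => i _; apply: sumr_ge0 => j _; exact: sqr_ge0.
Qed.

Lemma enorm_sqr_sum u : enorm u ^+ 2 = \sum_i u i ord0 ^+ 2.
Proof. by rewrite enorm_sqr; apply: eq_bigr => i _; rewrite expr2. Qed.

Lemma cauchy_schwarz u v : `|dotc u v| <= enorm u * enorm v.
Proof.
rewrite -(@ler_pXn2r _ 2)// ?nnegrE ?mulr_ge0 ?enorm_ge0//.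
rewrite real_normK ?num_real// exprMn !enorm_sqr_sum.
exact: sum_cauchy_schwarz.
Qed.

Lemma enormN u : enorm (- u) = enorm u.
Proof.
apply/eqP; rewrite -(@eqrXn2 _ 2)// ?enorm_ge0// !enorm_sqr dotcNr dotcC dotcNr.
by rewrite opprK.
Qed.

Lemma ler_enormD u v : enorm (u + v) <= enorm u + enorm v.
Proof.
rewrite -(@ler_pXn2r _ 2)// ?nnegrE ?addr_ge0 ?enorm_ge0//.
rewrite enorm_sqr sqrrD !dotcDr !dotcDl -!enorm_sqr (dotcC v u).
have := le_trans (ler_norm _) (cauchy_schwarz u v); lra.
Qed.

Lemma ler_enormB u v : enorm (u - v) <= enorm u + enorm v.
Proof. by rewrite (le_trans (ler_enormD _ _))// enormN. Qed.

Lemma enorm_eq0 u : enorm u = 0 -> u = 0.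
Proof.
move=> u0; have : enorm u ^+ 2 = 0 by rewrite u0 expr0n.
rewrite enorm_sqr_sum => /eqP; rewrite psumr_eq0; last first.
  by move=> i _; exact: sqr_ge0.
move=> /allP H; apply/colP => i; rewrite mxE.
by have := H i (mem_index_enum _); rewrite /= sqrf_eq0 => /eqP.
Qed.

Lemma ler_norm_enorm u i : `|u i ord0| <= enorm u.
Proof.
rewrite -(@ler_pXn2r _ 2)// ?nnegrE ?enorm_ge0//.
rewrite real_normK ?num_real// enorm_sqr_sum (bigD1 i)//= lerDl.
by apply: sumr_ge0 => j _; exact: sqr_ge0.
Qed.

Lemma enorm_sqr_le u (e : R) : (forall i, `|u i ord0| <= e) ->
  enorm u ^+ 2 <= K%:R * e ^+ 2.
Proof.
move=> ue; rewrite enorm_sqr_sum.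
have -> : K%:R * e ^+ 2 = \sum_(i < K) e ^+ 2.
  by rewrite sumr_const card_ord mulr_natl.
apply: ler_sum => i _; rewrite -real_normK ?num_real//.
by rewrite ler_pXn2r ?nnegrE// (le_trans _ (ue i)).
Qed.

(** Each row and each column of M has at most C nonzero entries, so that the row
    sums of squares and the column multiplicities both cost a factor C. *)
Lemma sparse_bound M (adj : rel 'I_K) (C : nat) (t : R) :
  0 <= t -> symmetric adj -> (forall i, (#|[pred j | adj i j]| <= C)%N) ->
  (forall i j, adj i j -> `|M i j| <= t) -> (forall i j, ~~ adj i j -> M i j = 0) ->
  forall v, enorm (M *m v) <= C%:R * t * enorm v.
Proof.
move=> t0 sadj cadj Mt M0 v.
rewrite -(@ler_pXn2r _ 2)// ?nnegrE ?mulr_ge0 ?enorm_ge0//.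
rewrite exprMn !enorm_sqr_sum.
have row i : (M *m v) i ord0 ^+ 2 <= C%:R * t ^+ 2 * \sum_(j | adj i j) v j ord0 ^+ 2.
  rewrite mxE (bigID (adj i))/= [X in _ + X]big1 ?addr0; last first.
    by move=> j /M0 ->; rewrite mul0r.
  rewrite (le_trans (sum_cauchy_schwarz _ _ _ _))// ler_wpM2r//.
    by apply: sumr_ge0 => j _; exact: sqr_ge0.
  apply: (@le_trans _ _ (\sum_(j | adj i j) t ^+ 2)).
    apply: ler_sum => j aij; rewrite -real_normK ?num_real//.
    by rewrite ler_pXn2r ?nnegrE ?Mt.
  rewrite sumr_const -(mulr_natl (t ^+ 2)) ler_wpM2r ?exprn_ge0// ler_nat.
  exact: cadj.
apply: le_trans (ler_sum _ (fun i _ => row i)) _.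
rewrite -mulr_sumr.
have -> : (C%:R * t) ^+ 2 * (\sum_i v i ord0 ^+ 2) =
  C%:R * t ^+ 2 * (C%:R * \sum_i v i ord0 ^+ 2) by ring.
rewrite ler_wpM2l ?mulr_ge0 ?exprn_ge0//.
rewrite (exchange_big_dep predT)//= mulr_sumr; apply: ler_sum => j _.
rewrite sumr_const -(mulr_natl (v j ord0 ^+ 2)) ler_wpM2r ?sqr_ge0// ler_nat.
apply: leq_trans (cadj j); rewrite leq_eqVlt; apply/orP; left; apply/eqP.
by apply: eq_card => i; rewrite !inE /in_mem/= sadj.
Qed.

Definition coercive (k : R) M : Prop := forall a, k * enorm a ^+ 2 <= dotc a (M *m a).

Lemma coercive_unitmx (k : R) M : 0 < k -> coercive k M -> M \in unitmx.
Proof.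
move=> k0 kM; rewrite unitmxE unitfE; apply/negP => /det0P[v v0 vM].
have := kM v^T; rewrite -dotcE trmxK mulmxA vM mul0mx mxE.
rewrite pmulr_rle0// => e0; move/eqP: v0; apply.
rewrite -[v]trmxK (@enorm_eq0 v^T) ?trmx0//.
by apply/eqP; rewrite -sqrf_eq0 eq_le e0 sqr_ge0.
Qed.

Lemma coercive_invmx (k : R) M u : 0 < k -> coercive k M ->
  enorm (invmx M *m u) <= enorm u / k.
Proof.
move=> k0 kM; have uM := coercive_unitmx k0 kM.
set g := invmx M *m u; have [->|g0] := eqVneq (enorm g) 0.
  by rewrite divr_ge0 ?enorm_ge0// ltW.
have g0' : 0 < enorm g by rewrite lt_neqAle eq_sym g0 enorm_ge0.
rewrite ler_pdivlMr// -(ler_pM2r g0') mulrAC -expr2 mulrC.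
apply: (le_trans (kM g)); rewrite /g mulmxA mulmxV// mul1mx -/g.
by rewrite dotcC (le_trans (ler_norm _))// cauchy_schwarz.
Qed.

(** N^-1 - M^-1 = - N^-1 (N - M) M^-1. *)
Lemma invmx_perturbation (k t : R) M N u : 0 < k -> 0 <= t ->
  coercive k M -> coercive k N ->
  (forall a, enorm ((N - M) *m a) <= t * enorm a) ->
  enorm (invmx N *m u - invmx M *m u) <= t / k ^+ 2 * enorm u.
Proof.
move=> k0 t0 kM kN tNM.
have uM := coercive_unitmx k0 kM; have uN := coercive_unitmx k0 kN.
have -> : invmx N *m u - invmx M *m u = - (invmx N *m ((N - M) *m (invmx M *m u))).
  rewrite mulmxBl mulmxBr !mulmxA mulVmx// mul1mx -(mulmxA _ M) mulmxV// mulmx1.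
  by rewrite opprB.
rewrite enormN (le_trans (coercive_invmx _ k0 kN))//.
rewrite ler_pdivrMr// (le_trans (tNM _))//.
apply: (le_trans (ler_wpM2l t0 (coercive_invmx u k0 kM))).
rewrite le_eqVlt; apply/orP; left; apply/eqP; field.
by rewrite gt_eqF.
Qed.

(** Changing the middle matrix and the two outer factors one at a time leaves
    three terms, each with one factor that is small. *)
Lemma sandwich_perturbation (k t b : R) M N Sg Th u : 0 < k -> 0 <= t -> 0 <= b ->
  coercive k M -> coercive k N ->
  (forall a, enorm ((N - M) *m a) <= t * enorm a) ->
  (forall a, enorm (Sg *m a) <= b * enorm a) ->
  (forall a, enorm ((Th - Sg) *m a) <= t * enorm a) ->
  `|dotc (invmx N *m u) (Th *m (invmx N *m u)) -
    dotc (invmx M *m u) (Sg *m (invmx M *m u))| <=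
  (t / k ^+ 2 + 2 * b * t / k ^+ 3) * enorm u ^+ 2.
Proof.
move=> k0 t0 b0 kM kN tNM bS tS.
set g := invmx M *m u; set gh := invmx N *m u.
have -> : dotc gh (Th *m gh) - dotc g (Sg *m g) =
    dotc gh ((Th - Sg) *m gh) + dotc (gh - g) (Sg *m gh) +
    dotc g (Sg *m (gh - g)).
  by rewrite mulmxBl mulmxBr !dotcBr dotcBl; ring.
have eg : enorm g <= enorm u / k := coercive_invmx u k0 kM.
have egh : enorm gh <= enorm u / k := coercive_invmx u k0 kN.
have ed : enorm (gh - g) <= t / k ^+ 2 * enorm u := invmx_perturbation u k0 t0 kM kN tNM.
have cs x y A B : enorm x <= A -> enorm y <= B -> `|dotc x y| <= A * B.
  move=> xA yB; rewrite (le_trans (cauchy_schwarz _ _))//.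
  by rewrite ler_pM ?enorm_ge0.
have k1 : 0 <= k^-1 by rewrite invr_ge0 ltW.
have i1 : `|dotc gh ((Th - Sg) *m gh)| <= (enorm u / k) * (t * (enorm u / k)).
  by apply: cs => //; rewrite (le_trans (tS _))// ler_wpM2l.
have i2 : `|dotc (gh - g) (Sg *m gh)| <= (t / k ^+ 2 * enorm u) * (b * (enorm u / k)).
  by apply: cs => //; rewrite (le_trans (bS _))// ler_wpM2l.
have i3 : `|dotc g (Sg *m (gh - g))| <= (enorm u / k) * (b * (t / k ^+ 2 * enorm u)).
  by apply: cs => //; rewrite (le_trans (bS _))// ler_wpM2l.
rewrite (le_trans (ler_normD _ _))// (le_trans (lerD (ler_normD _ _) (lexx _)))//.
apply: (le_trans (lerD (lerD i1 i2) i3)).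
rewrite le_eqVlt; apply/orP; left; apply/eqP; field.
by rewrite gt_eqF.
Qed.

(** The empirical projection of a small function is small: its square is a scalar
    product in the empirical design, to which Cauchy-Schwarz applies. *)
Lemma empirical_projection_bound (n : nat) (x : 'I_n -> 'cV[R]_K) (r : 'I_n -> R)
    (b e : R) : (0 < n)%N -> 0 <= b -> (forall i, `|r i| <= e) ->
  (forall a, n%:R^-1 * \sum_i dotc a (x i) ^+ 2 <= b * enorm a ^+ 2) ->
  enorm (n%:R^-1 *: \sum_i r i *: x i) ^+ 2 <= b * e ^+ 2.
Proof.
move=> n0 b0 re bx; set a := _ *: _.
have n0' : 0 < n%:R :> R by rewrite ltr0n.
have aE : enorm a ^+ 2 = n%:R^-1 * \sum_i r i * dotc a (x i).
  rewrite enorm_sqr {2}/a dotcZr dotc_sumr; congr (_ * _).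
  by apply: eq_bigr => i _; rewrite dotcZr.
have [a0|a0] := eqVneq (enorm a) 0.
  by rewrite a0 expr0n/= mulr_ge0// sqr_ge0.
have a0' : 0 < enorm a ^+ 2 by rewrite exprn_gt0// lt_neqAle eq_sym a0 enorm_ge0.
rewrite -(ler_pM2r a0') -expr2 {1}aE exprMn.
apply: (@le_trans _ _ ((n%:R^-1 * \sum_i r i ^+ 2) * (b * enorm a ^+ 2))).
  apply: (@le_trans _ _ ((n%:R^-1 * \sum_i r i ^+ 2) *
      (n%:R^-1 * \sum_i dotc a (x i) ^+ 2))).
    rewrite [leRHS]mulrACA -expr2 ler_wpM2l ?sqr_ge0//; exact: sum_cauchy_schwarz.
  rewrite ler_wpM2l// mulr_ge0 ?invr_ge0 ?ler0n//.
  by apply: sumr_ge0 => i _; exact: sqr_ge0.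
rewrite mulrA ler_wpM2r ?sqr_ge0// mulrC ler_wpM2l//.
rewrite ler_pdivrMl// mulr_natl.
have -> : e ^+ 2 *+ n = \sum_(i < n) e ^+ 2 by rewrite sumr_const card_ord.
apply: ler_sum => i _; rewrite -real_normK ?num_real//.
by rewrite ler_pXn2r ?nnegrE// (le_trans _ (re i)).
Qed.

End euclidean_norm.

(** * Borel sets, null sets and compactness in Euclidean space *)

Section borel.
Context {R : realType} {d : nat}.
Implicit Types (U A : set 'rV[R]_d) (x : 'rV[R]_d).

Definition rational_box (c : 'rV[rat]_d * nat) : set 'rV[R]_d :=
  [set v | forall i, `|v ord0 i - ratr (c.1 ord0 i)| < c.2.+1%:R^-1].

Lemma measurable_box (B : 'I_d -> set R) : (forall i, measurable (B i)) ->
  measurable [set v : 'rV[R]_d | forall i, B i (v ord0 i)].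
Proof.
move=> mB; rewrite (_ : [set v | _] = \bigcap_(i in [set: 'I_d])
    ((fun v : 'rV[R]_d => v ord0 i) @^-1` B i)).
  apply: fin_bigcap_measurable => // i _.
  by rewrite -[X in measurable X]setTI; exact: measurable_coord.
by apply/seteqP; split => v vA i; [move=> _|]; exact: vA.
Qed.

Lemma measurable_rational_box c : measurable (rational_box c).
Proof.
apply: (@measurable_box (fun i => [set r | `|r - ratr (c.1 ord0 i)| < c.2.+1%:R^-1])).
move=> i; apply: (measurable_lt_set (g := cst c.2.+1%:R^-1)) => //.
by apply: measurableT_comp => //; exact: measurable_funB.
Qed.

Lemma rational_box_nbhs x U : nbhs x U ->
  exists c, rational_box c x /\ rational_box c `<=` U.
Proof.
move=> /nbhs_ballP[e /= e0 xU].
have [k ke] : exists k : nat, 2 * k.+1%:R^-1 < e.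
  exists (Num.Def.truncn (2 / e)).
  rewrite ltr_pdivrMr// mulrC -ltr_pdivrMr// truncnS_gt//.
pose r : R := k.+1%:R^-1; have r0 : 0 < r by rewrite invr_gt0.
have H (i : 'I_d) : exists q : rat, `|x ord0 i - ratr q| < r.
  have : x ord0 i - r < x ord0 i + r by rewrite ltrD2l gtrN.
  move=> /rat_in_itvoo[q]; rewrite in_itv/= => /andP[q1 q2]; exists q.
  by rewrite ltr_distlC q1 q2.
have [q hq] := choice H.
exists (\row_i q i, k); split => [i|v vq] /=; first by rewrite mxE.
apply: xU; split => // i j; rewrite (ord1 i) /ball/=.
have := vq j; rewrite mxE /= => vj.
have := hq j; rewrite /r => xj.
rewrite (le_lt_trans _ ke)// mulr_natl mulr2n.
rewrite -[_ - _](subrKA (ratr (q j))) (le_trans (ler_normD _ _))// lerD ?ltW//.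
by rewrite distrC.
Qed.

Definition box_seq (k : nat) : set 'rV[R]_d :=
  if @choice.unpickle ('rV[rat]_d * nat)%type k is Some c then rational_box c else set0.

Lemma measurable_box_seq k : measurable (box_seq k).
Proof. by rewrite /box_seq; case: choice.unpickle => // c; exact: measurable_rational_box. Qed.

Lemma box_seq_nbhs x U : nbhs x U -> exists k, box_seq k x /\ box_seq k `<=` U.
Proof.
move=> /rational_box_nbhs[c [cx cU]]; exists (choice.pickle c).
by rewrite /box_seq choice.pickleK.
Qed.

(** The sigma-algebra is generated by the coordinates, so an open set has to be
    exhausted by countably many rational boxes. *)
Lemma open_measurable_rV U : open U -> measurable U.
Proof.
move=> oU; rewrite (_ : U = \bigcup_k
    (if `[< box_seq k `<=` U >] then box_seq k else set0)).
  apply: bigcup_measurable => k _; case: asboolP => // _.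
  exact: measurable_box_seq.
apply/seteqP; split => [x Ux|x [k _]]; last by case: asboolP => // kU /kU.
have [k [kx kU]] := box_seq_nbhs (open_nbhs_nbhs (conj oU Ux)).
by exists k => //; case: asboolP.
Qed.

Lemma closed_measurable_rV A : closed A -> measurable A.
Proof.
move=> cA; rewrite -[A]setCK; apply: measurableC.
by apply: open_measurable_rV; exact: closed_openC.
Qed.

Lemma continuous_measurable_rV U (g : 'rV[R]_d -> R) : open U ->
  (forall x, U x -> {for x, continuous g}) -> measurable_fun U g.
Proof.
move=> oU cg; apply: (measurability _ (RGenOInfty.measurableE R)).
move=> _ [_ [a ->] <-]; apply: open_measurable_rV.
rewrite openE => x [Ux]; rewrite /= in_itv/= andbT => ax.
have nU : nbhs x U by exact: open_nbhs_nbhs.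
have ng : nbhs x (g @^-1` [set` `]a, +oo[]).
  apply: (cg x Ux); apply: open_nbhs_nbhs; split; first exact: interval_open.
  by rewrite /= in_itv/= andbT.
exact: filterI.
Qed.

(** Points outside the support lie in null boxes, of which there are only
    countably many. *)
Lemma null_outside_support (mu : {measure set 'rV[R]_d -> \bar R}) :
  mu.-negligible (~` [set x | forall U, open U -> U x -> (0 < mu U)%E]).
Proof.
pose F k := if mu (box_seq k) == 0%E then box_seq k else set0.
have mF k : measurable (F k) by rewrite /F; case: ifP => // _; exact: measurable_box_seq.
apply: (negligibleS (A := \bigcup_k F k)); last first.
  apply: negligible_bigcup => k; exists (F k); split => //.
  by rewrite /F; case: ifPn => [/eqP|].
move=> x /= /existsNP[U] /not_implyP[oU /not_implyP[Ux /negP]].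
rewrite -leNgt => U0.
have [k [kx kU]] := box_seq_nbhs (open_nbhs_nbhs (conj oU Ux)).
exists k => //; rewrite /F ifT// eq_le measure_ge0 andbT.
rewrite (le_trans _ U0)// le_measure ?inE//.
  exact: measurable_box_seq.
exact: open_measurable_rV.
Qed.

End borel.

Section hyperplanes.
Context {R : realType}.

Definition hyperplane {d} (a : 'rV[R]_d) (b : R) : set 'rV[R]_d :=
  [set x | \sum_(i < d) a ord0 i * x ord0 i = b].

Lemma measurable_linear {d} (a : 'rV[R]_d) :
  measurable_fun setT (fun x : 'rV[R]_d => \sum_(i < d) a ord0 i * x ord0 i).
Proof.
apply: measurable_sum => i; apply: measurable_funM => //.
exact: measurable_coord.
Qed.

Lemma measurable_hyperplane {d} (a : 'rV[R]_d) b : measurable (hyperplane a b).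
Proof.
rewrite /hyperplane -[X in measurable X]setTI.
by have := measurable_linear a measurableT (measurable_set1 b).
Qed.

(** By induction on the dimension: the first coordinate is determined on a
    section if its coefficient is nonzero, and is irrelevant otherwise. *)
Lemma hyperplane_null {d} (a : 'rV[R]_d) b : a != 0 ->
  lebesgue_rV R d (hyperplane a b) = 0%E.
Proof.
elim: d a b => [|d ih] a b a0.
  by move: a0; rewrite (_ : a = 0) ?eqxx//; apply/rowP => -[].
rewrite [LHS]/= /lebesgue_rVS /pushforward.
pose a' : 'rV[R]_d := \row_j a ord0 (lift ord0 j).
have E (p : R * 'rV[R]_d) : hyperplane a b (rV_cons p) <->
    a ord0 ord0 * p.1 + \sum_(i < d) a' ord0 i * p.2 ord0 i = b.
  rewrite /hyperplane /= big_ord_recl /rV_cons mxE unlift_none.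
  rewrite (eq_bigr (fun i => a' ord0 i * p.2 ord0 i))// => i _.
  by rewrite !mxE liftK.
have mH : measurable (@rV_cons R d @^-1` hyperplane a b).
  by rewrite -[X in measurable X]setTI; apply: measurable_rV_cons => //;
    exact: measurable_hyperplane.
have [a00|a00] := eqVneq (a ord0 ord0) 0.
  apply: integral0_eq => x _ /=.
  rewrite (_ : xsection _ x = hyperplane a' b).
    apply: ih; apply: contra a0 => /eqP a'0; apply/eqP/rowP => i; rewrite mxE.
    case: (unliftP ord0 i) => [j ->|->//].
    by have /rowP/(_ j) := a'0; rewrite !mxE.
  apply/seteqP; split => v.
    by rewrite /xsection /= inE => /E /=; rewrite a00 mul0r add0r.
  by move=> Hv; rewrite /xsection /= inE; apply/E; rewrite a00 mul0r add0r.
rewrite (@product_measure_unique _ _ _ _ _ _ _ (lebesgue_measure \x^ lebesgue_rV R d)%E)//; last first.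
  by move=> A B mA mB; exact: product_measure2E.
apply: integral0_eq => v _ /=.
rewrite (_ : ysection _ v =
  [set (b - \sum_(i < d) a' ord0 i * v ord0 i) / a ord0 ord0]).
  exact: lebesgue_measure_set1.
apply/seteqP; split => x.
  rewrite /ysection /= inE => /E /= <-.
  by rewrite addrK mulrC mulKf.
move=> /= ->; rewrite /ysection /= inE; apply/E => /=.
by rewrite mulrC divfK// subrK.
Qed.

Lemma linear_continuous_at {d} (a x : 'rV[R]_d) :
  {for x, continuous (fun y : 'rV[R]_d => \sum_(i < d) a ord0 i * y ord0 i)}.
Proof.
elim: (index_enum _) => [|i r ih].
  rewrite (_ : (fun y => _) = cst 0); first exact: cst_continuous.
  by apply/funext => y; rewrite big_nil.
rewrite (_ : (fun y => _) = (fun y : 'rV[R]_d => a ord0 i * y ord0 i +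
    \sum_(j <- r) a ord0 j * y ord0 j)).
  apply: continuousD => //; apply: continuousM; first exact: cst_continuous.
  exact: coord_continuous.
by apply/funext => y; rewrite big_cons.
Qed.

(** A strict inequality between a linear form and a constant persists nearby, so
    only the hyperplanes of nonconstant forms can separate a point from nearby
    points of A. *)
Lemma polyhedral_boundary {d} (A : set 'rV[R]_d) : polyhedral A ->
  exists (I : finType) (a : I -> 'rV[R]_d) (b : I -> R), forall x,
    ~ (exists i, a i != 0 /\ hyperplane (a i) (b i) x) ->
    \forall y \near x, A y -> A x.
Proof.
move=> [k [j [H [hH ->]]]].
have hH' (il : 'I_k * 'I_j) : exists ab : 'rV[R]_d * R,
    H il.1 il.2 = [set x | \sum_(i < d) ab.1 ord0 i * x ord0 i < ab.2] \/
    H il.1 il.2 = [set x | \sum_(i < d) ab.1 ord0 i * x ord0 i <= ab.2].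
  by have [a [b Hab]] := hH il.1 il.2; exists (a, b).
have [ab Hab] := choice hH'.
exists ('I_k * 'I_j)%type, (fun il => (ab il).1), (fun il => (ab il).2) => x nx.
have : \forall y \near x, forall il : 'I_k * 'I_j, H il.1 il.2 y -> H il.1 il.2 x.
  apply: (@filter_forall _ ('I_k * 'I_j)%type
    (fun il y => H il.1 il.2 y -> H il.1 il.2 x) (nbhs x) (nbhs_filter x)) => il.
  set a := (ab il).1; set b := (ab il).2.
  pose L (y : 'rV[R]_d) := \sum_(i < d) a ord0 i * y ord0 i.
  have [a0|a0] := eqVneq a 0.
    have L0 y : L y = 0 by apply: big1 => i _; rewrite a0 mxE mul0r.
    apply: nearW => y; have [->|->] := Hab il; rewrite /= -/a -/b.
      by rewrite -/(L y) -/(L x) !L0.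
    by rewrite -/(L y) -/(L x) !L0.
  have [xb|bx|xb] := ltgtP (L x) b.
  - apply: nearW => y _; have [->|->] /= := Hab il; first exact: xb.
    exact: ltW.
  - have cL : {for x, continuous L} by exact: linear_continuous_at.
    have : nbhs x (L @^-1` [set` `]b, +oo[]).
      apply: cL; apply: open_nbhs_nbhs; split; first exact: interval_open.
      by rewrite /= in_itv/= andbT.
    apply: filterS => y; rewrite /= in_itv/= andbT => yb.
    have [->|->] /= := Hab il; rewrite -/a -/b -/(L y).
      by move=> /lt_trans/(_ yb); rewrite ltxx.
    by move=> /le_lt_trans/(_ yb); rewrite ltxx.
  - exfalso; apply: nx; exists il; split => //.
apply: filterS => y Hy [i _ Hi]; exists i => // l _.
by apply: (Hy (i, l)); exact: Hi.
Qed.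

Lemma null_bigsetU {d} {T : measurableType d} (mu : {measure set T -> \bar R})
    (I : Type) (r : seq I) (F : I -> set T) :
  (forall i, measurable (F i) /\ mu (F i) = 0%E) ->
  measurable (\big[setU/set0]_(i <- r) F i) /\
  mu (\big[setU/set0]_(i <- r) F i) = 0%E.
Proof.
move=> HF; elim/big_ind : _ => [|A B [mA A0] [mB B0]|i _]; last exact: HF.
  by split; rewrite ?measure0.
split; first exact: measurableU.
apply/eqP; rewrite eq_le measure_ge0 andbT.
apply: (@le_trans _ _ (mu A + mu B)%E); first exact: measureU2.
by rewrite A0 B0 adde0.
Qed.

Lemma polyhedral_boundary_null {d} (A : set 'rV[R]_d) : polyhedral A ->
  exists B : set 'rV[R]_d, [/\ measurable B, lebesgue_rV R d B = 0%E &
    forall x, ~ B x -> \forall y \near x, A y -> A x].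
Proof.
move=> /polyhedral_boundary[I [a [b H]]].
pose F i := if a i != 0 then hyperplane (a i) (b i) else set0.
have HF i : measurable (F i) /\ lebesgue_rV R d (F i) = 0%E.
  rewrite /F; case: ifPn => ai; last by rewrite measure0.
  by split; [exact: measurable_hyperplane|exact: hyperplane_null].
have [mB B0] := null_bigsetU (index_enum I) HF.
exists (\big[setU/set0]_(i : I) F i); split => // x nx; apply: H => -[i [ai xi]].
apply: nx; rewrite -bigcup_seq; exists i => /=; first exact: mem_index_enum.
by rewrite /F ai.
Qed.

End hyperplanes.

Section compactness.
Context {R : realType} {d : nat}.

Lemma within_bounded (K : set 'rV[R]_d) (g : 'rV[R]_d -> R) :
  compact K -> {within K, continuous g} -> exists C : R, forall x, K x -> `|g x| <= C.
Proof.
move=> cK cg; have /compact_bounded[M [_ HM]] := continuous_compact cg cK.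
exists (M + 1) => x Kx; apply: (HM (M + 1)); first by rewrite ltrDl.
by exists x.
Qed.

(** A limit at a point bounds g on A near that point, and finitely many of these
    neighbourhoods cover K. *)
Lemma limits_bounded (K A : set 'rV[R]_d) (g : 'rV[R]_d -> R) :
  compact K -> A `<=` K ->
  (forall x, K x -> cvg (g y @[y --> within A (nbhs x)])) ->
  exists C : R, forall x, A x -> `|g x| <= C.
Proof.
move=> cK AK cvgK.
have := (compact_near_coveringP K).1 cK _ (pinfty_nbhs R)
  (fun C x => A x -> `|g x| <= C) _.
move=> /(_ _)[].
  move=> x Kx; have /cvg_ex[l gl] := cvgK x Kx.
  have : \forall y \near within A (nbhs x), `|g y| <= `|l| + 1.
    move/cvgrPdist_le : gl => /(_ 1 ltr01); apply: filterS => y ly.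
    by rewrite -[g y](subrKC l) (le_trans (ler_normD _ _))// lerD2l distrC.
  rewrite near_withinE => gy.
  exists ([set y | A y -> `|g y| <= `|l| + 1], [set C | `|l| + 1 <= C]) => /=.
    by split => //; apply: nbhs_pinfty_ge; rewrite num_real.
  by move=> [y C] [/= H1 H2] Ay; rewrite (le_trans (H1 Ay)).
move=> M [_ HM]; exists (M + 1) => x Ax.
by apply: (HM (M + 1)) => //; [rewrite ltrDl|exact: AK].
Qed.

Lemma within_continuous_at (K U : set 'rV[R]_d) (g : 'rV[R]_d -> R) : open U ->
  U `<=` K -> {within K, continuous g} -> forall x, U x -> {for x, continuous g}.
Proof.
move=> oU UK cg x Ux.
have := continuous_subspaceW UK cg; rewrite continuous_open_subspace//.
by apply; rewrite inE.
Qed.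

Lemma compact_enorm_bounded (K : set 'rV[R]_d) : compact K ->
  exists M : R, forall x y, K x -> K y -> enorm (x - y) <= M.
Proof.
move=> /compact_bounded[M [_ HM]].
have HM1 x : K x -> `|x| <= M + 1 by apply: HM; rewrite ltrDl.
exists (Num.sqrt (\sum_(i < 1) \sum_(j < d) (2 * (M + 1)) ^+ 2)) => x y Kx Ky.
rewrite /enorm ler_wsqrtr//; apply: ler_sum => i _; apply: ler_sum => j _.
have coord_le (v : 'rV[R]_d) : `|v i j| <= `|v|.
  have -> : `|v| = mx_norm v by [].
  rewrite mx_normrE.
  by rewrite (le_bigmax _ (fun ij => `|v ij.1 ij.2|) (i, j)).
have M0 : 0 <= M + 1 := le_trans (normr_ge0 _) (HM1 x Kx).
rewrite !mxE -real_normK ?num_real// ler_pXn2r ?nnegrE ?mulr_ge0//.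
rewrite (le_trans (ler_normB _ _))// mulr_natl mulr2n lerD//.
  by rewrite (le_trans (coord_le _))// HM1.
by rewrite (le_trans (coord_le _))// HM1.
Qed.

Lemma diam_ub (A : set 'rV[R]_d) (M : R) :
  (forall x y, A x -> A y -> enorm (x - y) <= M) ->
  forall x y, A x -> A y -> enorm (x - y) <= diam A.
Proof.
move=> AM x y Ax Ay; apply: ub_le_sup; last by exists x => //; exists y.
by exists M => _ [u Au [v Av <-]]; exact: AM.
Qed.

Lemma ler_coord_enorm (v : 'rV[R]_d) i : `|v ord0 i| <= enorm v.
Proof.
rewrite -(@ler_pXn2r _ 2)// ?nnegrE ?enorm_ge0//.
rewrite /enorm sqr_sqrtr ?big_ord1; last by apply: sumr_ge0 => j _; exact: sqr_ge0.
rewrite real_normK ?num_real// (bigD1 i)//= lerDl.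
by apply: sumr_ge0 => j _; exact: sqr_ge0.
Qed.

(** The set lies in the cube with side 2h centered at any of its points. *)
Lemma volume_diam_le (A : set 'rV[R]_d) (h : R) : measurable A ->
  (forall x y, A x -> A y -> enorm (x - y) <= h) ->
  (lebesgue_rV R d A <= ((2 * `|h|) ^+ d)%:E)%E.
Proof.
move=> mA Ah; have [->|/set0P[x0 Ax0]] := eqVneq A set0.
  by rewrite measure0 lee_fin exprn_ge0// mulr_ge0.
have h0 : 0 <= h := le_trans (enorm_ge0 _) (Ah _ _ Ax0 Ax0).
pose B i : set R := [set` `[x0 ord0 i - h, x0 ord0 i + h]].
apply: (@le_trans _ _ (lebesgue_rV R d [set v | forall i, B i (v ord0 i)])).
  apply: le_measure; rewrite ?inE//.
    by apply: measurable_box => i; exact: measurable_itv.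
  move=> y Ay i; rewrite /B /= in_itv/= -ler_distlC.
  have := le_trans (ler_coord_enorm (x0 - y) i) (Ah _ _ Ax0 Ay).
  by rewrite !mxE.
rewrite lebesgue_rV_box; last by move=> i; exact: measurable_itv.
rewrite (eq_bigr (fun=> (2 * h)%:E)).
  by rewrite prodEFin prodr_const card_ord ger0_norm.
move=> i _; rewrite lebesgue_measure_itv/= lte_fin.
case: ifPn => [_|]; first by rewrite -EFinB; congr EFin; ring.
rewrite -leNgt => hh; congr EFin; lra.
Qed.

End compactness.

(** * Partial derivatives and one-sided limits on open cells *)

Section iterated_derivatives.
Context {R : realType} {d : nat}.
Implicit Types (A : set 'rV[R]_d) (g : 'rV[R]_d -> R) (js : seq 'I_d).

Definition dpart js g : 'rV[R]_d -> R := foldr (fun j => partial1 j) g js.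

Definition directions (q : multi_index d) : seq 'I_d :=
  flatten [seq nseq (q j) j | j <- enum 'I_d].

Lemma partial_dpart q g : partial q g = dpart (directions q) g.
Proof.
rewrite /partial /directions; elim: (enum 'I_d) => [//|j s ih] /=.
rewrite /dpart foldr_cat -/(dpart _ g) -ih.
by elim: (q j) => [//|k /= ->].
Qed.

Lemma size_directions q : size (directions q) = mi_order q.
Proof.
rewrite /directions size_flatten /shape -map_comp /mi_order.
rewrite sumnE big_map big_enum/=; apply: eq_bigr => j _.
by rewrite /= size_nseq.
Qed.

Lemma Ck_open_dpart A k js g : Ck_open k A g -> (size js <= k)%N ->
  Ck_open (k - size js) A (dpart js g).
Proof.
elim: js k g => [|j js ih] k g; first by rewrite subn0.
move=> gk /= jk; have := ih k g gk (ltnW jk).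
rewrite subnS; case E : (k - size js)%N => [|k'].
  by move: jk; rewrite -subn_gt0 E.
by move=> [_ /(_ j)[_]].
Qed.

Lemma Ck_open_continuous A k g : Ck_open k A g ->
  forall x, A x -> {for x, continuous g}.
Proof. by case: k => [[]|k []]. Qed.

Lemma partial_continuous A k q g : Ck_open k A g -> (mi_order q <= k)%N ->
  forall x, A x -> {for x, continuous (partial q g)}.
Proof.
move=> gk qk; rewrite partial_dpart.
by apply: Ck_open_continuous; apply: Ck_open_dpart gk _; rewrite size_directions.
Qed.

Lemma dpart_linear A k js (N : nat) (a : 'I_N -> R) (g : 'I_N -> 'rV[R]_d -> R)
    (F : 'rV[R]_d -> R) : open A -> (forall i, Ck_open k A (g i)) ->
  (size js <= k)%N -> (forall x, A x -> F x = \sum_i a i * g i x) ->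
  forall x, A x -> dpart js F x = \sum_i a i * dpart js (g i) x.
Proof.
move=> oA gk; elim: js => [//|j js ih] /= jk FE x Ax.
have jk' := ltnW jk.
have der i : derivable (dpart js (g i)) x (delta_mx ord0 j).
  have := Ck_open_dpart (gk i) jk'; case E : (k - size js)%N => [|k'].
    by move: jk; rewrite -subn_gt0 E.
  by move=> [_ /(_ j)[+ _]]; exact.
rewrite /partial1.
have -> : 'D_(delta_mx ord0 j) (dpart js F) x =
    'D_(delta_mx ord0 j) (\sum_i (a i *: dpart js (g i))) x.
  apply: near_eq_derive.
  have nA : nbhs x A by exact: open_nbhs_nbhs.
  apply: filterS nA => y Ay; rewrite (ih jk' FE y Ay) fct_sumE.
  by apply: eq_bigr.
rewrite derive_sum; last by move=> i; exact: derivableZ.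
by apply: eq_bigr => i _; rewrite deriveZ.
Qed.

Lemma partial_linear A k q (N : nat) (a : 'I_N -> R) (g : 'I_N -> 'rV[R]_d -> R)
    (F : 'rV[R]_d -> R) : open A -> (forall i, Ck_open k A (g i)) ->
  (mi_order q <= k)%N -> (forall x, A x -> F x = \sum_i a i * g i x) ->
  forall x, A x -> partial q F x = \sum_i a i * partial q (g i) x.
Proof.
move=> oA gk qk FE x Ax; rewrite partial_dpart.
rewrite (dpart_linear oA gk _ FE)// ?size_directions//.
by apply: eq_bigr => i _; rewrite partial_dpart.
Qed.

Lemma partial_eq0 A q g : open A -> (forall x, A x -> g x = 0) ->
  forall x, A x -> partial q g x = 0.
Proof.
move=> oA g0 x Ax.
rewrite (@partial_linear A (mi_order q) q 0 (fun=> 0) (fun=> g))// ?big_ord0//.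
- by move=> [].
- by move=> y /g0 ->; rewrite big_ord0.
Qed.

Lemma partial_mi0 g : partial mi0 g = g.
Proof.
rewrite /partial; elim: (enum 'I_d) => [//|j s /= ->].
by rewrite ffunE.
Qed.

End iterated_derivatives.

Section inner_limits.
Context {R : realType} {d : nat}.
Implicit Types (A : set 'rV[R]_d) (g : 'rV[R]_d -> R).

Lemma interior_open A x : open A -> A x -> A° x.
Proof. by rewrite openE => oA; exact: oA. Qed.

Lemma near_eq_continuous_at (g h : 'rV[R]_d -> R) (x : 'rV[R]_d) :
  (\forall y \near x, g y = h y) -> {for x, continuous h} -> {for x, continuous g}.
Proof.
move=> gh ch; have gx : g x = h x by exact: nbhs_singleton gh.
suff : g @ x --> g x by [].
rewrite gx => U hU.
have {}hU : nbhs x (h @^-1` U) by exact: ch.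
have : nbhs x (g @^-1` U).
  apply: (@filterS2 _ (nbhs x) (nbhs_filter x) _ _ _ _ gh hU) => y gy.
  by rewrite /preimage /= gy.
by [].
Qed.

Lemma inner_lim_continuous A g x : A° x -> {for x, continuous g} ->
  inner_lim A g x = g x.
Proof.
move=> Ax cg; rewrite /inner_lim within_interior; last exact: interior_open (open_interior A) Ax.
exact: cvg_lim.
Qed.

(** The filter of neighbourhoods of x contains x itself, so convergence along it
    is continuity. *)
Lemma inner_cvg_continuous A g x : A° x ->
  cvg (g y @[y --> within A° (nbhs x)]) -> {for x, continuous g}.
Proof.
move=> Ax; rewrite within_interior; last exact: interior_open (open_interior A) Ax.
move=> /cvg_ex[l gl].
have gxl : g x = l.
  apply/eqP; rewrite -subr_eq0 -normr_le0.
  apply/ler_addgt0Pl => e e0; rewrite addr0 distrC.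
  by move/cvgrPdist_le : gl => /(_ e e0)/nbhs_singleton.
by have : g @ x --> g x by rewrite gxl.
Qed.

Lemma inner_limE A g x : A° x ->
  cvg (g y @[y --> within A° (nbhs x)]) -> inner_lim A g x = g x.
Proof.
by move=> Ax gx; apply: inner_lim_continuous => //; exact: inner_cvg_continuous gx.
Qed.

End inner_limits.

Section cells.
Context {R : realType} {d k : nat}.
Variables (cells : 'I_k -> set 'rV[R]_d) (supp : set 'rV[R]_d).
Hypothesis hpart : is_partition cells supp.

Definition cell_union : set 'rV[R]_d := \bigcup_(l in setT) cells l.

Lemma open_cell_union : open cell_union.
Proof. by apply: bigcup_open => l _; exact: (partition_open hpart). Qed.

Lemma cell_union_sub : cell_union `<=` supp.
Proof. by move=> x [l _]; exact: (partition_sub hpart). Qed.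

Lemma cell_ofE l x : cells l x -> cell_of cells x = Some l.
Proof.
move=> lx; rewrite /cell_of; case: pickP => [l' /asboolP l'x|/(_ l)].
  have nl : nbhs x (cells l) by apply: open_nbhs_nbhs; split => //; exact: (partition_open hpart).
  have [y [l'y ly]] := l'x _ nl; congr Some.
  exact: (partition_disjoint hpart I I (ex_intro _ y (conj l'y ly))).
by move=> /asboolP; case; exact: subset_closure.
Qed.

Lemma cell_interior l x : cells l x -> (cells l)° x.
Proof. by apply: interior_open; exact: (partition_open hpart). Qed.

Lemma cell_lim_continuous l g x : cells l x -> {for x, continuous g} ->
  cell_lim cells g x = g x.
Proof.
move=> lx cg; rewrite /cell_lim (cell_ofE lx) inner_lim_continuous//.
exact: cell_interior.
Qed.

Lemma measurable_cell_union : measurable cell_union.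
Proof. exact: open_measurable_rV open_cell_union. Qed.

Lemma closed_partition_support : closed supp.
Proof. by rewrite -(partition_cover hpart); exact: closed_closure. Qed.

Lemma measurable_partition_support : measurable supp.
Proof. exact: closed_measurable_rV closed_partition_support. Qed.

(** Off the null boundaries of the cells, a limit of points of the cells is itself
    in a cell. *)
Lemma uncovered_null : lebesgue_rV R d (supp `\` cell_union) = 0%E.
Proof.
have H l := polyhedral_boundary_null (partition_polyhedral hpart l).
have [B HB] := choice H.
have [|mU U0] := @null_bigsetU _ _ _ (lebesgue_rV R d) _ (index_enum 'I_k) B.
  by move=> l; have [] := HB l.
apply: (subset_measure0 _ mU _ U0).
  by apply: measurableD; [exact: measurable_partition_support|exact: measurable_cell_union].
move=> x [sx nx]; apply: contrapT => nBx; apply: nx.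
have near_cells : \forall y \near x, forall l, cells l y -> cells l x.
  apply: (@filter_forall _ 'I_k (fun l y => cells l y -> cells l x)
    (nbhs x) (nbhs_filter x)) => l.
  have [_ _] := HB l; apply => Bx; apply: nBx.
  by rewrite -bigcup_seq; exists l => //=; exact: mem_index_enum.
move: sx; rewrite -(partition_cover hpart) => /(_ _ near_cells)[y [[l _ ly] Hy]].
by exists l => //; exact: Hy.
Qed.

(** The uncovered points form a null set. The integrand is arbitrary because the
    derivatives of basis functions are controlled on the open cells only. *)
Lemma Rintegral_cells (g : 'rV[R]_d -> R) :
  \int[lebesgue_rV R d]_(x in supp) g x =
  \int[lebesgue_rV R d]_(x in cell_union) g x.
Proof.
rewrite (Rintegral_setD_null (N := supp `\` cell_union)); last exact: uncovered_null.
  by rewrite setDD setIidr//; exact: cell_union_sub.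
by apply: measurableD; [exact: measurable_partition_support|exact: measurable_cell_union].
Qed.

Lemma cell_partial_eq l q s g x : Ck s (cells l) g -> (mi_order q <= s)%N ->
  cells l x -> cell_partial cells q g x = partial q g x.
Proof.
move=> [_ gk _] qs lx; rewrite /cell_partial (cell_lim_continuous lx)//.
by apply: (partial_continuous gk qs); exact: cell_interior.
Qed.

Lemma cell_partial_continuous q s g : (forall l, Ck s (cells l) g) ->
  (mi_order q <= s)%N ->
  forall x, cell_union x -> {for x, continuous (cell_partial cells q g)}.
Proof.
move=> gk qs x [l _ lx]; have [_ glk _] := gk l.
have cp := partial_continuous glk qs (cell_interior lx).
apply: near_eq_continuous_at cp.
have : nbhs x (cells l) by apply: open_nbhs_nbhs; split => //; exact: (partition_open hpart).
by apply: filterS => y ly; rewrite (cell_partial_eq (gk l) qs ly).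
Qed.

(** Around a point of an open cell the family is smooth and differentiation is
    linear; the limit from within the cell is then the value at the point. *)
Lemma cell_partial_linear q s (N : nat) (a : 'I_N -> R) (g : 'I_N -> 'rV[R]_d -> R) x :
  (forall i l, Ck s (cells l) (g i)) -> (mi_order q <= s)%N -> cell_union x ->
  cell_partial cells q (fun y => \sum_i a i * g i y) x =
  \sum_i a i * cell_partial cells q (g i) x.
Proof.
move=> gk qs [l _ lx].
have ol : open (cells l) by exact: (partition_open hpart).
have gok i : Ck_open s (cells l) (g i).
  by have [_ + _] := gk i l; rewrite (_ : (cells l)° = cells l)//; apply/interior_id.
pose F (y : 'rV[R]_d) := \sum_i a i * g i y.
have FE y : cells l y -> partial q F y = \sum_i a i * partial q (g i) y.
  by move=> ly; exact: (partial_linear ol gok qs).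
have cF : {for x, continuous (partial q F)}.
  apply: (near_eq_continuous_at (h := fun y => \sum_i a i * partial q (g i) y)).
    by apply: filterS (open_nbhs_nbhs (conj ol lx)) => y ly; rewrite FE.
  elim: (index_enum _) => [|i r ih].
    rewrite (_ : (fun y => _) = cst 0); first exact: cst_continuous.
    by apply/funext => y; rewrite big_nil.
  rewrite (_ : (fun y => _) = (fun y : 'rV[R]_d => a i * partial q (g i) y +
      \sum_(j <- r) a j * partial q (g j) y)).
    apply: continuousD => //; apply: continuousM; first exact: cst_continuous.
    exact: (partial_continuous (gok i) qs).
  by apply/funext => y; rewrite big_cons.
rewrite /cell_partial (cell_lim_continuous lx cF) FE//.
by apply: eq_bigr => i _; rewrite -/(cell_partial cells q (g i) x) (cell_partial_eq (gk i l) qs lx).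
Qed.

Lemma cell_partial_inactive q g l x : cells l x -> ~ active_on g (cells l) ->
  cell_partial cells q g x = 0.
Proof.
move=> lx ng; have ol : open (cells l) by exact: (partition_open hpart).
have g0 y : cells l y -> g y = 0.
  by move=> ly; apply/eqP; apply: contrapT => /negP gy; apply: ng; exists y.
have p0 y : cells l y -> partial q g y = 0 by exact: (partial_eq0 q ol g0).
rewrite /cell_partial (cell_lim_continuous lx) ?p0//.
apply: (near_eq_continuous_at (h := cst 0)); last exact: cst_continuous.
by apply: filterS (open_nbhs_nbhs (conj ol lx)) => y ly; rewrite p0.
Qed.

End cells.

(** * Gram matrices of locally supported functions *)

Section local_family.
Context {R : realType} {d K k : nat}.
Variables (cells : 'I_k -> set 'rV[R]_d) (supp : set 'rV[R]_d).
Hypothesis hpart : is_partition cells supp.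
Variables (p : 'rV[R]_d -> 'cV[R]_K) (C : nat) (h : R).

Local Notation D := (cell_union cells).
Local Notation lam := (lebesgue_rV R d).
Local Notation pk i := (fun x : 'rV[R]_d => p x i ord0).
Local Notation act i := (active_cells cells (pk i)).

Hypothesis h0 : 0 < h.
Hypothesis cells_diam : forall l x y, cells l x -> cells l y -> enorm (x - y) <= h.
Hypothesis act_le : forall i, (#|act i| <= C)%N.
Hypothesis nbr_le : forall i, (#|[pred j : 'I_K |
  `[< active_on (pk j) (active_region cells (pk i)) >]]| <= C)%N.
Hypothesis finD : (lam D < +oo)%E.

Let mD : measurable D := measurable_cell_union hpart.

Let mcell l : measurable (cells l).
Proof. by apply: open_measurable_rV; exact: (partition_open hpart). Qed.

Lemma bm_indic (A : set 'rV[R]_d) : measurable A -> bounded_measurable D (\1_A : _ -> R).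
Proof.
move=> mA; split; first exact: measurable_indic.
by exists 1 => x _; rewrite indicE; case: (_ \in _); rewrite ?normr1 ?normr0.
Qed.

Lemma Rintegral_cell_le l : \int[lam]_(x in D) \1_(cells l) x <= (2 * h) ^+ d.
Proof.
rewrite /Rintegral integral_indic//.
have sub : (lam (cells l `&` D) <= ((2 * h) ^+ d)%:E)%E.
  rewrite -{1}(gtr0_norm h0); apply: volume_diam_le; first exact: measurableI.
  by move=> x y [lx _] [ly _]; exact: (cells_diam lx ly).
rewrite -lee_fin fineK// ge0_fin_numE//.
by apply: le_lt_trans sub _; rewrite ltry.
Qed.

(** A function that vanishes where the i-th basis function is inactive lives on
    at most C cells of diameter at most h. *)
Lemma local_integral_le i (g : 'rV[R]_d -> R) (b : R) : 0 <= b ->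
  bounded_measurable D g -> (forall x, D x -> `|g x| <= b) ->
  (forall l x, cells l x -> l \notin act i -> g x = 0) ->
  `|\int[lam]_(x in D) g x| <= b * (C%:R * (2 * h) ^+ d).
Proof.
move=> b0 bg gb gi.
apply: (le_trans (le_normr_Rintegral mD (bm_integrable mD finD bg))).
pose u x := b * \sum_(l | l \in act i) \1_(cells l) x : R.
have bu : bounded_measurable D u.
  apply: bmM; first exact: bm_cst.
  by apply: bm_sum => l _; exact: bm_indic.
have bng : bounded_measurable D (fun x => `|g x|).
  have [mg _] := bg; split; last by exists b => x Dx; rewrite normr_id gb.
  exact: measurableT_comp.
apply: (@le_trans _ _ (\int[lam]_(x in D) u x)).
  apply: le_Rintegral_bm => // x Dx; rewrite /u.
  have [l _ lx] := Dx; have [li|li] := boolP (l \in act i); last first.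
    rewrite (gi l)// normr0 mulr_ge0//; apply: sumr_ge0 => l' _.
    by rewrite indicE.
  rewrite (bigD1 l)//= indicE mem_set// mulrDr mulr1 ler_wpDr ?gb//.
  by rewrite mulr_ge0//; apply: sumr_ge0 => l' _; rewrite indicE.
rewrite RintegralZl//; last first.
  by apply: bm_integrable => //; apply: bm_sum => l _; exact: bm_indic.
rewrite ler_wpM2l// Rintegral_sum//; last by move=> l _; exact: bm_indic.
apply: (@le_trans _ _ (\sum_(l | l \in act i) (2 * h) ^+ d)).
  by apply: ler_sum => l _; exact: Rintegral_cell_le.
rewrite sumr_const -(mulr_natl ((2 * h) ^+ d)) ler_wpM2r ?ler_nat//.
by rewrite exprn_ge0// mulr_ge0// ltW.
Qed.

Definition adjacent : rel 'I_K := fun i j => [exists l, (l \in act i) && (l \in act j)].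

Lemma adjacent_sym : symmetric adjacent.
Proof. by move=> i j; apply: eq_existsb => l; rewrite andbC. Qed.

Lemma card_adjacent i : (#|[pred j | adjacent i j]| <= C)%N.
Proof.
apply: leq_trans (nbr_le i); apply: subset_leq_card; apply/fintype.subsetP => j.
move=> /existsP[l /andP[li lj]].
have /asboolP[x lx jx] : `[< active_on (pk j) (cells l) >] := lj.
by apply/asboolP; exists x => //; exists l.
Qed.

(** The basis functions active on one cell all overlap with each other. *)
Lemma card_active l : (#|[pred i : 'I_K | l \in act i]| <= C)%N.
Proof.
have [i0 li0|none] := pickP [pred i : 'I_K | l \in act i]; last first.
  by rewrite eq_card0// => i; rewrite inE; exact: none.
apply: leq_trans (card_adjacent i0); apply: subset_leq_card.
by apply/fintype.subsetP => j lj; apply/existsP; exists l; apply/andP; split.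
Qed.

(** Instances are the basis functions and their partial derivatives, which vanish
    on the cells where the basis function itself does. *)
Definition local_functions (phi : 'I_K -> 'rV[R]_d -> R) (M : R) : Prop :=
  [/\ forall i, measurable_fun D (phi i),
      forall x, D x -> enorm (\col_i phi i x) <= M &
      forall i l x, cells l x -> l \notin act i -> phi i x = 0].

Section gram.
Variables (phi : 'I_K -> 'rV[R]_d -> R) (M : R).
Hypotheses (hphi : local_functions phi M) (M0 : 0 <= M).
Variables (nu : 'rV[R]_d -> R) (N : R).
Hypotheses (bnu : bounded_measurable D nu) (nuN : forall x, D x -> `|nu x| <= N).
Hypothesis N0 : 0 <= N.

Definition wgram : 'M[R]_K :=
  \matrix_(i, j) \int[lam]_(x in D) (phi i x * phi j x * nu x).

Lemma local_bound i x : D x -> `|phi i x| <= M.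
Proof.
move=> Dx; have [_ H _] := hphi; apply: le_trans (H x Dx).
by have := ler_norm_enorm (\col_i phi i x) i; rewrite mxE.
Qed.

Lemma bm_local i : bounded_measurable D (phi i).
Proof.
by have [mphi _ _] := hphi; split => //; exists M => x; exact: local_bound.
Qed.

Lemma wgram_entry_le i j : `|wgram i j| <= M ^+ 2 * N * (C%:R * (2 * h) ^+ d).
Proof.
rewrite mxE; apply: (@local_integral_le i).
- by rewrite mulr_ge0// exprn_ge0.
- by apply: bmM => //; apply: bmM; exact: bm_local.
- move=> x Dx; rewrite !normrM expr2 ler_pM ?mulr_ge0 ?nuN//.
  by rewrite ler_pM ?local_bound.
- by move=> l x lx li; have [_ _ H] := hphi; rewrite (H i l x)// !mul0r.
Qed.

Lemma wgram_nonadjacent i j : ~~ adjacent i j -> wgram i j = 0.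
Proof.
move=> ij; rewrite mxE (@eq_Rintegral _ _ _ _ _ (cst 0)).
  by rewrite Rintegral_cst// mul0r.
move=> x /set_mem[l _ lx] /=; have [_ _ H] := hphi.
have [li|li] := boolP (l \in act i); last by rewrite (H i l x)// !mul0r.
have [lj|lj] := boolP (l \in act j); last by rewrite (H j l x)// mulr0 mul0r.
by move/existsP : ij; case; exists l; rewrite li.
Qed.

(** Only the entries at adjacent indices are nonzero, and adjacency has bounded
    degree. *)
Lemma wgram_bound (v : 'cV[R]_K) : enorm (wgram *m v) <=
  C%:R * (M ^+ 2 * N * (C%:R * (2 * h) ^+ d)) * enorm v.
Proof.
apply: (sparse_bound (adj := adjacent)).
- by rewrite !mulr_ge0 ?exprn_ge0 ?mulr_ge0// ltW.
- exact: adjacent_sym.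
- exact: card_adjacent.
- by move=> i j _; exact: wgram_entry_le.
- exact: wgram_nonadjacent.
Qed.

Lemma dotc_wgram a b : dotc a (wgram *m b) =
  \int[lam]_(x in D) (dotc a (\col_i phi i x) * dotc b (\col_i phi i x) * nu x).
Proof.
have bms i j : bounded_measurable D (fun x => a i ord0 * (phi i x * phi j x * nu x) * b j ord0).
  apply: bmM; last exact: bm_cst.
  apply: bmM; first exact: bm_cst.
  by apply: bmM => //; apply: bmM; exact: bm_local.
transitivity (\int[lam]_(x in D) (\sum_i \sum_j
    a i ord0 * (phi i x * phi j x * nu x) * b j ord0)).
  rewrite Rintegral_sum//; last by move=> i _; apply: bm_sum => j _; exact: bms.
  apply: eq_bigr => i _; rewrite mxE mulr_sumr Rintegral_sum//.
  apply: eq_bigr => j _; rewrite mxE mulrA -RintegralZl//; last first.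
    by apply: bm_integrable => //; apply: bmM => //; apply: bmM; exact: bm_local.
  rewrite -RintegralZr//; apply: bm_integrable => //; apply: bmM; first exact: bm_cst.
  by apply: bmM => //; apply: bmM; exact: bm_local.
apply: eq_Rintegral => x _.
rewrite /dotc big_distrlr/= mulr_suml; apply: eq_bigr => i _.
rewrite mulr_suml; apply: eq_bigr => j _; rewrite !mxE; ring.
Qed.

End gram.

Section coercivity.
Variables (M c : R).
Hypotheses (hp : local_functions (fun i x => p x i ord0) M) (M0 : 0 <= M) (c0 : 0 < c).
Hypothesis basis_gram : forall (i : 'I_K) (a : 'cV[R]_K),
  c * (a i ord0 ^+ 2 * h ^+ d) <=
  (a^T *m (\matrix_(j, j') \int[lam]_(x in active_region cells (pk i))
     (p x j ord0 * p x j' ord0)) *m a) ord0 ord0.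

Let mregion i : measurable (active_region cells (pk i)).
Proof. by apply: fin_bigcup_measurable => // l _; exact: mcell. Qed.

Let region_sub i : active_region cells (pk i) `<=` D.
Proof. by move=> x [l _ lx]; exists l. Qed.

Let colE x : \col_i p x i ord0 = p x.
Proof. by apply/colP => i; rewrite mxE. Qed.

Let bp i : bounded_measurable D (pk i) := bm_local hp i.

Lemma bm_dotc (a : 'cV[R]_K) : bounded_measurable D (fun x => dotc a (p x)).
Proof. by apply: bm_sum => i _; apply: bmM; [exact: bm_cst|exact: bp]. Qed.

Let region_form (i : 'I_K) (a : 'cV[R]_K) :
  c * (a i ord0 ^+ 2 * h ^+ d) <=
  \int[lam]_(x in D) (\1_(active_region cells (pk i)) x * dotc a (p x) ^+ 2).
Proof.
apply: (le_trans (basis_gram i a)); rewrite -mulmxA dotcE.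
set Hi := active_region _ _.
have mHi : measurable Hi := mregion i.
have finH : (lam Hi < +oo)%E.
  apply: le_lt_trans finD; apply: le_measure; rewrite ?inE//.
  exact: region_sub.
have bH j j' : bounded_measurable Hi (fun x => p x j ord0 * p x j' ord0).
  by apply: (bm_subset mD (mregion i) (@region_sub i)); apply: bmM; exact: bp.
rewrite le_eqVlt; apply/orP; left; apply/eqP.
transitivity (\int[lam]_(x in Hi) dotc a (p x) ^+ 2); last first.
  rewrite [LHS]Rintegral_mkcond [RHS]Rintegral_mkcond.
  apply: eq_Rintegral => x _; rewrite !patchE indicE.
  have [Hx|Hx] := boolP (x \in Hi); last by rewrite mul0r if_same.
  by rewrite ifT ?mul1r// inE; apply: (region_sub (i := i)); move: Hx; rewrite inE.
have bms j j' : bounded_measurable Hi (fun x => a j ord0 * (p x j ord0 * p x j' ord0) * a j' ord0).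
  apply: bmM; last exact: bm_cst.
  by apply: bmM => //; exact: bm_cst.
transitivity (\int[lam]_(x in Hi) (\sum_j \sum_j'
    a j ord0 * (p x j ord0 * p x j' ord0) * a j' ord0)).
  rewrite Rintegral_sum//; last by move=> j _; apply: bm_sum => j' _; exact: bms.
  apply: eq_bigr => j _; rewrite mxE mulr_sumr Rintegral_sum//.
  apply: eq_bigr => j' _; rewrite mxE mulrA -RintegralZl//; last first.
    exact: bm_integrable.
  rewrite -RintegralZr//; apply: bm_integrable => //; apply: bmM => //.
  exact: bm_cst.
apply: eq_Rintegral => x _.
rewrite expr2 /dotc big_distrlr/=; apply: eq_bigr => j _.
apply: eq_bigr => j' _; ring.
Qed.

(** Summing the local lower bounds over all basis functions counts each cell at
    most C times. *)
Lemma wgram_coercive (nu : 'rV[R]_d -> R) (nu0 : R) : 0 < nu0 ->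
  bounded_measurable D nu -> (forall x, D x -> nu0 <= nu x) ->
  coercive (c * nu0 / C.+1%:R * h ^+ d) (wgram (fun i x => p x i ord0) nu).
Proof.
move=> nu00 bnu nuge a.
have C0 : 0 < C.+1%:R :> R by [].
rewrite (dotc_wgram hp bnu).
under eq_Rintegral do rewrite colE -expr2.
have bI i : bounded_measurable D (fun x =>
    \1_(active_region cells (pk i)) x * dotc a (p x) ^+ 2).
  by apply: bmM; [apply: bm_indic; exact: mregion|apply: bmX; exact: bm_dotc].
have S : c * h ^+ d * enorm a ^+ 2 <=
    \int[lam]_(x in D) (C.+1%:R / nu0 * (dotc a (p x) ^+ 2 * nu x)).
  rewrite enorm_sqr_sum mulr_sumr.
  apply: (@le_trans _ _ (\sum_(i < K) \int[lam]_(x in D)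
      (\1_(active_region cells (pk i)) x * dotc a (p x) ^+ 2))).
    apply: ler_sum => i _; apply: le_trans (region_form i a).
    by rewrite le_eqVlt; apply/orP; left; apply/eqP; ring.
  rewrite -Rintegral_sum//; apply: le_Rintegral_bm => //.
  - by apply: bm_sum => i _; exact: bI.
  - apply: bmM; first exact: bm_cst.
    by apply: bmM => //; apply: bmX; exact: bm_dotc.
  move=> x Dx; rewrite -mulr_suml.
  apply: (@le_trans _ _ (C.+1%:R * dotc a (p x) ^+ 2)); last first.
    have -> : C.+1%:R / nu0 * (dotc a (p x) ^+ 2 * nu x) =
      C.+1%:R * dotc a (p x) ^+ 2 * (nu x / nu0) by ring.
    apply: ler_peMr; first by rewrite mulr_ge0 ?sqr_ge0.
    by rewrite ler_pdivlMr// mul1r nuge.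
  rewrite ler_wpM2r ?sqr_ge0//.
  have [l _ lx] := Dx.
  apply: (@le_trans _ _ (\sum_(i < K | l \in act i) 1)).
    rewrite [leRHS]big_mkcond/=; apply: ler_sum => i _; rewrite indicE.
    have [|] := boolP (x \in _); last by case: ifP.
    rewrite inE => -[l' /= li l'x].
    rewrite ifT// (_ : l = l')//.
    apply: (partition_disjoint hpart) => //.
    by exists x.
  rewrite sumr_const ler_nat ltnW// ltnS.
  exact: card_active.
rewrite RintegralZl// in S; last first.
  apply: bm_integrable => //; apply: bmM => //; apply: bmX; exact: bm_dotc.
rewrite -(ler_pM2l (divr_gt0 C0 nu00)) (le_trans _ S)// le_eqVlt; apply/orP; left.
by apply/eqP; move: C0; set m := C.+1%:R => m0; field; rewrite !gt_eqF.
Qed.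

(** The local lower bounds for the unit vectors add up to at most the integral of
    the squared norm of p. *)
Lemma basis_card_bound : c * h ^+ d * K%:R <= M ^+ 2 * fine (lam D).
Proof.
have bI i : bounded_measurable D (fun x =>
    \1_(active_region cells (pk i)) x * dotc (delta_mx i ord0) (p x) ^+ 2).
  by apply: bmM; [apply: bm_indic; exact: mregion|apply: bmX; exact: bm_dotc].
apply: (@le_trans _ _ (\sum_(i < K) \int[lam]_(x in D)
    (\1_(active_region cells (pk i)) x * dotc (delta_mx i ord0) (p x) ^+ 2))).
  rewrite mulrC mulr_natl -[X in _ *+ X](card_ord K) -sumr_const.
  apply: ler_sum => i _; apply: le_trans (region_form i (delta_mx i ord0)).
  by rewrite mxE !eqxx expr1n mul1r.
rewrite -Rintegral_sum// -Rintegral_cst//; apply: le_Rintegral_bm => //.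
- by apply: bm_sum => i _; exact: bI.
- exact: bm_cst.
move=> x Dx.
have Mx : enorm (p x) <= M by rewrite -colE; have [_ H _] := hp; exact: H.
apply: (@le_trans _ _ (enorm (p x) ^+ 2)); last first.
  by rewrite ler_pXn2r ?nnegrE ?enorm_ge0.
rewrite enorm_sqr_sum; apply: ler_sum => i _.
have -> : dotc (delta_mx i ord0) (p x) = p x i ord0.
  rewrite /dotc (bigD1 i)//= big1 => [|j ji]; first by rewrite mxE !eqxx mul1r addr0.
  by rewrite mxE (negbTE ji) mul0r.
by rewrite ler_piMl ?sqr_ge0// indicE; case: (_ \in _).
Qed.

End coercivity.

End local_family.

(** * The integrated squared error at a fixed design *)

Section fixed_design.
Context {R : realType} {dT : measure_display} {T : measurableType dT} {K : nat}.
Variables (lam : {measure set T -> \bar R}) (D : set T).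
Hypotheses (mD : measurable D) (finD : (lam D < +oo)%E).
Variables (psi : T -> 'cV[R]_K) (Mq : R) (w : T -> R) (Nw : R).
Hypothesis bpsi : forall i, bounded_measurable D (fun x => psi x i ord0).
Hypothesis psiM : forall x, D x -> enorm (psi x) <= Mq.
Hypotheses (bw : bounded_measurable D w) (w0 : forall x, D x -> 0 <= w x)
  (wN : forall x, D x -> w x <= Nw).
Hypotheses (Mq0 : 0 <= Mq) (Nw0 : 0 <= Nw).

Lemma bm_mulmx (A : 'M[R]_K) i : bounded_measurable D (fun x => (A *m psi x) i ord0).
Proof.
under [X in bounded_measurable D X]eq_fun do rewrite mxE.
by apply: bm_sum => j _; apply: bmM; [exact: bm_cst|exact: bpsi].
Qed.

Lemma bm_dotc_psi (v : 'cV[R]_K) : bounded_measurable D (fun x => dotc (psi x) v).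
Proof.
by apply: bm_sum => i _; apply: bmM; [exact: bpsi|exact: bm_cst].
Qed.

Definition sandwich (G S : 'M[R]_K) (x : T) : R :=
  dotc (invmx G *m psi x) (S *m (invmx G *m psi x)).

Lemma bm_sandwich (G S : 'M[R]_K) : bounded_measurable D (sandwich G S).
Proof.
apply: bm_sum => i _; apply: bmM; first exact: bm_mulmx.
under [X in bounded_measurable D X]eq_fun do rewrite mulmxA.
exact: bm_mulmx.
Qed.

Lemma Rintegral_weight_le (g : T -> R) (b : R) : 0 <= b ->
  bounded_measurable D g -> (forall x, D x -> g x <= b) ->
  \int[lam]_(x in D) (g x * w x) <= b * Nw * fine (lam D).
Proof.
move=> b0 bg gb; rewrite -Rintegral_cst//; apply: le_Rintegral_bm => //.
- exact: bmM.
- exact: bm_cst.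
move=> x Dx; apply: (@le_trans _ _ (b * w x)).
  by rewrite ler_wpM2r ?w0 ?gb.
by rewrite ler_wpM2l ?wN.
Qed.

Section variance.
Variables (k t b : R) (G Gh S Sh : 'M[R]_K).
Hypotheses (k0 : 0 < k) (t0 : 0 <= t) (b0 : 0 <= b).
Hypotheses (kG : coercive k G)
  (bS : forall a : 'cV[R]_K, enorm (S *m a) <= b * enorm a).

Lemma variance_perturbation : coercive k Gh ->
  (forall a : 'cV[R]_K, enorm ((Gh - G) *m a) <= t * enorm a) ->
  (forall a : 'cV[R]_K, enorm ((Sh - S) *m a) <= t * enorm a) ->
  `|\int[lam]_(x in D) (sandwich Gh Sh x * w x) -
    \int[lam]_(x in D) (sandwich G S x * w x)| <=
  (t / k ^+ 2 + 2 * b * t / k ^+ 3) * Mq ^+ 2 * Nw * fine (lam D).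
Proof.
move=> kGh tG tS.
have i1 := bm_integrable mD finD (bmM (bm_sandwich Gh Sh) bw).
have i2 := bm_integrable mD finD (bmM (bm_sandwich G S) bw).
rewrite -RintegralB//.
under eq_Rintegral do rewrite -mulrBl.
set C := t / k ^+ 2 + 2 * b * t / k ^+ 3.
have C0 : 0 <= C.
  by rewrite addr_ge0// divr_ge0 ?mulr_ge0 ?exprn_ge0// ltW.
have bd := bmB (bm_sandwich Gh Sh) (bm_sandwich G S).
have dle x : D x -> `|sandwich Gh Sh x - sandwich G S x| <= C * Mq ^+ 2.
  move=> Dx; apply: (le_trans (sandwich_perturbation (psi x) k0 t0 b0 kG kGh tG bS tS)).
  by rewrite ler_wpM2l// ler_pXn2r ?nnegrE ?enorm_ge0// psiM.
rewrite ler_norml; apply/andP; split.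
  rewrite lerNl -mulN1r -RintegralZl//; last exact/bm_integrable/bmM.
  under eq_Rintegral do rewrite mulrA.
  apply: Rintegral_weight_le.
  - by rewrite mulr_ge0// exprn_ge0.
  - by apply: bmM => //; exact: bm_cst.
  - move=> x Dx; rewrite mulN1r; have := dle x Dx.
    by rewrite ler_norml => /andP[]; rewrite lerNl.
apply: Rintegral_weight_le => //; first by rewrite mulr_ge0// exprn_ge0.
by move=> x Dx; apply: le_trans (ler_norm _) (dle x Dx).
Qed.

Lemma variance_upper :
  \int[lam]_(x in D) (sandwich G S x * w x) <=
  b / k ^+ 2 * Mq ^+ 2 * Nw * fine (lam D).
Proof.
apply: Rintegral_weight_le; last 1 first.
- move=> x Dx; rewrite /sandwich; set g := invmx G *m psi x.
  have eg : enorm g <= Mq / k.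
    apply: (le_trans (coercive_invmx _ k0 kG)).
    by rewrite ler_wpM2r ?psiM// invr_ge0 ltW.
  apply: (le_trans (ler_norm _)); apply: (le_trans (cauchy_schwarz _ _)).
  apply: (@le_trans _ _ (Mq / k * (b * (Mq / k)))).
    rewrite ler_pM ?enorm_ge0// (le_trans (bS _))// ler_wpM2l//.
  rewrite le_eqVlt; apply/orP; left; apply/eqP; field.
  by rewrite gt_eqF.
- by rewrite !mulr_ge0 ?invr_ge0 ?exprn_ge0// ltW.
- exact: bm_sandwich.
Qed.

(** With g = G^-1 psi, the norm of psi = G g is at most B times that of g, which
    bounds g from below. *)
Lemma variance_lower (s0 B mq wl : R) : 0 < s0 -> 0 < B -> 0 <= mq -> 0 <= wl ->
  (forall a : 'cV[R]_K, s0 * dotc a (G *m a) <= dotc a (S *m a)) ->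
  (forall a : 'cV[R]_K, enorm (G *m a) <= B * enorm a) ->
  (forall x, D x -> mq <= enorm (psi x)) -> (forall x, D x -> wl <= w x) ->
  s0 * k / B ^+ 2 * mq ^+ 2 * wl * fine (lam D) <=
  \int[lam]_(x in D) (sandwich G S x * w x).
Proof.
move=> s00 B0 mq0 wl0 SG BG mqpsi wlw.
have uG := coercive_unitmx k0 kG.
rewrite -Rintegral_cst//; apply: le_Rintegral_bm => //.
- exact: bm_cst.
- by apply: bmM => //; exact: bm_sandwich.
have C0 : 0 <= s0 * k / B ^+ 2 by rewrite divr_ge0 ?mulr_ge0 ?exprn_ge0// ltW.
move=> x Dx; apply: ler_pM => //.
- by rewrite mulr_ge0// exprn_ge0.
- rewrite /sandwich; set g := invmx G *m psi x.
  have Gg : psi x = G *m g by rewrite /g mulmxA mulmxV// mul1mx.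
  apply: le_trans (SG g); rewrite -!mulrA ler_pM2l//.
  apply: le_trans (kG g); rewrite ler_pM2l// ler_pdivrMl ?exprn_gt0// -exprMn.
  rewrite ler_pXn2r ?nnegrE ?mulr_ge0 ?enorm_ge0 ?(ltW B0)//.
  by rewrite (le_trans (mqpsi x Dx))// {1}Gg BG.
- exact: wlw.
Qed.

End variance.

(** The squares of two functions differ by little in mean if the functions do;
    the weight eta trades the size of the difference against that of the square. *)
Lemma square_perturbation (f g : T -> R) (eta : R) : 0 < eta ->
  bounded_measurable D f -> bounded_measurable D g ->
  `|\int[lam]_(x in D) (f x ^+ 2 * w x) - \int[lam]_(x in D) (g x ^+ 2 * w x)| <=
  (1 + eta^-1) * \int[lam]_(x in D) ((f x - g x) ^+ 2 * w x) +
  eta * \int[lam]_(x in D) (g x ^+ 2 * w x).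
Proof.
move=> eta0 bf bg.
have bf2 := bmM (bmX 2 bf) bw; have bg2 := bmM (bmX 2 bg) bw.
have bd2 := bmM (bmX 2 (bmB bf bg)) bw.
have I h : bounded_measurable D h -> lam.-integrable D (EFin \o h).
  exact: bm_integrable.
rewrite -RintegralB ?I// -!RintegralZl ?I//.
rewrite -RintegralD; last 3 first.
- by [].
- by apply: I; apply: bmM => //; exact: bm_cst.
- by apply: I; apply: bmM => //; exact: bm_cst.
apply: (le_trans (le_normr_Rintegral mD (I _ (bmB bf2 bg2)))).
apply: le_Rintegral_bm => //.
- have [m [C hC]] := bmB bf2 bg2; split; first exact: measurableT_comp.
  by exists C => x Dx; rewrite normr_id hC.
- by apply: bmD; (apply: bmM; first exact: bm_cst).
move=> x Dx; rewrite -mulrBl normrM (ger0_norm (w0 Dx)) !mulrA -mulrDl.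
rewrite ler_wpM2r ?w0//.
set a := f x; set b := g x.
have ie0 : 0 < eta^-1 by rewrite invr_gt0.
have e1 : eta^-1 * eta = 1 by rewrite mulVf// gt_eqF.
have key : 0 <= eta^-1 * ((a - b) - eta * b) ^+ 2.
  by rewrite mulr_ge0 ?sqr_ge0// ltW.
have key2 : 0 <= eta^-1 * ((a - b) + eta * b) ^+ 2.
  by rewrite mulr_ge0 ?sqr_ge0// ltW.
have expd : eta^-1 * ((a - b) - eta * b) ^+ 2 =
  eta^-1 * (a - b) ^+ 2 - 2 * ((a - b) * b) + eta * b ^+ 2.
  by field; rewrite gt_eqF.
have expd2 : eta^-1 * ((a - b) + eta * b) ^+ 2 =
  eta^-1 * (a - b) ^+ 2 + 2 * ((a - b) * b) + eta * b ^+ 2.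
  by field; rewrite gt_eqF.
have ab : a ^+ 2 - b ^+ 2 = (a - b) ^+ 2 + 2 * ((a - b) * b) by ring.
have s0 := sqr_ge0 (a - b).
rewrite ab ler_norml mulrDl mul1r.
rewrite expd in key; rewrite expd2 in key2.
by apply/andP; split; lra.
Qed.

(** H stands for the volume of a cell, hm for the size of the approximation error
    and hq for the factor by which differentiation enlarges functions. *)
Section bias.
Variables (c1 c2 c3 c4 c5 c6 H hm hq delta : R) (G Gh : 'M[R]_K).
Hypotheses (H0 : 0 < H) (hm0 : 0 <= hm) (hq0 : 0 <= hq)
  (delta0 : 0 < delta) (delta1 : delta <= 1).
Hypotheses (c10 : 0 < c1) (c20 : 0 <= c2) (c30 : 0 <= c3) (c40 : 0 <= c4) (c50 : 0 <= c5).
Hypotheses (kG : coercive (c1 * H) G) (kGh : coercive (c1 * H) Gh)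
  (dG : forall a : 'cV[R]_K, enorm ((Gh - G) *m a) <= delta * H * enorm a).
Hypothesis psi_form : forall v : 'cV[R]_K,
  \int[lam]_(x in D) (dotc (psi x) v ^+ 2 * w x) <= c3 * H * hq ^+ 2 * enorm v ^+ 2.
Variables (rho b0 b0h : 'cV[R]_K).
Hypotheses (rho_le : enorm rho ^+ 2 <= c2 * H * (delta * hm) ^+ 2)
  (b0_le : enorm b0 ^+ 2 <= c5 * H * hm ^+ 2)
  (db0 : enorm (b0h - b0) ^+ 2 <= c4 * H * (delta * hm) ^+ 2).
Variables (f g r : T -> R).
Hypotheses (bf : bounded_measurable D f) (bg : bounded_measurable D g)
  (r_le : forall x, D x -> `|r x| <= delta * (hm * hq)).
Hypothesis fg : forall x, D x ->
  f x - g x = - r x + dotc (psi x) (invmx Gh *m (rho - b0h) + invmx G *m b0).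
Hypothesis g_le : \int[lam]_(x in D) (g x ^+ 2 * w x) <= c6 * (hm * hq) ^+ 2.

Let v : 'cV[R]_K := invmx Gh *m (rho - b0h) + invmx G *m b0.

Let kH : 0 < c1 * H. Proof. exact: mulr_gt0. Qed.

Let v_le : enorm v ^+ 2 <=
  3 * (c2 + c4 + c5 / c1 ^+ 2) / c1 ^+ 2 * (delta * hm) ^+ 2 / H.
Proof.
pose v1 := invmx Gh *m rho; pose v2 := invmx Gh *m (b0h - b0).
pose v3 := invmx Gh *m b0 - invmx G *m b0.
have vE : v = v1 - v2 - v3 by rewrite /v /v1 /v2 /v3 !mulmxBr; apply/colP => i; rewrite !mxE; ring.
have e1 : enorm v1 ^+ 2 <= c2 * H * (delta * hm) ^+ 2 / (c1 * H) ^+ 2.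
  apply: (@le_trans _ _ ((enorm rho / (c1 * H)) ^+ 2)).
    by rewrite ler_pXn2r ?nnegrE ?divr_ge0 ?enorm_ge0 ?(ltW kH)// coercive_invmx.
  by rewrite exprMn exprVn ler_wpM2r ?invr_ge0 ?exprn_ge0 ?(ltW kH).
have e2 : enorm v2 ^+ 2 <= c4 * H * (delta * hm) ^+ 2 / (c1 * H) ^+ 2.
  apply: (@le_trans _ _ ((enorm (b0h - b0) / (c1 * H)) ^+ 2)).
    by rewrite ler_pXn2r ?nnegrE ?divr_ge0 ?enorm_ge0 ?(ltW kH)// coercive_invmx.
  by rewrite exprMn exprVn ler_wpM2r ?invr_ge0 ?exprn_ge0 ?(ltW kH).
have e3 : enorm v3 ^+ 2 <= (delta * H / (c1 * H) ^+ 2) ^+ 2 * (c5 * H * hm ^+ 2).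
  have C0 : 0 <= delta * H / (c1 * H) ^+ 2.
    apply: divr_ge0; last by rewrite exprn_ge0// ltW.
    by rewrite mulr_ge0 ?(ltW delta0) ?(ltW H0).
  apply: (@le_trans _ _ ((delta * H / (c1 * H) ^+ 2 * enorm b0) ^+ 2)).
    rewrite ler_pXn2r ?nnegrE ?enorm_ge0 ?(mulr_ge0 C0 (enorm_ge0 _))//.
    apply: invmx_perturbation => //.
    by rewrite mulr_ge0 ?(ltW delta0) ?(ltW H0).
  by rewrite exprMn ler_wpM2l ?exprn_ge0.
have sq3 : enorm v ^+ 2 <= 3 * (enorm v1 ^+ 2 + enorm v2 ^+ 2 + enorm v3 ^+ 2).
  apply: (@le_trans _ _ ((enorm v1 + enorm v2 + enorm v3) ^+ 2)).
    rewrite ler_pXn2r ?nnegrE ?addr_ge0 ?enorm_ge0//.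
    rewrite vE (le_trans (ler_enormB _ _))// lerD2r ler_enormB//.
  have := sqr_ge0 (enorm v1 - enorm v2); have := sqr_ge0 (enorm v1 - enorm v3).
  have := sqr_ge0 (enorm v2 - enorm v3); nra.
apply: (le_trans sq3).
apply: (@le_trans _ _ (3 * (c2 * H * (delta * hm) ^+ 2 / (c1 * H) ^+ 2 +
  c4 * H * (delta * hm) ^+ 2 / (c1 * H) ^+ 2 +
  (delta * H / (c1 * H) ^+ 2) ^+ 2 * (c5 * H * hm ^+ 2)))).
  by rewrite ler_pM2l// !lerD.
rewrite le_eqVlt; apply/orP; left; apply/eqP; field.
by rewrite !gt_eqF.
Qed.

(** By fg, the two biases differ by the remainder r and by the projections of the
    remainder and of the fluctuation of the leading bias, all of relative size
    delta. With the weight eta = delta the integrated squares then also differ by a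
    relative amount of order delta. *)
Lemma bias_perturbation :
  `|\int[lam]_(x in D) (f x ^+ 2 * w x) - \int[lam]_(x in D) (g x ^+ 2 * w x)| <=
  delta * (hm * hq) ^+ 2 *
  (4 * Nw * fine (lam D) + 12 * c3 * (c2 + c4 + c5 / c1 ^+ 2) / c1 ^+ 2 + c6).
Proof.
apply: (le_trans (square_perturbation delta0 bf bg)).
have bdv : bounded_measurable D (fun x => dotc (psi x) v ^+ 2 * w x).
  by apply: bmM => //; apply: bmX; exact: bm_dotc_psi.
have br : bounded_measurable D r.
  apply: (@bm_eq _ _ _ _ (fun x => dotc (psi x) v - (f x - g x))).
    by move=> x Dx; rewrite fg//; ring.
  by apply: bmB; [exact: bm_dotc_psi|exact: bmB].
have brw : bounded_measurable D (fun x => r x ^+ 2 * w x) by apply: bmM => //; exact: bmX.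
have fin0 : 0 <= fine (lam D) by rewrite fine_ge0.
have diff : \int[lam]_(x in D) ((f x - g x) ^+ 2 * w x) <=
    delta ^+ 2 * (hm * hq) ^+ 2 *
    (2 * Nw * fine (lam D) + 6 * c3 * (c2 + c4 + c5 / c1 ^+ 2) / c1 ^+ 2).
  apply: (@le_trans _ _ (2 * \int[lam]_(x in D) (r x ^+ 2 * w x) +
      2 * \int[lam]_(x in D) (dotc (psi x) v ^+ 2 * w x))).
    rewrite -!RintegralZl//; last 2 first.
    - exact: bm_integrable.
    - exact: bm_integrable.
    rewrite -RintegralD//; last 2 first.
    - by apply: bm_integrable => //; apply: bmM => //; exact: bm_cst.
    - by apply: bm_integrable => //; apply: bmM => //; exact: bm_cst.
    apply: le_Rintegral_bm => //.
    - by apply: bmM => //; apply: bmX; exact: bmB.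
    - by apply: bmD; (apply: bmM; first exact: bm_cst).
    move=> x Dx; rewrite fg// !mulrA -mulrDl ler_wpM2r ?w0//.
    have := sqr_ge0 (r x + dotc (psi x) v); rewrite -/v; nra.
  have rb : \int[lam]_(x in D) (r x ^+ 2 * w x) <=
      (delta * (hm * hq)) ^+ 2 * Nw * fine (lam D).
    apply: Rintegral_weight_le => //; first by rewrite sqr_ge0.
      exact: bmX.
    move=> x Dx; rewrite -real_normK ?num_real//.
    by rewrite ler_pXn2r ?nnegrE ?mulr_ge0 ?r_le// ltW.
  have vb : \int[lam]_(x in D) (dotc (psi x) v ^+ 2 * w x) <=
      c3 * H * hq ^+ 2 *
      (3 * (c2 + c4 + c5 / c1 ^+ 2) / c1 ^+ 2 * (delta * hm) ^+ 2 / H).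
    apply: (le_trans (psi_form v)); apply: ler_wpM2l; last exact: v_le.
    by rewrite !mulr_ge0 ?exprn_ge0 ?(ltW H0).
  apply: (@le_trans _ _ (2 * ((delta * (hm * hq)) ^+ 2 * Nw * fine (lam D)) +
    2 * (c3 * H * hq ^+ 2 *
      (3 * (c2 + c4 + c5 / c1 ^+ 2) / c1 ^+ 2 * (delta * hm) ^+ 2 / H)))).
    by rewrite lerD// ler_pM2l.
  rewrite le_eqVlt; apply/orP; left; apply/eqP; field.
  by rewrite !gt_eqF.
have eta_le : 1 + delta^-1 <= 2 / delta.
  rewrite ler_pdivlMr//.
  have -> : (1 + delta^-1) * delta = delta + 1 by field; rewrite gt_eqF.
  by move: delta1; lra.
have e0 : 0 <= 1 + delta^-1 by rewrite addr_ge0// invr_ge0 ltW.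
set A := _ * (2 * Nw * fine (lam D) + _) in diff.
have A0 : 0 <= A.
  apply: le_trans diff; apply: Rintegral_ge0 => x Dx.
  by rewrite mulr_ge0 ?sqr_ge0 ?w0.
apply: (@le_trans _ _ (2 / delta * A + delta * (c6 * (hm * hq) ^+ 2))).
  rewrite lerD ?ler_pM2l// (le_trans (ler_wpM2l e0 diff))//.
  by rewrite ler_wpM2r.
rewrite le_eqVlt; apply/orP; left; apply/eqP; rewrite /A; field.
by rewrite !gt_eqF.
Qed.

End bias.

End fixed_design.

(** * The law of a regressor *)

Lemma bm_restrict {R : realType} {dT : measure_display} {T : measurableType dT}
    (D : set T) (g : T -> R) : measurable D -> bounded_measurable D g ->
  bounded_measurable setT (g \_ D).
Proof.
move=> mD [mg [C hC]]; split; first exact: (measurable_restrictT _ mD).1.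
exists `|C| => x _; rewrite patchE; case: ifPn => [|_]; last by rewrite normr0.
by rewrite inE => Dx; rewrite (le_trans (hC x Dx))// ler_norm.
Qed.

Section law.
Context {R : realType} {d : nat} {disp : measure_display}
  {Omega : measurableType disp}.
Variables (P : probability Omega R) (X : Omega -> 'rV[R]_d) (f : 'rV[R]_d -> R).
Hypotheses (mX : measurable_fun setT X) (mf : measurable_fun setT f)
  (f0 : forall x, 0 <= f x)
  (density : forall A, measurable A ->
    P (X @^-1` A) = (\int[lebesgue_rV R d]_(x in A) (f x)%:E)%E).
Local Notation lam := (lebesgue_rV R d).

Lemma density_null A : measurable A -> lam A = 0%E -> P (X @^-1` A) = 0%E.
Proof.
move=> mA A0; rewrite density// null_set_integral//.
by apply: measurable_funTS; exact/measurable_EFinP.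
Qed.

(** A regressor is almost surely in its support, and the part of the support that
    the cells leave uncovered is null for Lebesgue measure. *)
Lemma design_in_cells k (cells : 'I_k -> set 'rV[R]_d) (supp : set 'rV[R]_d) :
  is_partition cells supp ->
  supp = [set x | forall U, open U -> U x -> (0 < P (X @^-1` U))%E] ->
  P (X @^-1` ~` cell_union cells) = 0%E.
Proof.
move=> hpart suppE.
have mXi A : measurable A -> measurable (X @^-1` A).
  by move=> mA; rewrite -[X in measurable X]setTI; exact: mX.
have mD := measurable_cell_union hpart.
have mS := measurable_partition_support hpart.
have /(_ mX) nS := null_outside_support (pushforward P X).
have PS : P (X @^-1` ~` supp) = 0%E.
  move/negligibleP : nS; rewrite /pushforward -suppE; apply.
  exact: measurableC.
apply/eqP; rewrite eq_le measure_ge0 andbT.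
apply: (@le_trans _ _ (P ((X @^-1` ~` supp) `|` (X @^-1` (supp `\` cell_union cells))))).
  apply: le_measure; rewrite ?inE.
  - exact/mXi/measurableC.
  - by apply: measurableU; apply: mXi; [exact: measurableC|exact: measurableD].
  - move=> w /= nD; have [Sw|nS'] := pselect (supp (X w)); first by right.
    by left.
apply: (le_trans (measureU2 _ _ _)).
- exact/mXi/measurableC.
- by apply: mXi; exact: measurableD.
have N0 := density_null (measurableD mS mD) (uncovered_null hpart).
by rewrite [X in (X + _)%E]PS add0e [X in (X <= _)%E]N0.
Qed.

Variable D : set 'rV[R]_d.
Hypotheses (mD : measurable D) (finD : (lam D < +oo)%E)
  (PD : P (X @^-1` ~` D) = 0%E) (bf : bounded_measurable D f).

Let nonneg_expectation (phi : 'rV[R]_d -> R) : bounded_measurable D phi ->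
  (forall x, D x -> 0 <= phi x) ->
  \int[P]_w (phi \_ D) (X w) = \int[lam]_(x in D) (phi x * f x).
Proof.
move=> bphi phi0; rewrite /Rintegral; congr fine.
have mXi A : measurable A -> measurable (X @^-1` A).
  by move=> mA; rewrite -[X in measurable X]setTI; exact: mX.
transitivity (\int[P]_w (cst 1 w * (phi \_ D) (X w))%:E)%E.
  by apply: eq_integral => w _; rewrite /= mul1r.
rewrite (@integral_transfer _ _ _ _ _ _ _ P lam (cst 1) (f \_ D) X id)//.
- rewrite [RHS]integral_mkcond; apply: eq_integral => x _.
  by rewrite !patchE; case: ifP => // _; rewrite ?mul0r// mulrC.
- by have [] := bm_restrict mD bf.
- by move=> x; rewrite patchE; case: ifP.
- move=> A mA.
  under eq_integral do rewrite mul1r.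
  transitivity (P (X @^-1` (A `&` D))).
    transitivity (P (X @^-1` A)).
      rewrite -[in RHS](setIT (X @^-1` A)) -integral_indic//; last exact: mXi.
    have := @measureU0 _ _ _ P (X @^-1` (A `&` D)) (X @^-1` (A `\` D)) _ _.
    rewrite -preimage_setU setUIDK => H; apply: H.
    + by apply: mXi; exact: measurableI.
    + by apply: mXi; exact: measurableD.
    + apply/eqP; rewrite eq_le measure_ge0 andbT -PD.
      apply: le_measure; rewrite ?inE.
      * by apply: mXi; exact: measurableD.
      * by apply: mXi; exact: measurableC.
      * by move=> w [].
  rewrite density//; last exact: measurableI.
  rewrite [LHS]integral_mkcond; apply: eq_integral => x _.
  rewrite !patchE indicE in_setI.
  by case: (x \in A) => /=; case: (x \in D); rewrite ?mulr1 ?mulr0 ?mul0r.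
- by have [] := bm_restrict mD bphi.
- by move=> x; rewrite patchE; case: ifPn => //; rewrite inE => /phi0.
Qed.

(** Adding a constant makes phi nonnegative, so that transfer applies. *)
Lemma expectation_density (phi : 'rV[R]_d -> R) : bounded_measurable D phi ->
  \int[P]_w (phi \_ D) (X w) = \int[lam]_(x in D) (phi x * f x).
Proof.
move=> bphi; have [mphi [C hC]] := bphi.
have bC : bounded_measurable D (cst `|C| : 'rV[R]_d -> R) by exact: bm_cst.
have bphiC : bounded_measurable D (fun x => phi x + `|C|) by exact: bmD.
have hphiC x : D x -> 0 <= phi x + `|C|.
  move=> /hC hx; rewrite -(opprK (phi x)) addrC subr_ge0.
  by rewrite (le_trans (ler_norm (- phi x)))// normrN (le_trans hx)// ler_norm.
have H1 := nonneg_expectation bphiC hphiC.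
have H2 := nonneg_expectation bC (fun x _ => normr_ge0 C).
have PT := probability_finite P.
have I g : bounded_measurable D g -> P.-integrable setT (EFin \o (fun w => (g \_ D) (X w))).
  move=> /(bm_restrict mD)[mg [b hb]]; apply: bm_integrable => //; split.
    exact: (measurableT_comp mg mX).
  by exists b => w _; exact: hb.
have IL g : bounded_measurable D g -> lam.-integrable D (EFin \o g) by exact: bm_integrable.
have -> : \int[P]_w (phi \_ D) (X w) =
    \int[P]_w ((fun x => phi x + `|C|) \_ D) (X w) - \int[P]_w (cst `|C| \_ D) (X w).
  rewrite -RintegralB//; [|exact: I|exact: I].
  by apply: eq_Rintegral => w _; rewrite !patchE; case: ifP => _; rewrite ?subr0// addrK.
rewrite H1 H2 -RintegralB//; last 2 first.
- by apply: IL; exact: bmM.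
- by apply: IL; exact: bmM.
by apply: eq_Rintegral => x _; rewrite /=; ring.
Qed.

(** The law lives on D, and nothing is known about phi elsewhere, not even
    measurability. *)
Lemma expectation_on (phi : 'rV[R]_d -> R) :
  \int[P]_w phi (X w) = \int[P]_w (phi \_ D) (X w).
Proof.
apply: (@Rintegral_off_null _ _ _ P (X @^-1` ~` D)) => //.
  by rewrite -[X in measurable X]setTI; apply: mX => //; exact: measurableC.
move=> w /= nw; rewrite !patchE [_ \in setT]in_setT.
by rewrite ifT// inE; apply: contrapT.
Qed.

End law.

(** * Concentration of local averages *)

Lemma iid_comp {R : realType} {disp dT dS : measure_display}
    {Omega : measurableType disp} {T : measurableType dT} {S : measurableType dS}
    (P : probability Omega R) (Z : nat -> Omega -> T) (pr : T -> S) :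
  measurable_fun setT pr -> iid P Z -> iid P (fun i w => pr (Z i w)).
Proof.
move=> mpr [indep ident].
have mp A : measurable A -> measurable (pr @^-1` A).
  by move=> mA; rewrite -[X in measurable X]setTI; exact: mpr.
split; last by move=> i A mA; exact: (ident i (pr @^-1` A) (mp _ mA)).
by move=> J A mA; exact: (indep J (fun i => pr @^-1` A i) (fun i => mp _ (mA i))).
Qed.

Lemma union_bound {R : realType} {disp : measure_display}
    {Omega : measurableType disp} (P : {measure set Omega -> \bar R})
    (I : Type) (r : seq I) (A : I -> set Omega) (e : R) :
  (forall i, measurable (A i)) -> (forall i, (P (A i) <= e%:E)%E) ->
  measurable (\big[setU/set0]_(i <- r) A i) /\
  (P (\big[setU/set0]_(i <- r) A i) <= ((size r)%:R * e)%:E)%E.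
Proof.
move=> mA Ae; elim: r => [|i r [mr ih]].
  by rewrite big_nil measure0 mul0r.
rewrite big_cons; split; first exact: measurableU.
apply: (le_trans (measureU2 _ _ _)) => //=.
by rewrite -natr1 mulrDl mul1r addrC EFinD leeD.
Qed.

Lemma mem_bigsetU {T : Type} (I : finType) (A : I -> set T) x :
  ~ (\big[setU/set0]_(i <- index_enum I) A i) x -> forall i, ~ A i x.
Proof.
move=> nA i Ai; apply: nA; rewrite -bigcup_seq; exists i => //=.
by rewrite mem_index_enum.
Qed.

Section local_averages.
Context {R : realType} {d : nat} {disp : measure_display}
  {Omega : measurableType disp}.
Variables (P : probability Omega R) (X : nat -> Omega -> 'rV[R]_d)
  (f : 'rV[R]_d -> R).
Hypotheses (mX : forall i, measurable_fun setT (X i)) (iidX : iid P X)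
  (mf : measurable_fun setT f) (f0 : forall x, 0 <= f x)
  (density : forall A, measurable A ->
    P (X 0%N @^-1` A) = (\int[lebesgue_rV R d]_(x in A) (f x)%:E)%E).
Context {K k : nat}.
Variables (cells : 'I_k -> set 'rV[R]_d) (supp : set 'rV[R]_d).
Hypothesis hpart : is_partition cells supp.
Variables (p : 'rV[R]_d -> 'cV[R]_K) (C : nat) (h : R).

Local Notation D := (cell_union cells).
Local Notation lam := (lebesgue_rV R d).
Local Notation pk i := (fun x : 'rV[R]_d => p x i ord0).
Local Notation act i := (active_cells cells (pk i)).

Hypothesis h0 : 0 < h.
Hypothesis cells_diam : forall l x y, cells l x -> cells l y -> enorm (x - y) <= h.
Hypothesis act_le : forall i, (#|act i| <= C)%N.
Hypothesis finD : (lam D < +oo)%E.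
Hypothesis PD : P (X 0%N @^-1` ~` D) = 0%E.
Variable Nf : R.
Hypothesis fN : forall x, D x -> f x <= Nf.
Hypothesis Nf0 : 0 <= Nf.

Let mD : measurable D := measurable_cell_union hpart.

Lemma bm_density : bounded_measurable D f.
Proof.
split; first exact: measurable_funTS.
by exists Nf => x Dx; rewrite ger0_norm ?f0 ?fN.
Qed.

(** The average of a function that lives on few small cells has a variance of the
    order of their volume, which is what makes its deviations exponentially small
    in the expected number of observations in a cell. *)
Lemma local_deviation (n : nat) i (phi : 'rV[R]_d -> R) (b tau delta : R) :
  (0 < n)%N -> 0 <= b -> bounded_measurable D phi ->
  (forall x, D x -> `|phi x| <= b) ->
  (forall l x, cells l x -> l \notin act i -> phi x = 0) ->
  0 < tau -> tau * b <= 1 / 2 ->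
  4 * tau * (b ^+ 2 * Nf * (C%:R * 2 ^+ d)) <= delta ->
  (P [set w | (delta * h ^+ d < `|n%:R^-1 * \sum_(j < n) (phi \_ D) (X j w) -
      \int[lam]_(x in D) (phi x * f x)|)%R] <=
   (2 * expR (- (n%:R * h ^+ d * (tau * delta / 2))))%:E)%E.
Proof.
move=> n0 b0 bphi phib philoc tau0 taub taud.
have bf := bm_density.
set v := b ^+ 2 * Nf * (C%:R * 2 ^+ d) in taud.
have mphi := bm_restrict mD bphi.
have hd0 : 0 < h ^+ d by rewrite exprn_gt0.
have var : \int[P]_w ((phi \_ D) (X 0%N w)) ^+ 2 <= v * h ^+ d.
  have -> : \int[P]_w ((phi \_ D) (X 0%N w)) ^+ 2 =
      \int[P]_w ((fun x => phi x ^+ 2) \_ D) (X 0%N w).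
    by apply: eq_Rintegral => w _; rewrite !patchE; case: ifP => // _; rewrite expr0n.
  rewrite (expectation_density (mX 0%N) f0 density mD finD PD bf); last exact: bmX.
  have -> : v * h ^+ d = b ^+ 2 * Nf * (C%:R * (2 * h) ^+ d).
    by rewrite exprMn /v; ring.
  apply: (le_trans (ler_norm _)); apply: (@local_integral_le _ _ _ _ _ _ hpart p C h h0 cells_diam act_le finD i) => //.
  - by rewrite mulr_ge0 ?sqr_ge0.
  - by apply: bmM => //; exact: bmX.
  - move=> x Dx; rewrite normrM (ger0_norm (f0 x)) normrX.
    by rewrite ler_pM ?exprn_ge0 ?fN// ler_pXn2r ?nnegrE ?phib.
  - by move=> l x lx /(philoc _ _ lx) ->; rewrite expr0n mul0r.
have phib' x : `|(phi \_ D) x| <= b.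
  by rewrite patchE; case: ifPn => [|_]; rewrite ?normr0// inE => /phib.
have := bernstein_deviation (delta * h ^+ d) mX iidX mphi.1 phib' var tau0 taub n0.
rewrite (expectation_density (mX 0%N) f0 density mD finD PD bf)// => H.
apply: (le_trans H); rewrite lee_fin ler_pM2l// ler_expR lerN2 -[n%:R * _ * _]mulrA ler_pM2l ?ltr0n//.
have tv : 2 * tau ^+ 2 * (v * h ^+ d) <= tau * (delta / 2) * h ^+ d.
  have -> : 2 * tau ^+ 2 * (v * h ^+ d) = tau * (4 * tau * v / 2) * h ^+ d by field.
  by rewrite ler_pM2r// ler_pM2l// ler_pM2r.
lra.
Qed.

End local_averages.

(** * Good designs *)

Lemma coercive_perturbation {R : realType} {K : nat} (k t : R) (G Gh : 'M[R]_K) :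
  coercive k G -> (forall a : 'cV[R]_K, enorm ((Gh - G) *m a) <= t * enorm a) ->
  coercive (k - t) Gh.
Proof.
move=> kG tG a; have := kG a.
have -> : dotc a (Gh *m a) = dotc a (G *m a) + dotc a ((Gh - G) *m a).
  by rewrite -dotcDr -mulmxDl addrC subrK.
have : `|dotc a ((Gh - G) *m a)| <= t * enorm a ^+ 2.
  rewrite (le_trans (cauchy_schwarz _ _))// expr2 mulrCA.
  by rewrite ler_wpM2l ?enorm_ge0.
by rewrite ler_norml => /andP[]; lra.
Qed.

Lemma coercive_le {R : realType} {K : nat} (k k' : R) (G : 'M[R]_K) : k' <= k ->
  coercive k G -> coercive k' G.
Proof. by move=> kk' kG a; rewrite (le_trans _ (kG a))// ler_wpM2r ?sqr_ge0. Qed.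

Section empirical.
Context {R : realType} {d K n : nat}.
Variable p : 'rV[R]_d -> 'cV[R]_K.
Implicit Types (nu : 'rV[R]_d -> R) (x : 'I_n -> 'rV[R]_d).

Definition egram nu x : 'M[R]_K :=
  \matrix_(i, j) (n%:R^-1 * \sum_l (p (x l) i ord0 * p (x l) j ord0 * nu (x l))).

Definition evec nu x : 'cV[R]_K :=
  \col_i (n%:R^-1 * \sum_l (p (x l) i ord0 * nu (x l))).

Lemma evecE nu x : evec nu x = n%:R^-1 *: \sum_l nu (x l) *: p (x l).
Proof.
apply/colP => i; rewrite !mxE summxE; congr (_ * _).
by apply: eq_bigr => l _; rewrite mxE mulrC.
Qed.

Lemma dotc_egram nu x (a : 'cV[R]_K) : dotc a (egram nu x *m a) =
  n%:R^-1 * \sum_l nu (x l) * dotc a (p (x l)) ^+ 2.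
Proof.
rewrite dotc_mulmx.
transitivity (\sum_i \sum_j \sum_l n%:R^-1 *
    (nu (x l) * (a i ord0 * p (x l) i ord0 * (a j ord0 * p (x l) j ord0)))).
  apply: eq_bigr => i _; apply: eq_bigr => j _; rewrite mxE mulr_sumr.
  by rewrite mulr_sumr mulr_suml; apply: eq_bigr => l _; ring.
under eq_bigr => i _ do rewrite exchange_big/=.
rewrite exchange_big/= mulr_sumr; apply: eq_bigr => l _.
rewrite expr2 /dotc big_distrlr/= !mulr_sumr; apply: eq_bigr => i _.
by rewrite !mulr_sumr; apply: eq_bigr => j _.
Qed.

Lemma egram_sym nu x : (egram nu x)^T = egram nu x.
Proof.
apply/matrixP => i j; rewrite !mxE; congr (_ * _); apply: eq_bigr => l _.
by rewrite (mulrC (p _ j ord0)).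
Qed.

End empirical.

Section good_design.
Context {R : realType} {d K k : nat}.
Variables (cells : 'I_k -> set 'rV[R]_d) (supp : set 'rV[R]_d).
Hypothesis hpart : is_partition cells supp.
Variables (p psi : 'rV[R]_d -> 'cV[R]_K) (C : nat) (h c M L : R).

Local Notation D := (cell_union cells).
Local Notation lam := (lebesgue_rV R d).
Local Notation pk i := (fun x : 'rV[R]_d => p x i ord0).
Local Notation act i := (active_cells cells (pk i)).
Local Notation H := (h ^+ d).

Hypothesis h0 : 0 < h.
Hypothesis cells_diam : forall l x y, cells l x -> cells l y -> enorm (x - y) <= h.
Hypothesis act_le : forall i, (#|act i| <= C)%N.
Hypothesis nbr_le : forall i, (#|[pred j : 'I_K |
  `[< active_on (pk j) (active_region cells (pk i)) >]]| <= C)%N.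
Hypotheses (finD : (lam D < +oo)%E) (DL : fine (lam D) = L).
Hypotheses (c0 : 0 < c) (M0 : 0 <= M).
Hypothesis hp : local_functions cells p (fun i x => p x i ord0) M.
Hypothesis basis_gram : forall (i : 'I_K) (a : 'cV[R]_K),
  c * (a i ord0 ^+ 2 * H) <=
  (a^T *m (\matrix_(j, j') \int[lam]_(x in active_region cells (pk i))
     (p x j ord0 * p x j' ord0)) *m a) ord0 ord0.
Variables (hq hm : R).
Hypotheses (hq0 : 0 <= hq) (hm0 : 0 <= hm).
Hypothesis hpsi : local_functions cells p (fun i x => psi x i ord0) (M * hq).
Hypothesis psi_low : forall x, D x -> c * hq <= enorm (psi x).
Variables f s w : 'rV[R]_d -> R.
Hypotheses (bf : bounded_measurable D f) (bs : bounded_measurable D s)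
  (bw : bounded_measurable D w).
Hypotheses (cf : forall x, D x -> c <= f x <= M)
  (cs : forall x, D x -> c <= s x <= M) (cw : forall x, D x -> c <= w x <= M).

Let mD : measurable D := measurable_cell_union hpart.
Let H0 : 0 < H. Proof. exact: exprn_gt0. Qed.
Let L0 : 0 <= L. Proof. by rewrite -DL fine_ge0. Qed.
Let w0 x : D x -> 0 <= w x.
Proof. by move=> /cw /andP[cwx _]; rewrite (le_trans _ cwx)// ltW. Qed.

(** The floors and ceilings below bound matrices, dimensions and integrals after
    the powers of h, hq and hm have been factored out. They depend only on the
    dimension d, on the volume L and on the uniform bounds c, M and C, hence not on
    the partition. Here hq is the size of the derivative psi of the basis relative
    to the basis itself, and hm the size of the approximation error. *)
Definition gram_floor : R := c * c / C.+1%:R / 2.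
Definition gram_ceil : R := C%:R * (M ^+ 2 * M * (C%:R * 2 ^+ d)).
Definition sigma_ceil : R := C%:R * (M ^+ 2 * (M * M) * (C%:R * 2 ^+ d)).

Local Notation G := (wgram cells (fun i x => p x i ord0) f).
Local Notation S := (wgram cells (fun i x => p x i ord0) (fun x => s x * f x)).

Let colE (u : 'rV[R]_d -> 'cV[R]_K) x : \col_i u x i ord0 = u x.
Proof. by apply/colP => i; rewrite mxE. Qed.

Lemma gram_floor_gt0 : 0 < gram_floor. Proof. by rewrite !divr_gt0 ?mulr_gt0. Qed.
Lemma gram_ceil_ge0 : 0 <= gram_ceil. Proof. by rewrite !mulr_ge0 ?exprn_ge0. Qed.
Lemma sigma_ceil_ge0 : 0 <= sigma_ceil. Proof. by rewrite !mulr_ge0 ?exprn_ge0. Qed.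

Let fM x : D x -> `|f x| <= M.
Proof.
move=> /cf /andP[cfx fx]; rewrite ger0_norm//.
by rewrite (le_trans _ cfx)// ltW.
Qed.
Let sM x : D x -> `|s x| <= M.
Proof.
move=> /cs /andP[csx sx]; rewrite ger0_norm//.
by rewrite (le_trans _ csx)// ltW.
Qed.
Let wM x : D x -> `|w x| <= M.
Proof. by move=> Dx; rewrite ger0_norm ?w0//; have /andP[] := cw Dx. Qed.
Let sfM x : D x -> `|s x * f x| <= M * M.
Proof. by move=> Dx; rewrite normrM ler_pM ?sM ?fM. Qed.
Let bsf : bounded_measurable D (fun x => s x * f x). Proof. exact: bmM. Qed.

Lemma gram_coercive : coercive (2 * gram_floor * H) G.
Proof.
have -> : 2 * gram_floor * H = c * c / C.+1%:R * H.
  by rewrite /gram_floor; congr (_ * _); field.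
apply: (wgram_coercive hpart nbr_le finD hp basis_gram c0 bf).
by move=> x /cf /andP[].
Qed.

Let gram_coercive' : coercive (gram_floor * H) G.
Proof.
apply: coercive_le gram_coercive; rewrite ler_pM2r//.
by have := gram_floor_gt0; lra.
Qed.

Lemma gram_bound (a : 'cV[R]_K) : enorm (G *m a) <= gram_ceil * H * enorm a.
Proof.
apply: (le_trans (wgram_bound hpart h0 cells_diam act_le nbr_le finD hp M0 bf fM M0 a)).
by rewrite le_eqVlt; apply/orP; left; apply/eqP; rewrite exprMn /gram_ceil; ring.
Qed.

Lemma Sigma_bound (a : 'cV[R]_K) : enorm (S *m a) <= sigma_ceil * H * enorm a.
Proof.
have MM0 : 0 <= M * M by rewrite mulr_ge0.
apply: (le_trans (wgram_bound hpart h0 cells_diam act_le nbr_le finD hp M0 bsf sfM MM0 a)).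
by rewrite le_eqVlt; apply/orP; left; apply/eqP; rewrite exprMn /sigma_ceil; ring.
Qed.

Lemma psi_form (v : 'cV[R]_K) :
  \int[lam]_(x in D) (dotc (psi x) v ^+ 2 * w x) <= gram_ceil * H * hq ^+ 2 * enorm v ^+ 2.
Proof.
have Mq0 : 0 <= M * hq by rewrite mulr_ge0.
have := dotc_wgram hpart finD hpsi bw v v.
under [X in _ = X -> _]eq_Rintegral do rewrite colE -expr2 dotcC.
move=> <-.
apply: (le_trans (ler_norm _)); apply: (le_trans (cauchy_schwarz _ _)).
have -> : gram_ceil * H * hq ^+ 2 * enorm v ^+ 2 = gram_ceil * H * hq ^+ 2 * enorm v * enorm v by ring.
rewrite mulrC ler_wpM2r ?enorm_ge0//.
apply: (le_trans (wgram_bound hpart h0 cells_diam act_le nbr_le finD hpsi Mq0 bw wM M0 v)).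
by rewrite le_eqVlt; apply/orP; left; apply/eqP; rewrite !exprMn /gram_ceil; ring.
Qed.

Let bpsi i : bounded_measurable D (fun x => psi x i ord0) := bm_local hpsi i.
Let psiM x : D x -> enorm (psi x) <= M * hq.
Proof. by move=> Dx; have [_ Hx _] := hpsi; have := Hx x Dx; rewrite colE. Qed.

Local Notation V := (\int[lam]_(x in D) (sandwich psi G S x * w x)).

Definition variance_ceil : R := sigma_ceil / gram_floor ^+ 2 * M ^+ 2 * M * L.
Definition variance_floor : R := c * (2 * gram_floor) / (gram_ceil + 1) ^+ 2 * c ^+ 2 * c * L.

Lemma leading_variance_upper : V <= variance_ceil * (H^-1 * hq ^+ 2).
Proof.
have kH : 0 < gram_floor * H by rewrite mulr_gt0 ?gram_floor_gt0.
have bH : 0 <= sigma_ceil * H by rewrite mulr_ge0 ?sigma_ceil_ge0 ?(ltW H0).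
have Mq0 : 0 <= M * hq by rewrite mulr_ge0.
have wu x : D x -> w x <= M by move=> /cw /andP[].
apply: (le_trans (variance_upper mD finD bpsi psiM bw w0 wu Mq0 kH bH gram_coercive' Sigma_bound)).
rewrite DL le_eqVlt; apply/orP; left; apply/eqP; rewrite /variance_ceil exprMn; have := gram_floor_gt0 => k0; field.
by rewrite !gt_eqF.
Qed.

(** The variance is bounded below by c, so the weighted Gram matrix dominates c
    times the Gram matrix and the sandwich form is coercive. *)
Lemma leading_variance_lower : variance_floor * (H^-1 * hq ^+ 2) <= V.
Proof.
have kH : 0 < 2 * gram_floor * H by rewrite !mulr_gt0 ?gram_floor_gt0.
have b1 : 0 < gram_ceil + 1 by rewrite ltr_wpDl ?gram_ceil_ge0.
have BH : 0 < (gram_ceil + 1) * H by rewrite mulr_gt0.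
have cq0 : 0 <= c * hq by rewrite mulr_ge0// ltW.
have wl x : D x -> c <= w x by move=> /cw /andP[].
have SG (a : 'cV[R]_K) : c * dotc a (G *m a) <= dotc a (S *m a).
  rewrite (dotc_wgram hpart finD hp bf) (dotc_wgram hpart finD hp bsf).
  have ba := bm_dotc hp a.
  rewrite -RintegralZl//; last first.
    apply: bm_integrable => //; apply: bmM => //.
    by apply: bmM; under [X in bounded_measurable _ X]eq_fun do rewrite colE.
  apply: le_Rintegral_bm => //.
  - apply: bmM; first exact: bm_cst.
    apply: bmM => //.
    by apply: bmM; under [X in bounded_measurable _ X]eq_fun do rewrite colE.
  - apply: bmM => //.
    by apply: bmM; under [X in bounded_measurable _ X]eq_fun do rewrite colE.
  move=> x Dx; rewrite -expr2 mulrCA ler_wpM2l ?sqr_ge0// ler_wpM2r//.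
    by have /andP[cfx _] := cf Dx; rewrite (le_trans _ cfx)// ltW.
  by have /andP[] := cs Dx.
have GB (a : 'cV[R]_K) : enorm (G *m a) <= (gram_ceil + 1) * H * enorm a.
  by rewrite (le_trans (gram_bound a))// ler_wpM2r ?enorm_ge0// ler_pM2r// lerDl.
apply: le_trans (variance_lower mD finD bpsi bw kH gram_coercive c0 BH cq0 (ltW c0) SG GB psi_low wl).
rewrite DL le_eqVlt; apply/orP; left; apply/eqP; rewrite /variance_floor exprMn; field.
by rewrite !gt_eqF.
Qed.

Section bias_target.
Variables B0 Bq : 'rV[R]_d -> R.
Hypotheses (bB0 : bounded_measurable D B0) (bBq : bounded_measurable D Bq).
Hypotheses (B0M : forall x, D x -> `|B0 x| <= M * hm)
  (BqM : forall x, D x -> `|Bq x| <= M * (hm * hq)).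

Definition bias_moment : 'cV[R]_K := \col_i \int[lam]_(x in D) (p x i ord0 * B0 x * f x).

Definition dimension_ceil : R := M ^+ 2 * L / c.

Lemma card_bound : K%:R * H <= dimension_ceil.
Proof.
rewrite /dimension_ceil ler_pdivlMr// -DL.
have -> : K%:R * H * c = c * H * K%:R by ring.
exact: (basis_card_bound hpart finD hp M0 basis_gram).
Qed.

Let enorm_card (u : 'cV[R]_K) (e : R) : (forall i, `|u i ord0| <= e * H) ->
  enorm u ^+ 2 <= dimension_ceil * H * e ^+ 2.
Proof.
move=> ue; apply: (le_trans (enorm_sqr_le ue)).
have -> : K%:R * (e * H) ^+ 2 = K%:R * H * (H * e ^+ 2) by rewrite exprMn; ring.
rewrite -[leRHS]mulrA; apply: ler_wpM2r card_bound.
by rewrite mulr_ge0 ?sqr_ge0// ltW.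
Qed.

Definition moment_ceil : R := dimension_ceil * (M * M * M * (C%:R * 2 ^+ d)) ^+ 2.

Lemma bias_moment_le : enorm bias_moment ^+ 2 <= moment_ceil * H * hm ^+ 2.
Proof.
have Mh0 : 0 <= M * hm by rewrite mulr_ge0.
have -> : moment_ceil * H * hm ^+ 2 = dimension_ceil * H * (M * M * M * (C%:R * 2 ^+ d) * hm) ^+ 2.
  by rewrite /moment_ceil !exprMn; ring.
apply: enorm_card => i; rewrite mxE.
have -> : M * M * M * (C%:R * 2 ^+ d) * hm * H =
    M * (M * hm) * M * (C%:R * (2 * h) ^+ d) by rewrite exprMn; ring.
apply: (@local_integral_le _ _ _ _ _ _ hpart p C h h0 cells_diam act_le finD i).
- by rewrite !mulr_ge0.
- by apply: bmM => //; apply: bmM => //; exact: bm_local hp i.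
- move=> x Dx; rewrite !normrM ler_pM ?mulr_ge0 ?fM//.
  by rewrite ler_pM ?B0M// (local_bound hp).
- by move=> l x lx li; have [_ _ /(_ i l x lx li) ->] := hp; rewrite !mul0r.
Qed.

(** The error of projecting the leading bias of the function, as it appears in the
    bias of the derivative. *)
Definition bias_target x : R := Bq x - dotc (psi x) (invmx G *m bias_moment).

Let bm_target : bounded_measurable D bias_target.
Proof. by apply: bmB => //; exact: bm_dotc_psi. Qed.

Definition bias_ceil : R := 2 * M ^+ 2 * M * L + 2 * (gram_ceil * moment_ceil / gram_floor ^+ 2).

Lemma bias_upper :
  \int[lam]_(x in D) (bias_target x ^+ 2 * w x) <= bias_ceil * (hm * hq) ^+ 2.
Proof.
set v := invmx G *m bias_moment.
have bBq2 : bounded_measurable D (fun x => Bq x ^+ 2 * w x).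
  by apply: bmM => //; exact: bmX.
have bv2 : bounded_measurable D (fun x => dotc (psi x) v ^+ 2 * w x).
  by apply: bmM => //; apply: bmX; exact: bm_dotc_psi.
have kH : 0 < gram_floor * H by rewrite mulr_gt0 ?gram_floor_gt0.
have b1 : \int[lam]_(x in D) (Bq x ^+ 2 * w x) <= (M * (hm * hq)) ^+ 2 * M * L.
  rewrite -DL; apply: Rintegral_weight_le => //.
  - by move=> x /cw /andP[].
  - by rewrite sqr_ge0.
  - exact: bmX.
  move=> x Dx; rewrite -real_normK ?num_real//.
  by rewrite ler_pXn2r ?nnegrE ?mulr_ge0 ?BqM.
have b2 : \int[lam]_(x in D) (dotc (psi x) v ^+ 2 * w x) <=
    gram_ceil * H * hq ^+ 2 * (moment_ceil * H * hm ^+ 2 / (gram_floor * H) ^+ 2).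
  apply: (le_trans (psi_form v)); apply: ler_wpM2l.
    by rewrite mulr_ge0 ?sqr_ge0// mulr_ge0 ?gram_ceil_ge0 ?(ltW H0).
  apply: (@le_trans _ _ ((enorm bias_moment / (gram_floor * H)) ^+ 2)).
    rewrite ler_pXn2r ?nnegrE ?divr_ge0 ?enorm_ge0 ?(ltW kH)//.
    exact: coercive_invmx.
  by rewrite exprMn exprVn ler_wpM2r ?bias_moment_le// invr_ge0 exprn_ge0// ltW.
apply: (@le_trans _ _ (2 * \int[lam]_(x in D) (Bq x ^+ 2 * w x) +
    2 * \int[lam]_(x in D) (dotc (psi x) v ^+ 2 * w x))).
  rewrite -!RintegralZl//; [|exact: bm_integrable|exact: bm_integrable].
  rewrite -RintegralD//; last 2 first.
  - by apply: bm_integrable => //; apply: bmM => //; exact: bm_cst.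
  - by apply: bm_integrable => //; apply: bmM => //; exact: bm_cst.
  apply: le_Rintegral_bm => //.
  - by apply: bmM => //; exact: bmX.
  - by apply: bmD; (apply: bmM; first exact: bm_cst).
  move=> x Dx; rewrite !mulrA -mulrDl ler_wpM2r ?w0//.
  have := sqr_ge0 (Bq x + dotc (psi x) v); rewrite /bias_target -/v; nra.
apply: (@le_trans _ _ (2 * ((M * (hm * hq)) ^+ 2 * M * L) +
    2 * (gram_ceil * H * hq ^+ 2 * (moment_ceil * H * hm ^+ 2 / (gram_floor * H) ^+ 2)))).
  by rewrite lerD// ler_pM2l.
rewrite le_eqVlt; apply/orP; left; apply/eqP; rewrite /bias_ceil; have := gram_floor_gt0 => k0; field.
by rewrite !gt_eqF.
Qed.

Section at_design.
Variables (n : nat) (x : 'I_n -> 'rV[R]_d) (delta : R).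
Hypotheses (n0 : (0 < n)%N) (xD : forall l, D (x l)).
Hypotheses (delta0 : 0 < delta) (delta1 : delta <= 1) (deltaC : delta <= gram_floor).

Local Notation Gh := (egram p (cst 1) x).
Local Notation Sh := (egram p s x).

(** The difference of the two matrices vanishes at nonadjacent indices, so that
    closeness of the entries gives closeness as operators at the cost of a factor
    C; the denominator C.+1 pays for it. *)
Lemma egram_close (nu nu' : 'rV[R]_d -> R) :
  (forall i j, `|egram p nu x i j - wgram cells (fun i y => p y i ord0) nu' i j| <=
    delta / C.+1%:R * H) ->
  forall a : 'cV[R]_K, enorm ((egram p nu x - wgram cells (fun i y => p y i ord0) nu') *m a) <=
    delta * H * enorm a.
Proof.
move=> dij a.
apply: (@le_trans _ _ (C%:R * (delta / C.+1%:R * H) * enorm a)).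
  apply: (sparse_bound (adj := adjacent cells p)).
  - by rewrite mulr_ge0 ?divr_ge0 ?(ltW H0) ?(ltW delta0).
  - exact: adjacent_sym.
  - exact: card_adjacent nbr_le.
  - by move=> i j _; rewrite !mxE; have := dij i j; rewrite !mxE.
  move=> i j nij; have w00 := wgram_nonadjacent hpart hp nu' nij.
  rewrite [LHS]mxE [X in _ + X]mxE w00 oppr0 addr0 mxE big1 ?mulr0// => l _.
  have [_ _ loc] := hp; have [r _ rx] := xD l.
  have [ri|ri] := boolP (r \in act i); last by rewrite (loc i r)// !mul0r.
  have [rj|rj] := boolP (r \in act j); last by rewrite (loc j r)// mulr0 mul0r.
  by case/negP: nij; apply/existsP; exists r; rewrite ri rj.
rewrite ler_wpM2r ?enorm_ge0// mulrA ler_wpM2r ?(ltW H0)//.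
rewrite mulrCA ler_piMr ?(ltW delta0)// ler_pdivrMr ?ltr0Sn// mul1r ler_nat.
exact: leqnSn.
Qed.

Hypothesis dG : forall i j, `|Gh i j - G i j| <= delta / C.+1%:R * H.

Lemma egram_coercive : coercive (gram_floor * H) Gh.
Proof.
apply: coercive_le (coercive_perturbation gram_coercive (egram_close dG)).
rewrite -mulrBl ler_pM2r//; move: deltaC; lra.
Qed.

Definition variance_slope : R := (1 / gram_floor ^+ 2 + 2 * sigma_ceil / gram_floor ^+ 3) * M ^+ 2 * M * L.

Lemma design_variance : (forall i j, `|Sh i j - S i j| <= delta / C.+1%:R * H) ->
  `|\int[lam]_(y in D) (sandwich psi Gh Sh y * w y) - V| <=
  variance_slope * delta * (H^-1 * hq ^+ 2).
Proof.
move=> dS.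
have kH : 0 < gram_floor * H by rewrite mulr_gt0 ?gram_floor_gt0.
have bH : 0 <= sigma_ceil * H by rewrite mulr_ge0 ?sigma_ceil_ge0 ?(ltW H0).
have t0 : 0 <= delta * H by rewrite mulr_ge0 ?(ltW H0) ?(ltW delta0).
have Mq0 : 0 <= M * hq by rewrite mulr_ge0.
have wu y : D y -> w y <= M by move=> /cw /andP[].
apply: (le_trans (variance_perturbation mD finD bpsi psiM bw w0 wu Mq0 kH t0 bH
  gram_coercive' Sigma_bound egram_coercive (egram_close dG) (egram_close dS))).
rewrite DL le_eqVlt; apply/orP; left; apply/eqP; rewrite /variance_slope exprMn; have := gram_floor_gt0 => k0; field.
by rewrite !gt_eqF.
Qed.

Variables (mu muq r0 rq : 'rV[R]_d -> R) (a : 'cV[R]_K).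
Hypothesis bmuq : bounded_measurable D muq.
Hypotheses (muE : forall y, D y -> mu y = dotc a (p y) - B0 y + r0 y)
  (muqE : forall y, D y -> muq y = dotc a (psi y) - Bq y + rq y).
Hypotheses (r0_le : forall y, D y -> `|r0 y| <= delta * hm)
  (rq_le : forall y, D y -> `|rq y| <= delta * (hm * hq)).
Hypothesis dB : forall i, `|evec p B0 x i ord0 - bias_moment i ord0| <= delta * H * hm.

Definition design_bias y : R := dotc (psi y) (invmx Gh *m evec p mu x) - muq y.

(** Least squares reproduces the spline with coefficients a exactly, so only its
    errors have to be projected. *)
Let evec_mu : evec p mu x = Gh *m a - evec p B0 x + evec p r0 x.
Proof.
apply/colP => i; rewrite !mxE.
under eq_bigr => l _ do rewrite (muE (xD l)) mulrDr mulrBr.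
rewrite big_split/= sumrB mulrDr mulrBr; congr (_ - _ + _).
transitivity (\sum_l \sum_j n%:R^-1 *
    (p (x l) i ord0 * (a j ord0 * p (x l) j ord0))).
  rewrite mulr_sumr; apply: eq_bigr => l _.
  by rewrite /dotc mulr_sumr mulr_sumr.
rewrite exchange_big/=; apply: eq_bigr => j _.
rewrite mxE -mulrA mulr_suml mulr_sumr; apply: eq_bigr => l _.
by rewrite /= mulr1; ring.
Qed.

Definition bias_slope : R :=
  4 * M * L + 12 * gram_ceil * (gram_ceil + 1 + dimension_ceil + moment_ceil / gram_floor ^+ 2) / gram_floor ^+ 2 + bias_ceil.

(** At the design, the bias is the leading bias of the derivative minus the
    empirical projection of the leading bias of the function, up to remainders of
    relative size delta. *)
Lemma design_bias_le : `|\int[lam]_(y in D) (design_bias y ^+ 2 * w y) -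
    \int[lam]_(y in D) (bias_target y ^+ 2 * w y)| <= bias_slope * delta * (hm * hq) ^+ 2.
Proof.
have kH : 0 < gram_floor * H by rewrite mulr_gt0 ?gram_floor_gt0.
have uG := coercive_unitmx kH egram_coercive.
have rho_le : enorm (evec p r0 x) ^+ 2 <= (gram_ceil + 1) * H * (delta * hm) ^+ 2.
  rewrite evecE; apply: empirical_projection_bound => //.
  - by rewrite mulr_ge0 ?addr_ge0 ?gram_ceil_ge0 ?(ltW H0).
  - by move=> l; exact: r0_le.
  move=> b.
  have -> : n%:R^-1 * \sum_i dotc b (p (x i)) ^+ 2 = dotc b (Gh *m b).
    by rewrite dotc_egram; congr (_ * _); apply: eq_bigr => l _; rewrite mul1r.
  have GhE : Gh *m b = G *m b + (Gh - G) *m b by rewrite -mulmxDl addrC subrK.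
  apply: (le_trans (ler_norm _)); apply: (le_trans (cauchy_schwarz _ _)).
  have -> : (gram_ceil + 1) * H * enorm b ^+ 2 = enorm b * (gram_ceil * H * enorm b + 1 * H * enorm b) by ring.
  rewrite ler_wpM2l ?enorm_ge0// GhE (le_trans (ler_enormD _ _))// lerD ?gram_bound//.
  apply: (le_trans (egram_close dG b)).
  by rewrite ler_wpM2r ?enorm_ge0// ler_pM2r.
have db0 : enorm (evec p B0 x - bias_moment) ^+ 2 <= dimension_ceil * H * (delta * hm) ^+ 2.
  apply: enorm_card => i; rewrite mxE [X in _ + X]mxE.
  by rewrite (le_trans (dB i))// mulrAC.
have bdb : bounded_measurable D design_bias by apply: bmB => //; exact: bm_dotc_psi.
have wu y : D y -> w y <= M by move=> /cw /andP[].
have fg y : D y -> design_bias y - bias_target y =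
    - rq y + dotc (psi y) (invmx Gh *m (evec p r0 x - evec p B0 x) + invmx G *m bias_moment).
  move=> Dy; rewrite /design_bias /bias_target evec_mu muqE//.
  have -> : Gh *m a - evec p B0 x + evec p r0 x = Gh *m a + (evec p r0 x - evec p B0 x).
    by rewrite -addrA (addrC (- _)).
  rewrite mulmxDr mulmxA mulVmx// mul1mx !dotcDr (dotcC a); ring.
have := bias_perturbation mD finD bpsi bw w0 wu H0 hm0 hq0 delta0 delta1 gram_floor_gt0 gram_ceil_ge0
  gram_coercive' egram_coercive (egram_close dG) psi_form rho_le bias_moment_le db0 bdb bm_target
  rq_le fg bias_upper.
move=> le1; apply: (le_trans le1).
rewrite DL le_eqVlt; apply/orP; left; apply/eqP; rewrite /bias_slope; ring.
Qed.

End at_design.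
End bias_target.

End good_design.

Section good_event.
Context {R : realType} {d : nat} {disp : measure_display}
  {Omega : measurableType disp}.
Variables (P : probability Omega R) (X : nat -> Omega -> 'rV[R]_d)
  (f : 'rV[R]_d -> R).
Hypotheses (mX : forall i, measurable_fun setT (X i)) (iidX : iid P X)
  (mf : measurable_fun setT f) (f0 : forall x, 0 <= f x)
  (density : forall A, measurable A ->
    P (X 0%N @^-1` A) = (\int[lebesgue_rV R d]_(x in A) (f x)%:E)%E).
Context {K k : nat}.
Variables (cells : 'I_k -> set 'rV[R]_d) (supp : set 'rV[R]_d).
Hypothesis hpart : is_partition cells supp.
Variables (p : 'rV[R]_d -> 'cV[R]_K) (C : nat) (h : R).

Local Notation D := (cell_union cells).
Local Notation lam := (lebesgue_rV R d).
Local Notation pk i := (fun x : 'rV[R]_d => p x i ord0).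
Local Notation act i := (active_cells cells (pk i)).
Local Notation H := (h ^+ d).

Hypothesis h0 : 0 < h.
Hypothesis cells_diam : forall l x y, cells l x -> cells l y -> enorm (x - y) <= h.
Hypothesis act_le : forall i, (#|act i| <= C)%N.
Hypothesis finD : (lam D < +oo)%E.
Hypothesis PD : P (X 0%N @^-1` ~` D) = 0%E.
Variables (M hm : R).
Hypotheses (M0 : 0 <= M) (hm0 : 0 < hm).
Hypothesis fM : forall x, D x -> f x <= M.
Variables (n : nat) (n0 : (0 < n)%N) (tau eps : R).
Hypothesis tau0 : 0 < tau.

(** The exponent tau of the exponential bound has to be small in comparison with
    the range b of the functions and with their variance. *)
Definition rate_condition (b : R) : Prop :=
  tau * b <= 1 / 2 /\ 4 * tau * (b ^+ 2 * M * (C%:R * 2 ^+ d)) <= eps.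

Lemma family_deviation (I : finType) (idx : I -> 'I_K) (phi : I -> 'rV[R]_d -> R) (b : R) :
  0 <= b -> rate_condition b -> (forall i, bounded_measurable D (phi i)) ->
  (forall i x, D x -> `|phi i x| <= b) ->
  (forall i l x, cells l x -> l \notin act (idx i) -> phi i x = 0) ->
  exists E, [/\ measurable E,
    (P E <= (#|I|%:R * (2 * expR (- (n%:R * H * (tau * eps / 2)))))%:E)%E &
    forall w, ~ E w -> (forall l : 'I_n, D (X l w)) -> forall i,
      `|n%:R^-1 * \sum_(l < n) phi i (X l w) - \int[lam]_(x in D) (phi i x * f x)| <=
      eps * H].
Proof.
move=> b0 [taub taue] bphi phib loc.
have mD := measurable_cell_union hpart.
pose A i := [set w | eps * H < `|n%:R^-1 * \sum_(j < n) (phi i \_ D) (X j w) -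
  \int[lam]_(x in D) (phi i x * f x)|].
have mA i : measurable (A i).
  apply: measurable_lt_set; first exact: measurable_cst.
  apply: measurableT_comp => //; apply: measurable_funB; last exact: measurable_cst.
  apply: measurable_funM; first exact: measurable_cst.
  apply: measurable_sum => j; apply: (measurableT_comp _ (mX j)).
  by have [] := bm_restrict mD (bphi i).
have PA i : (P (A i) <= (2 * expR (- (n%:R * H * (tau * eps / 2))))%:E)%E.
  exact: (local_deviation mX iidX mf f0 density hpart h0 cells_diam act_le finD PD fM M0
    n0 b0 (bphi i) (phib i) (loc i) tau0 taub taue).
have [mE PE] := union_bound (index_enum I) mA PA.
exists (\big[setU/set0]_(i <- index_enum I) A i); split => //.
  apply: (le_trans PE); rewrite lee_fin.
  by rewrite (_ : size (index_enum I) = #|I|)// cardT enumT.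
move=> w nE XD i; have /negP := @mem_bigsetU _ _ A w nE i.
rewrite -leNgt; congr (`| _ * _ - _| <= _).
by apply: eq_bigr => l _; rewrite patchE ifT// inE.
Qed.

Variables s B0 : 'rV[R]_d -> R.
Hypothesis hp : local_functions cells p (fun i x => p x i ord0) M.
Hypotheses (bs : bounded_measurable D s) (sM : forall x, D x -> `|s x| <= M).
Hypotheses (bB0 : bounded_measurable D B0) (B0M : forall x, D x -> `|B0 x| <= M * hm).

Definition good_design (x : 'I_n -> 'rV[R]_d) : Prop :=
  [/\ forall i j, `|egram p (cst 1) x i j -
        wgram cells (fun i x => p x i ord0) f i j| <= eps * H,
      forall i j, `|egram p s x i j -
        wgram cells (fun i x => p x i ord0) (fun x => s x * f x) i j| <= eps * H &
      forall i, `|evec p B0 x i ord0 - bias_moment cells p f B0 i ord0| <= eps * H * hm].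

(** All entries are averages of functions that live on few cells; the bias has
    to be rescaled to the size of the others. *)
Lemma good_design_probability : rate_condition (M ^+ 2 + M ^+ 3) ->
  exists E, [/\ measurable E,
    (P E <= (6 * K%:R ^+ 2 * expR (- (n%:R * H * (tau * eps / 2))))%:E)%E &
    forall w, ~ E w -> (forall l : 'I_n, D (X l w)) ->
      good_design (fun l : 'I_n => X l w)].
Proof.
move=> rc.
pose phi (i : 'I_K * 'I_K * option bool) x : R := match i.2 with
  | None => p x i.1.1 ord0 * (B0 x / hm)
  | Some true => p x i.1.1 ord0 * p x i.1.2 ord0 * s x
  | Some false => p x i.1.1 ord0 * p x i.1.2 ord0
  end.
have pM i x : D x -> `|p x i ord0| <= M by move=> Dx; exact: (local_bound hp i Dx).
have bp i : bounded_measurable D (fun x => p x i ord0) := bm_local hp i.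
have [||||E [mE PE good]] := @family_deviation _ (fun i => i.1.1) phi (M ^+ 2 + M ^+ 3) _ rc.
- by rewrite addr_ge0 ?exprn_ge0.
- move=> [[i j] [[]|]]; rewrite /phi/=.
  + by apply: bmM => //; exact: bmM.
  + exact: bmM.
  + by apply: bmM => //; apply: bmM => //; exact: bm_cst.
- have M2 : 0 <= M ^+ 2 by rewrite exprn_ge0.
  have M3 : 0 <= M ^+ 3 by rewrite exprn_ge0.
  move=> [[i j] [[]|]] x Dx; rewrite /phi/= !normrM.
  + apply: (@le_trans _ _ (M ^+ 3)); last by rewrite lerDr.
    by rewrite !exprSr expr0 mul1r !ler_pM ?pM ?sM// mulr_ge0.
  + apply: (@le_trans _ _ (M ^+ 2)); last by rewrite lerDl.
    by rewrite expr2 ler_pM ?pM.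
  + apply: (@le_trans _ _ (M ^+ 2)); last by rewrite lerDl.
    rewrite expr2 ler_pM ?pM// normfV (gtr0_norm hm0) ler_pdivrMr//.
    exact: B0M.
- by move=> [[i j] [[]|]] l x lx li; rewrite /phi/=; have [_ _ /(_ i l x lx li) ->] := hp; rewrite !mul0r.
exists E; split => //.
  apply: (le_trans PE); rewrite lee_fin !card_prod card_option card_bool !card_ord.
  by rewrite !natrM le_eqVlt; apply/orP; left; apply/eqP; ring.
move=> w nE XD; have gd := good w nE XD; split.
- move=> i j; have := gd (i, j, Some false); rewrite /phi/= !mxE; congr (`| _ * _ - _| <= _).
  by apply: eq_bigr => l _; rewrite /= mulr1.
- move=> i j; have := gd (i, j, Some true); rewrite /phi/= !mxE; congr (`| _ - _| <= _).
  by apply: eq_Rintegral => x _; rewrite mulrA.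
- move=> i; have := gd (i, i, None); rewrite /phi/= !mxE.
  rewrite -(ler_pM2r hm0); congr (_ <= _).
  rewrite -[X in _ * X = _](gtr0_norm hm0) -normrM; congr (`|_|).
  rewrite mulrBl; congr (_ - _).
    rewrite -mulrA mulr_suml; congr (_ * _); apply: eq_bigr => l _.
    by field; rewrite gt_eqF.
  rewrite -RintegralZr; last 2 first.
  - exact: measurable_cell_union hpart.
  - apply: bm_integrable => //; first exact: measurable_cell_union hpart.
    apply: bmM; last by split; [exact: measurable_funTS|exists M => x Dx; rewrite ger0_norm ?f0 ?fM].
    by apply: bmM => //; apply: bmM => //; exact: bm_cst.
  by apply: eq_Rintegral => x _; field; rewrite gt_eqF.
Qed.

End good_event.

(** * The conditional mean squared error *)

Section measurable_algebra.
Context {R : realType} {dT : measure_display} {T : measurableType dT}.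

Lemma measurable_funV (g : T -> R) : measurable_fun setT g ->
  measurable_fun setT (fun t => (g t)^-1).
Proof.
move=> mg.
suff mV : measurable_fun setT (fun x : R => x^-1) by exact: (measurableT_comp mV mg).
have -> : (fun x : R => x^-1) = (fun x => if x == 0 then 0 else x^-1).
  by apply/funext => x; case: eqP => // ->; rewrite invr0.
apply: measurable_fun_if => //; first exact: measurable_fun_eqr.
have mN : measurable ([set: R] `&` (fun x : R => x == 0) @^-1` [set false]).
  rewrite setTI (_ : _ @^-1` _ = ~` [set 0]); first exact: measurableC.
  by apply/seteqP; split => x /=; case: eqP.
apply: subspace_continuous_measurable_fun => //.
apply: continuous_in_subspaceT => x; rewrite inE/= => -[_ x0].
by apply: inv_continuous; rewrite x0.
Qed.

Definition measurable_mx (m n : nat) (A : T -> 'M[R]_(m, n)) : Prop :=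
  forall i j, measurable_fun setT (fun t => A t i j).

Lemma measurable_mulmx m n r (A : T -> 'M[R]_(m, n)) (B : T -> 'M[R]_(n, r)) :
  measurable_mx A -> measurable_mx B -> measurable_mx (fun t => A t *m B t).
Proof.
move=> mA mB i j; under eq_fun do rewrite mxE.
by apply: measurable_sum => l; apply: measurable_funM.
Qed.

Lemma measurable_det n (A : T -> 'M[R]_n) : measurable_mx A ->
  measurable_fun setT (fun t => \det (A t)).
Proof.
move=> mA; apply: measurable_sum => s; apply: measurable_funM => //.
by apply: measurable_prod => i _; exact: mA.
Qed.

(** By Cramer's rule the entries of the inverse of a nonsingular matrix are rational
    functions of its entries. *)
Lemma measurable_invmx n (A : T -> 'M[R]_n) : measurable_mx A ->
  measurable_mx (fun t => invmx (A t)).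
Proof.
move=> mA i j; have mdet := measurable_det mA.
have -> : (fun t => invmx (A t) i j) = (fun t => if \det (A t) == 0 then A t i j
    else (\det (A t))^-1 * ((-1) ^+ (j + i) * \det (row' j (col' i (A t))))).
  apply/funext => t; rewrite /invmx unitmxE unitfE.
  by case: eqP => //= _; rewrite !mxE.
apply: measurable_fun_ifT => //; first exact: measurable_fun_eqr.
apply: measurable_funM; first exact: measurable_funV.
apply: measurable_funM => //; apply: measurable_det => i' j'.
by under eq_fun do rewrite !mxE; exact: mA.
Qed.

Lemma measurable_dotc n (u v : T -> 'cV[R]_n) : measurable_mx u -> measurable_mx v ->
  measurable_fun setT (fun t => dotc (u t) (v t)).
Proof.
by move=> mu mv; apply: measurable_sum => i; apply: measurable_funM; [exact: mu|exact: mv].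
Qed.

End measurable_algebra.

Section regression.
Context {R : realType} {d : nat} {disp : measure_display}
  {Omega : measurableType disp}.
Variables (P : probability Omega R) (X : nat -> Omega -> 'rV[R]_d)
  (Y eps : nat -> Omega -> R) (mu sigma2 : 'rV[R]_d -> R) (D : set 'rV[R]_d).
Hypotheses (mX : forall i, measurable_fun setT (X i))
  (mY : forall i, measurable_fun setT (Y i))
  (meps : forall i, measurable_fun setT (eps i)).
Hypothesis model : forall i w, Y i w = mu (X i w) + eps i w.
Hypothesis eps_int : forall i, P.-integrable setT (EFin \o eps i).
Hypothesis eps_mean : forall i, cond_expectation P (X i) (EFin \o eps i) (cst 0%E).
Hypothesis eps_var : forall i, cond_expectation P (X i)
  (fun w => (eps i w ^+ 2)%:E) (EFin \o sigma2).

Definition sample i w : 'rV[R]_d * R := (X i w, Y i w).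
Hypothesis iidZ : iid P sample.
Hypotheses (mD : measurable D) (PD : forall i, P (X i @^-1` ~` D) = 0%E).
Hypothesis mmu : measurable_fun D mu.
Hypothesis msigma2 : measurable_fun setT sigma2.
Variable N : R.
Hypothesis sN : forall x, D x -> 0 <= sigma2 x <= N.

(** The errors as a measurable function of the observations: the regression
    function is only known to be measurable on D. *)
Definition noise (z : 'rV[R]_d * R) : R := z.2 - (mu \_ D) z.1.

Let mXi i A : measurable A -> measurable (X i @^-1` A).
Proof. by move=> mA; rewrite -[X in measurable X]setTI; exact: mX. Qed.

Lemma measurable_sample i : measurable_fun setT (sample i).
Proof. by apply/(measurable_fun_pairP _).2; split; [exact: mX|exact: mY]. Qed.

Lemma measurable_noise : measurable_fun setT noise.
Proof.
apply: measurable_funB; first exact: measurable_snd.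
exact: (measurableT_comp ((measurable_restrictT _ mD).1 mmu) measurable_fst).
Qed.

Let mnoise i : measurable_fun setT (fun w => noise (sample i w)).
Proof. exact: (measurableT_comp measurable_noise (measurable_sample i)). Qed.

Lemma in_cells_ae i : {ae P, forall w, D (X i w)}.
Proof.
exists (X i @^-1` ~` D); split.
- by apply: mXi; exact: measurableC.
- exact: PD.
- by move=> w /=.
Qed.

Lemma noise_ae i : {ae P, forall w, noise (sample i w) = eps i w}.
Proof.
apply: filterS (in_cells_ae i) => w Dw.
by rewrite /noise /= patchE ifT ?inE// model addrC addKr.
Qed.

Let noise_integrable i : P.-integrable setT (EFin \o (fun w => noise (sample i w))).
Proof.
apply/integrableP; split; first exact/measurable_EFinP.
have /integrableP[_] := eps_int i; apply: le_lt_trans.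
rewrite le_eqVlt; apply/orP; left; apply/eqP; apply: ae_eq_integral => //.
- by apply: measurableT_comp => //; exact/measurable_EFinP.
- by apply: measurableT_comp => //; exact/measurable_EFinP/meps.
- by apply: filterS (noise_ae i) => w /= -> _.
Qed.

Lemma noise_centered i : centered P (fst \o sample i) (fun w => noise (sample i w)).
Proof.
apply: centeredP; [exact: mX|exact: noise_integrable|].
move=> A mA; have [_ /(_ A mA)] := eps_mean i.
rewrite integral0 => <-; apply: ae_eq_integral.
- exact: mXi.
- by apply: measurable_funTS; exact/measurable_EFinP.
- by apply: measurable_funTS; exact/measurable_EFinP/meps.
- by apply: filterS (noise_ae i) => w /= -> _.
Qed.

Let sigma2_ge0 i : {ae P, forall w, 0 <= sigma2 (X i w) <= N}.
Proof. by apply: filterS (in_cells_ae i) => w; exact: sN. Qed.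

Let msX i : measurable_fun setT (fun w => sigma2 (X i w)).
Proof. exact: (measurableT_comp msigma2 (mX i)). Qed.

Let sigma2_integrable i : P.-integrable setT (EFin \o (fun w => sigma2 (X i w))).
Proof.
apply/integrableP; split; first exact/measurable_EFinP.
apply: (@le_lt_trans _ _ (\int[P]_w (cst `|N|%:E w))%E).
  apply: ae_ge0_le_integral => //.
  - by apply: measurableT_comp => //; exact/measurable_EFinP.
  - by move=> w _; rewrite lee_fin.
  - apply: filterS (sigma2_ge0 i) => w /= /andP[s0 sn] _.
    by rewrite lee_fin ger0_norm// (le_trans sn)// ler_norm.
by rewrite integral_cst//; apply: lte_mul_pinfty => //; exact: (probability_finite P).
Qed.

Let noise2_integrable i : P.-integrable setT (EFin \o (fun w => noise (sample i w) ^+ 2)).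
Proof.
apply/integrableP; split; first exact/measurable_EFinP/measurable_funX.
have [_ /(_ setT measurableT)] := eps_var i; rewrite preimage_setT => e2.
apply: (@le_lt_trans _ _ (\int[P]_w (eps i w ^+ 2)%:E)%E).
  rewrite le_eqVlt; apply/orP; left; apply/eqP; apply: ae_eq_integral => //.
  - apply: measurableT_comp => //; exact/measurable_EFinP/measurable_funX.
  - exact/measurable_EFinP/measurable_funX/meps.
  - by apply: filterS (noise_ae i) => w /= -> _; rewrite ger0_norm ?sqr_ge0.
rewrite e2; have /integrableP[_] := sigma2_integrable i.
by apply: le_lt_trans; apply: (le_trans (lee_abs _)); apply: le_abse_integral => //; exact/measurable_EFinP.
Qed.

Lemma noise_square_centered i : centered P (fst \o sample i)
  (fun w => noise (sample i w) ^+ 2 - sigma2 (X i w)).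
Proof.
apply: centeredP; first exact: mX.
  have := integrableB measurableT (noise2_integrable i) (sigma2_integrable i).
  by apply: eq_integrable => // w _ /=; rewrite EFinB.
move=> A mA; have mXA := mXi i mA.
have sub f : P.-integrable setT f -> P.-integrable (X i @^-1` A) f.
  by apply: integrableS.
under eq_integral do rewrite EFinB.
rewrite (integralB mXA (sub _ (noise2_integrable i)) (sub _ (sigma2_integrable i))).
have [_ /(_ A mA)] := eps_var i => e2.
rewrite (_ : integral P _ (EFin \o (fun w => noise (sample i w) ^+ 2)) =
   (\int[P]_(w in X i @^-1` A) (EFin \o sigma2) (X i w))%E).
  rewrite subee//; have := integrable_fin_num mXA (sub _ (sigma2_integrable i)).
  exact.
rewrite -e2; apply: ae_eq_integral => //.
- by apply: measurable_funTS; exact/measurable_EFinP/measurable_funX.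
- by apply: measurable_funTS; exact/measurable_EFinP/measurable_funX/meps.
- by apply: filterS (noise_ae i) => w /= -> _.
Qed.

Variable n : nat.
Local Notation V := (design_of sample fst n).

(** The errors are centered and uncorrelated given the whole design, because each
    of them is independent of the other observations. *)
Lemma conditional_square_error (c : 'I_n -> n.-tuple 'rV[R]_d -> R)
    (b : n.-tuple 'rV[R]_d -> R) (W : Omega -> \bar R) (g : n.-tuple 'rV[R]_d -> \bar R) :
  (forall i, measurable_fun setT (c i)) -> measurable_fun setT b ->
  cond_expectation P V W g ->
  (forall w, W w = ((\sum_(i < n) c i (V w) * noise (sample i w) + b (V w)) ^+ 2)%:E) ->
  {ae P, forall w, g (V w) =
    (\sum_(i < n) c i (V w) ^+ 2 * sigma2 (tnth (V w) i) + b (V w) ^+ 2)%:E}.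
Proof.
move=> mc mb gW WE.
have mfstZ : measurable_fun setT (@fst 'rV[R]_d R) by exact: measurable_fst.
have mV : measurable_fun setT V := measurable_design_of measurable_sample mfstZ.
have one_int : P.-integrable setT (EFin \o (fun w : Omega => (1 : R))).
  by apply: (bm_integrable measurableT (probability_finite P)); exact: bm_cst.
have neqS (i : nat) : i != i.+1 by rewrite neq_ltn ltnSn.
apply: (@conditional_square _ _ _ P _ _ V n (fun i w => noise (sample i w))
  (fun i t => sigma2 (tnth t i)) mV _ _ _ c b mc mb W g gW).
- by move=> i; apply: (measurableT_comp msigma2); exact: measurable_tnth.
- move=> i; have := centered_mul n measurable_sample iidZ mfstZ (neqS i) measurable_noise
    (measurable_cst (1 : R)) one_int (noise_centered i).
  by under eq_fun do rewrite mulr1.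
- move=> i j; have [<-|ij] := eqVneq i j.
    have mu2 : measurable_fun setT (fun z : 'rV[R]_d * R => noise z ^+ 2 - sigma2 z.1).
      apply: measurable_funB; first by apply: measurable_funX; exact: measurable_noise.
      exact: (measurableT_comp msigma2 measurable_fst).
    have := centered_mul n measurable_sample iidZ mfstZ (neqS i) mu2
      (measurable_cst (1 : R)) one_int (noise_square_centered i).
    congr (centered _ _ _); apply/funext => w.
    by rewrite mulr1 /design_of tnth_mktuple.
  have := centered_mul n measurable_sample iidZ mfstZ (ij : (i : nat) != j)
    measurable_noise measurable_noise (noise_integrable j) (noise_centered i).
  by congr (centered _ _ _); apply/funext => w; rewrite subr0.
- by apply: aeW => w; rewrite WE.
Qed.

End regression.

(** * The integrated conditional mean squared error *)

Section measurable_integral.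
Context {R : realType} {dX dS : measure_display} {T : measurableType dX}
  {S : measurableType dS}.
Variables (lam : {sigma_finite_measure set T -> \bar R}) (D : set T).
Hypothesis mD : measurable D.

(** Tonelli's theorem, with fine turning the values into reals. *)
Lemma measurable_Rintegral (F : T -> S -> R) :
  measurable_fun setT (fun z : T * S => ((F ^~ z.2) \_ D) z.1) ->
  (forall x t, D x -> 0 <= F x t) ->
  measurable_fun setT (fun t => \int[lam]_(x in D) F x t).
Proof.
move=> mF F0; rewrite /Rintegral.
apply: (@measurableT_comp _ _ _ _ _ _ (fine : \bar R -> R)); first exact: fine_measurable.
have -> : (fun t => \int[lam]_(x in D) (F x t)%:E)%E =
    fubini_G lam (fun z : T * S => (((F ^~ z.2) \_ D) z.1)%:E).
  apply/funext => t; rewrite /fubini_G [LHS]integral_mkcond; apply: eq_integral => x _.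
  by rewrite !patchE; case: ifP.
apply: measurable_fun_fubini_tonelli_G; first exact/measurable_EFinP.
by move=> z; rewrite lee_fin patchE; case: ifPn => //; rewrite inE => /F0.
Qed.

End measurable_integral.

Section imse.
Context {R : realType} {d : nat} {disp : measure_display}
  {Omega : measurableType disp}.
Variables (P : probability Omega R) (X : nat -> Omega -> 'rV[R]_d)
  (Y eps : nat -> Omega -> R) (mu sigma2 : 'rV[R]_d -> R) (D supp : set 'rV[R]_d).
Hypotheses (mX : forall i, measurable_fun setT (X i))
  (mY : forall i, measurable_fun setT (Y i))
  (meps : forall i, measurable_fun setT (eps i)).
Hypothesis model : forall i w, Y i w = mu (X i w) + eps i w.
Hypothesis eps_int : forall i, P.-integrable setT (EFin \o eps i).
Hypothesis eps_mean : forall i, cond_expectation P (X i) (EFin \o eps i) (cst 0%E).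
Hypothesis eps_var : forall i, cond_expectation P (X i)
  (fun w => (eps i w ^+ 2)%:E) (EFin \o sigma2).
Hypothesis iidZ : iid P (sample X Y).
Hypotheses (mD : measurable D) (PD : forall i, P (X i @^-1` ~` D) = 0%E).
Hypothesis mmu : measurable_fun D mu.
Hypothesis msigma2 : measurable_fun setT sigma2.
Variable N : R.
Hypothesis sN : forall x, D x -> 0 <= sigma2 x <= N.
Local Notation lam := (lebesgue_rV R d).
Hypotheses (msupp : measurable supp) (Dsupp : D `<=` supp)
  (supp_null : lam (supp `\` D) = 0%E).
Hypothesis finD : (lam D < +oo)%E.
Context {K : nat}.
Variables (n : nat) (p psi : 'rV[R]_d -> 'cV[R]_K) (muq w : 'rV[R]_d -> R)
  (mse : 'rV[R]_d * n.-tuple 'rV[R]_d -> \bar R).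
Hypothesis mp : forall k, measurable_fun setT (fun x => p x k ord0).
Hypothesis bpsi : forall k, bounded_measurable D (fun x => psi x k ord0).
Hypotheses (bmuq : bounded_measurable D muq) (bw : bounded_measurable D w)
  (w0 : forall x, D x -> 0 <= w x).
Hypothesis mmse : measurable_fun setT mse.

Local Notation V := (design_of (sample X Y) fst n).
Local Notation Gh t := (egram p (cst 1) (tnth t)).

Definition ls_value (x : 'rV[R]_d) (o : Omega) : R :=
  dotc (psi x) (invmx (egram p (cst 1) (fun l : 'I_n => X l o)) *m
    (n%:R^-1 *: \sum_(l < n) Y l o *: p (X l o))).

Hypothesis hmse : forall x, D x ->
  cond_expectation P V (fun o => ((ls_value x o - muq x) ^+ 2)%:E) (fun t => mse (x, t)).

Let coef x (i : 'I_n) (t : n.-tuple 'rV[R]_d) : R :=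
  n%:R^-1 * dotc (psi x) (invmx (Gh t) *m p (tnth t i)).

Let err x (t : n.-tuple 'rV[R]_d) : R :=
  dotc (psi x) (invmx (Gh t) *m evec p (mu \_ D) (tnth t)) - muq x.

Let F x t : R := \sum_(i < n) coef x i t ^+ 2 * sigma2 (tnth t i) + err x t ^+ 2.

Let mtn (i : 'I_n) : measurable_fun setT (fun t : n.-tuple 'rV[R]_d => tnth t i).
Proof. exact: measurable_tnth. Qed.

Let mpt (i : 'I_n) : measurable_mx (fun t : n.-tuple 'rV[R]_d => p (tnth t i)).
Proof. by move=> k j; rewrite ord1; exact: (measurableT_comp (mp k) (mtn i)). Qed.

Let megram (nu : 'rV[R]_d -> R) : measurable_fun setT nu ->
  measurable_mx (fun t : n.-tuple 'rV[R]_d => egram p nu (tnth t)).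
Proof.
move=> mnu i j; under eq_fun do rewrite mxE.
apply: measurable_funM => //; apply: measurable_sum => l.
apply: measurable_funM; last exact: (measurableT_comp mnu (mtn l)).
by apply: measurable_funM; exact: mpt.
Qed.

Let mGh : measurable_mx (fun t : n.-tuple 'rV[R]_d => Gh t).
Proof. exact: megram. Qed.

Let mevec (nu : 'rV[R]_d -> R) : measurable_fun setT nu ->
  measurable_mx (fun t : n.-tuple 'rV[R]_d => evec p nu (tnth t)).
Proof.
move=> mnu i j; under eq_fun do rewrite mxE.
apply: measurable_funM => //; apply: measurable_sum => l.
by apply: measurable_funM; [exact: mpt|exact: (measurableT_comp mnu (mtn l))].
Qed.

Let mmuD : measurable_fun setT (mu \_ D).
Proof. exact: (measurable_restrictT _ mD).1. Qed.

Let psiD x : 'cV[R]_K := \col_k (((fun y => psi y k ord0) \_ D) x).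

Let mpsiD : measurable_mx psiD.
Proof.
move=> k j; under eq_fun do rewrite mxE.
by have [] := bm_restrict mD (bpsi k).
Qed.

Let psiDE x : D x -> psiD x = psi x.
Proof.
by move=> Dx; apply/colP => k; rewrite mxE patchE ifT// inE.
Qed.

Let coefE x t i : coef x i t = n%:R^-1 * dotc (invmx (Gh t) *m psi x) (p (tnth t i)).
Proof. by rewrite /coef dotc_trmx trmx_inv egram_sym. Qed.

Let FE x t : F x t =
  n%:R^-1 * sandwich psi (Gh t) (egram p sigma2 (tnth t)) x + err x t ^+ 2.
Proof.
rewrite /F /sandwich dotc_egram; congr (_ + _).
rewrite mulr_sumr mulr_sumr; apply: eq_bigr => i _; rewrite coefE exprMn; ring.
Qed.

Let FD z : R := \sum_(i < n)
    (n%:R^-1 * dotc (psiD z.1) (invmx (Gh z.2) *m p (tnth z.2 i))) ^+ 2 * sigma2 (tnth z.2 i) +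
  (dotc (psiD z.1) (invmx (Gh z.2) *m evec p (mu \_ D) (tnth z.2)) - (muq \_ D) z.1) ^+ 2.

Let comp_mx {dT dS} {T : measurableType dT} {S : measurableType dS} m r
    (A : S -> 'M[R]_(m, r)) (g : T -> S) : measurable_fun setT g ->
  measurable_mx A -> measurable_mx (fun t => A (g t)).
Proof. by move=> mg mA i j; exact: (measurableT_comp (mA i j) mg). Qed.

Let m2 := @measurable_snd _ _ 'rV[R]_d (n.-tuple 'rV[R]_d).
Let m1 := @measurable_fst _ _ 'rV[R]_d (n.-tuple 'rV[R]_d).

Let merrD : measurable_fun setT (fun z : 'rV[R]_d * n.-tuple 'rV[R]_d =>
  dotc (psiD z.1) (invmx (Gh z.2) *m evec p (mu \_ D) (tnth z.2)) - (muq \_ D) z.1).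
Proof.
apply: measurable_funB.
  apply: measurable_dotc; first exact: comp_mx m1 mpsiD.
  apply: (comp_mx (A := fun t => invmx (Gh t) *m evec p (mu \_ D) (tnth t)) m2).
  by apply: measurable_mulmx; [exact: measurable_invmx|exact: mevec].
by have [mq _] := bm_restrict mD bmuq; exact: (measurableT_comp mq m1).
Qed.

Let mcoefD (i : 'I_n) : measurable_fun setT (fun z : 'rV[R]_d * n.-tuple 'rV[R]_d =>
  n%:R^-1 * dotc (psiD z.1) (invmx (Gh z.2) *m p (tnth z.2 i))).
Proof.
apply: measurable_funM => //.
apply: measurable_dotc; first exact: comp_mx m1 mpsiD.
apply: (comp_mx (A := fun t => invmx (Gh t) *m p (tnth t i)) m2).
by apply: measurable_mulmx; [exact: measurable_invmx|exact: mpt].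
Qed.

Let mFD : measurable_fun setT FD.
Proof.
apply: measurable_funD; last exact: measurable_funX.
apply: measurable_sum => i; apply: measurable_funM; first exact: measurable_funX.
by apply: (measurableT_comp msigma2); exact: (measurableT_comp (mtn i) m2).
Qed.

Let FDE x t : D x -> FD (x, t) = F x t.
Proof. by move=> Dx; rewrite /FD /F /coef /err/= psiDE// patchE ifT// inE. Qed.

Let tnthV o (l : 'I_n) : tnth (V o) l = X l o.
Proof. by rewrite /design_of tnth_mktuple. Qed.

Let ls_error x o : D x -> ls_value x o - muq x =
  \sum_(i < n) coef x i (V o) * noise mu D (sample X Y i o) + err x (V o).
Proof.
move=> Dx; rewrite /ls_value /err addrA; congr (_ - _).
have GE : egram p (cst 1) (fun l : 'I_n => X l o) = Gh (V o).
  by congr egram; apply/funext => l; rewrite tnthV.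
rewrite GE evecE -!scalemxAr !dotcZr !mulmx_sumr !dotc_sumr !mulr_sumr -big_split/=.
apply: eq_bigr => i _; rewrite -!scalemxAr !dotcZr /coef !tnthV /noise/=; ring.
Qed.

Let mse_ae x : D x -> {ae P, forall o, mse (x, V o) = (FD (x, V o))%:E}.
Proof.
move=> Dx.
have mc i : measurable_fun setT (coef x i).
  apply: measurable_funM => //; apply: measurable_dotc; first by move=> k j.
  by apply: measurable_mulmx; [exact: measurable_invmx|exact: mpt].
have me : measurable_fun setT (err x).
  apply: measurable_funB => //; apply: measurable_dotc; first by move=> k j.
  by apply: measurable_mulmx; [exact: measurable_invmx|exact: mevec].
have := conditional_square_error mX mY meps model eps_int eps_mean eps_var iidZ mD PD mmu
  msigma2 sN mc me (hmse Dx).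
have H o : ((ls_value x o - muq x) ^+ 2)%:E = ((\sum_(i < n) coef x i (V o) *
    noise mu D (sample X Y i o) + err x (V o)) ^+ 2)%:E :> \bar R by rewrite ls_error.
by move=> /(_ H); apply: filterS => o ->; rewrite FDE.
Qed.

Let mV : measurable_fun setT V.
Proof. by apply: measurable_design_of; [exact: measurable_sample|exact: measurable_fst]. Qed.

Let mse_ae_ae : {ae P, forall o, {ae lam, forall x, D x -> mse (x, V o) = (FD (x, V o))%:E}}.
Proof.
have mE : measurable_fun setT (EFin \o FD) by exact/measurable_EFinP.
exact: (@ae_ae _ _ _ P _ _ _ _ lam D V mse (EFin \o FD) mD mV mmse mE mse_ae).
Qed.

Let berr t : bounded_measurable D (err ^~ t).
Proof. by apply: bmB => //; exact: bm_dotc_psi. Qed.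

Let bF t : bounded_measurable D (fun x => F x t * w x).
Proof.
apply: bmM => //; under [X in bounded_measurable _ X]eq_fun do rewrite FE.
by apply: bmD; [apply: bmM; [exact: bm_cst|exact: bm_sandwich]|exact: bmX].
Qed.

Let integral_mse o : {ae lam, forall x, D x -> mse (x, V o) = (FD (x, V o))%:E} ->
  (\int[lam]_(x in supp) (mse (x, V o) * (w x)%:E))%E =
  (n%:R^-1 * \int[lam]_(x in D)
     (sandwich psi (Gh (V o)) (egram p sigma2 (tnth (V o))) x * w x) +
   \int[lam]_(x in D) (err x (V o) ^+ 2 * w x))%:E.
Proof.
move=> [A [mA A0 hA]].
have -> : (\int[lam]_(x in supp) (mse (x, V o) * (w x)%:E))%E =
    (\int[lam]_(x in D) (F x (V o) * w x)%:E)%E.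
  apply: (@integral_off_null _ _ _ lam ((supp `\` D) `|` A)).
  - by apply: measurableU => //; exact: measurableD.
  - exact: etrans (measureU0 (measurableD msupp mD) mA A0) supp_null.
  move=> x /not_orP[nSD nA]; rewrite !patchE.
  have [Dx|nDx] := pselect (D x).
    rewrite !ifT ?inE//; last exact: Dsupp.
    rewrite EFinM; congr (_ * _)%E; rewrite -FDE//.
    by apply: contrapT => H; apply: nA; apply: hA => /= H'; apply: H; exact: H'.
  rewrite !ifF//; apply/negbTE; rewrite notin_setE// => Sx; exact: nSD.
have I g : bounded_measurable D g -> lam.-integrable D (EFin \o g) by exact: bm_integrable.
rewrite -[LHS]fineK; last by apply: integrable_fin_num => //; apply: I; exact: bF.
congr (_%:E); rewrite -RintegralZl//; last first.
  by apply: I; apply: bmM => //; exact: bm_sandwich.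
rewrite -RintegralD//; last 2 first.
- by apply: I; apply: bmM; [exact: bm_cst|apply: bmM => //; exact: bm_sandwich].
- by apply: I; apply: bmM => //; exact: bmX.
by apply: eq_Rintegral => x _; rewrite FE mulrDl mulrA.
Qed.

Let abs_sandwich_ge0 x (t : n.-tuple 'rV[R]_d) : 0 <= sandwich psi (Gh t) (egram p (fun x => `|sigma2 x|) (tnth t)) x.
Proof.
rewrite /sandwich dotc_egram mulr_ge0//; apply: sumr_ge0 => l _.
by rewrite mulr_ge0 ?sqr_ge0.
Qed.

Let mwD : measurable_fun setT (w \_ D).
Proof. by have [] := bm_restrict mD bw. Qed.

(** On the null event that an observation falls outside the cells the conditional
    variance could be negative; its absolute value makes Tonelli's theorem
    applicable to the variance as a function of the design. *)
Lemma imse_decomposition : exists v b : Omega -> R,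
  [/\ measurable_fun setT v, measurable_fun setT b,
    {ae P, forall o, (\int[lam]_(x in supp) (mse (x, V o) * (w x)%:E))%E =
      (n%:R^-1 * v o + b o)%:E} &
    forall o, (forall l : 'I_n, D (X l o)) ->
      v o = \int[lam]_(x in D) (sandwich psi (egram p (cst 1) (fun l : 'I_n => X l o))
        (egram p sigma2 (fun l : 'I_n => X l o)) x * w x) /\
      b o = \int[lam]_(x in D) (design_bias p psi (fun l : 'I_n => X l o) mu muq x ^+ 2 * w x)].
Proof.
pose as2 x := `|sigma2 x|.
exists (fun o => \int[lam]_(x in D) (sandwich psi (Gh (V o)) (egram p as2 (tnth (V o))) x * w x)).
exists (fun o => \int[lam]_(x in D) (err x (V o) ^+ 2 * w x)).
have tE o : tnth (V o) = (fun l : 'I_n => X l o) by apply/funext => l; rewrite tnthV.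
have vE o : (forall l : 'I_n, D (X l o)) ->
    egram p as2 (tnth (V o)) = egram p sigma2 (tnth (V o)).
  move=> XD; apply/matrixP => i j; rewrite !mxE; congr (_ * _); apply: eq_bigr => l _.
  by rewrite /as2 tnthV ger0_norm//; have /andP[] := sN (XD l).
have mas2 : measurable_fun setT as2 by exact: measurableT_comp.
split.
- apply: (measurableT_comp (f := fun t => \int[lam]_(x in D)
    (sandwich psi (Gh t) (egram p as2 (tnth t)) x * w x)) _ mV).
  apply: measurable_Rintegral => //; last first.
    by move=> x t Dx; rewrite mulr_ge0 ?abs_sandwich_ge0 ?w0.
  have -> : (fun z : 'rV[R]_d * n.-tuple 'rV[R]_d =>
      ((fun x => sandwich psi (Gh z.2) (egram p as2 (tnth z.2)) x * w x) \_ D) z.1) =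
    (fun z => dotc (invmx (Gh z.2) *m psiD z.1) (egram p as2 (tnth z.2) *m
      (invmx (Gh z.2) *m psiD z.1)) * (w \_ D) z.1).
    apply/funext => z; rewrite !patchE; case: ifPn => [|_]; last by rewrite mulr0.
    by rewrite inE => Dz; rewrite psiDE.
  have mi : measurable_mx (fun z : 'rV[R]_d * n.-tuple 'rV[R]_d => invmx (Gh z.2) *m psiD z.1).
    apply: measurable_mulmx; last exact: comp_mx m1 mpsiD.
    apply: (comp_mx (A := fun t => invmx (Gh t)) m2); exact: measurable_invmx.
  apply: measurable_funM; last exact: (measurableT_comp mwD m1).
  apply: measurable_dotc => //; apply: measurable_mulmx => //.
  exact: (comp_mx (A := fun t => egram p as2 (tnth t)) m2 (megram mas2)).
- apply: (measurableT_comp (f := fun t => \int[lam]_(x in D) (err x t ^+ 2 * w x)) _ mV).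
  apply: measurable_Rintegral => //; last first.
    by move=> x t Dx; rewrite mulr_ge0 ?sqr_ge0 ?w0.
  have -> : (fun z : 'rV[R]_d * n.-tuple 'rV[R]_d =>
      ((fun x => err x z.2 ^+ 2 * w x) \_ D) z.1) =
    (fun z => (dotc (psiD z.1) (invmx (Gh z.2) *m evec p (mu \_ D) (tnth z.2)) -
      (muq \_ D) z.1) ^+ 2 * (w \_ D) z.1).
    apply/funext => z; rewrite !patchE; case: ifPn => [|_]; last by rewrite mulr0.
    by rewrite inE => Dz; rewrite psiDE.
  apply: measurable_funM; last exact: (measurableT_comp mwD m1).
  exact: measurable_funX.
- have inD : {ae P, forall o, forall l : 'I_n, D (X l o)}.
    apply: (@filter_forall _ 'I_n (fun l o => D (X l o)) (almost_everywhere P)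
      (ae_filter_ringOfSetsType P)) => l.
    exact: (in_cells_ae mX mD PD).
  apply: filterS2 inD mse_ae_ae => o XD /integral_mse ->.
  by rewrite vE.
move=> o XD; rewrite (vE o XD) tE; split; first exact: erefl.
apply: eq_Rintegral => x _.
congr (_ ^+ 2 * _); rewrite /err /design_bias tE; congr (dotc _ (_ *m _) - _).
apply/colP => i; rewrite !mxE; congr (_ * _); apply: eq_bigr => l _.
by rewrite patchE ifT// inE.
Qed.

End imse.

(** The expected number of observations in a cell beats the logarithm of the
    sample size, and the number of pairs of basis functions is at most of the order
    of the squared sample size. *)
Lemma exponential_tail {R : realType} (a b : R) (H : nat -> R) (K : nat -> nat) :
  0 < a -> (forall n, 0 < H n) -> ln n%:R / (n%:R * H n) @[n --> \oo] --> (0 : R) ->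
  (\forall n \near \oo, (K n)%:R * H n <= b) ->
  forall eta, 0 < eta -> \forall n \near \oo,
    6 * (K n)%:R ^+ 2 * expR (- (n%:R * H n * a)) <= eta.
Proof.
move=> a0 H0 rate card eta eta0.
(* This choice makes the tail at most n^-3, against at most of the order of n^2
   pairs. *)
pose e := a / 3; have e0 : 0 < e by rewrite divr_gt0.
have rate' : \forall n \near \oo, ln n%:R <= e * (n%:R * H n).
  move/cvgrPdist_le : rate => /(_ e e0).
  apply: filterS2 (nbhs_infty_gt 0) => n n0; rewrite sub0r normrN => le_e.
  have nH : 0 < n%:R * H n by rewrite mulr_gt0 ?ltr0n.
  by rewrite -ler_pdivrMr//; apply: le_trans le_e; exact: ler_norm.
near=> n.
have n0 : 0 < n%:R :> R by rewrite ltr0n; near: n; exact: nbhs_infty_gt.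
have ln1 : 1 <= ln (n%:R : R).
  rewrite -[leLHS]expRK ler_ln ?posrE ?expR_gt0//.
  by near: n; exact: nbhs_infty_ger.
have rn : ln n%:R <= e * (n%:R * H n) by near: n.
have Hn := H0 n.
have Kb : (K n)%:R * H n <= b by near: n.
have b0 : 0 <= b by apply: le_trans Kb; rewrite mulr_ge0// ltW.
have K_le : (K n)%:R <= b * e * n%:R.
  have eH : 1 <= e * n%:R * H n by rewrite -mulrA (le_trans ln1).
  apply: (@le_trans _ _ ((K n)%:R * (e * n%:R * H n))); first by rewrite ler_peMr.
  have -> : (K n)%:R * (e * n%:R * H n) = (K n)%:R * H n * (e * n%:R) by ring.
  rewrite -[leRHS]mulrA; apply: ler_wpM2r Kb.
  by rewrite mulr_ge0 ?ltW.
have exp_le : expR (- (n%:R * H n * a)) <= (n%:R ^+ 3)^-1.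
  have -> : (n%:R ^+ 3)^-1 = expR (- (3%:R * ln n%:R)) :> R.
    by rewrite expRN expRM_natl lnK.
  rewrite ler_expR lerN2 (le_trans (ler_wpM2l _ rn))// /e.
  by rewrite le_eqVlt; apply/orP; left; apply/eqP; field.
apply: (@le_trans _ _ (6 * (b * e * n%:R) ^+ 2 * (n%:R ^+ 3)^-1)).
  apply: ler_pM; [by rewrite mulr_ge0 ?sqr_ge0|exact: expR_ge0| |exact: exp_le].
  by rewrite ler_pM2l// ler_pXn2r ?nnegrE// !mulr_ge0// ltW.
have -> : 6 * (b * e * n%:R) ^+ 2 * (n%:R ^+ 3)^-1 = 6 * (b * e) ^+ 2 / n%:R :> R.
  by field; rewrite gt_eqF.
rewrite ler_pdivrMr// -ler_pdivrMl//.
near: n; exact: nbhs_infty_ger.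
Unshelve. all: by end_near.
Qed.

Lemma random_variable_of {R : realType} {disp : measure_display}
    {Omega : measurableType disp} (P : probability Omega R) (g : Omega -> R) :
  measurable_fun setT g -> exists r : {RV P >-> R}, forall o, r o = g o.
Proof.
move=> mg.
pose mixin := isMeasurableFun.Build _ _ _ _ g mg.
pose r : {RV P >-> R} := HB.pack g mixin.
by exists r.
Qed.

(** * Regularity along the sequence of partitions *)

Section regularity.
Context {R : realType} {d : nat} {disp : measure_display} {Omega : measurableType disp}.
Variables (P : probability Omega R)
    (X : nat -> {RV P >-> 'rV[R]_d}) (Y eps : nat -> {RV P >-> R})
    (mu sigma2 f : 'rV[R]_d -> R) (supp : set 'rV[R]_d)
    (q : multi_index d) (S m vs : nat) (rho : R)
    (kappa K : nat -> nat) (cells : forall n, 'I_(kappa n) -> set 'rV[R]_d)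
    (p : forall n, 'rV[R]_d -> 'cV[R]_(K n))
    (Lambda : {fset multi_index d})
    (B : nat -> multi_index d -> multi_index d -> 'rV[R]_d -> R)
    (w : 'rV[R]_d -> R).
Arguments cells : clear implicits.
Hypotheses (d_gt0 : (0 < d)%N)
    (hdgp : data_generating_process X Y eps mu sigma2 f supp q S rho)
    (hpart : forall n, is_partition (cells n) supp)
    (hqu : quasi_uniform_partition cells)
    (hbasis : local_basis cells p q m vs)
    (happrox : approximation_error cells p supp mu m Lambda B S vs rho)
    (hw : {within supp, continuous w})
    (hw0 : bounded_away_from_zero supp w).

Local Notation lam := (lebesgue_rV R d).
Local Notation h n := (mesh (cells n)).
Local Notation D n := (cell_union (cells n)).
Local Notation psi n := (basis_partial cells p n q).
Local Notation bias n := (leading_bias cells supp mu m Lambda B n).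

Let mD n : measurable (D n) := measurable_cell_union (hpart n).
Let oD n : open (D n) := open_cell_union (hpart n).
Let Dsupp n : D n `<=` supp := cell_union_sub (hpart n).

Let msupp : measurable supp := measurable_partition_support (hpart 0%N).

Lemma outside_cells_null n i : P (X i @^-1` ~` D n) = 0%E.
Proof.
apply: (design_in_cells (measurable_funPT (X i)) (dgp_density_measurable hdgp)
  (@dgp_density _ _ _ _ _ _ _ _ _ _ _ _ _ _ _ hdgp i) (hpart n)).
exact: (dgp_support hdgp).
Qed.

Definition volume : R := fine (lam supp).

Lemma supp_finite : (lam supp < +oo)%E.
Proof.
have [M hM] := compact_enorm_bounded (dgp_compact hdgp).
exact: le_lt_trans (volume_diam_le msupp hM) (ltry _).
Qed.

Lemma cells_finite n : (lam (D n) < +oo)%E.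
Proof.
apply: le_lt_trans supp_finite; apply: le_measure; rewrite ?inE//; exact: Dsupp.
Qed.

Lemma cells_volume n : fine (lam (D n)) = volume.
Proof.
rewrite /volume; congr fine.
rewrite -[in RHS](setDUK (@Dsupp n)).
by rewrite measureU0//; [exact: measurableD|exact: uncovered_null (hpart n)].
Qed.

Lemma on_support_bounded (g : 'rV[R]_d -> R) : {within supp, continuous g} ->
  exists C : R, forall x, supp x -> `|g x| <= C.
Proof. exact: within_bounded (dgp_compact hdgp). Qed.

Lemma bm_on_support n (g : 'rV[R]_d -> R) : {within supp, continuous g} ->
  bounded_measurable (D n) g.
Proof.
move=> cg; have [C hC] := on_support_bounded cg; split; last by exists C => x /Dsupp/hC.
apply: continuous_measurable_rV => //.
move=> x Dx; exact (within_continuous_at (@oD n) (@Dsupp n) cg Dx).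
Qed.

(** The law of a regressor lives on the support and has a density. *)
Lemma volume_gt0 : 0 < volume.
Proof.
have [M hM] := on_support_bounded (dgp_density_continuous hdgp).
rewrite lt_neqAle fine_ge0 ?andbT// eq_sym; apply/eqP => v0.
have fin := cells_finite 0%N; have mD0 := mD 0%N.
have lD0 : lam (D 0%N) = 0%E.
  by rewrite -[LHS]fineK ?cells_volume ?v0// ge0_fin_numE.
have := density_null (dgp_density_measurable hdgp)
  (@dgp_density _ _ _ _ _ _ _ _ _ _ _ _ _ _ _ hdgp 0%N) mD0 lD0.
have := outside_cells_null 0%N 0%N => P1 P2.
have mXi A : measurable A -> measurable (X 0%N @^-1` A).
  by move=> mA; rewrite -[X in measurable X]setTI; exact: (measurable_funPT (X 0%N)).
have : P setT = 0%E.
  have := measureU0 (mu := P) (mXi _ mD0) (mXi _ (measurableC mD0)) P1.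
  by rewrite -preimage_setU setUv preimage_setT => ->.
by rewrite probability_setT => /eqP; rewrite onee_eq0.
Qed.

Lemma cells_diam n l x y : cells n l x -> cells n l y -> enorm (x - y) <= h n.
Proof.
move=> lx ly; have [M hM] := compact_enorm_bounded (dgp_compact hdgp).
apply: (@le_trans _ _ (diam (cells n l))).
  apply: (@diam_ub _ _ _ M) lx ly => x' y' /(partition_sub (hpart n)) Sx.
  by move=> /(partition_sub (hpart n)) Sy; exact: hM.
exact: le_bigmax.
Qed.

Lemma cell_diam_ge0 n l : 0 <= diam (cells n l).
Proof.
have [->|/set0P[x lx]] := eqVneq (cells n l) set0.
  rewrite /diam (_ : [set _ | _ in _ & _ in _] = set0) ?sup0//.
  by apply/seteqP; split => // z [].
have [M hM] := compact_enorm_bounded (dgp_compact hdgp).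
have := @diam_ub _ _ (cells n l) M _ x x lx lx; rewrite subrr => H.
apply: (le_trans (enorm_ge0 _)); apply: H => x' y' /(partition_sub (hpart n)) Sx.
by move=> /(partition_sub (hpart n)) Sy; exact: hM.
Qed.

(** If all diameters were zero, the cells would be null and could not fill the
    support up to a null set. *)
Lemma mesh_gt0 n : 0 < h n.
Proof.
have h0 : 0 <= h n by apply: bigmax_ge_id.
rewrite lt_neqAle h0 andbT eq_sym; apply/eqP => h00.
have cell0 l : measurable (cells n l) /\ lam (cells n l) = 0%E.
  have ml : measurable (cells n l) by apply: open_measurable_rV; exact: partition_open (hpart n) l.
  split => //; apply/eqP; rewrite eq_le measure_ge0 andbT.
  have := volume_diam_le ml (@cells_diam n l); rewrite h00 normr0 mulr0.
  by rewrite expr0n (gtn_eqF d_gt0).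
have [_] := null_bigsetU (index_enum 'I_(kappa n)) cell0.
rewrite -bigcup_seq (_ : \bigcup_(i in _) _ = D n); last first.
  by apply/seteqP; split => x [l _ lx]; exists l => //=; rewrite mem_index_enum.
move=> D0; have := cells_volume n; rewrite D0 /= => /esym v0.
by have := volume_gt0; rewrite v0 ltxx.
Qed.

(** ** Derivatives on the cells *)

Lemma supp_interior n x : D n x -> supp° x.
Proof. by have := @Dsupp n; rewrite open_subsetE// => H Dx; exact: H Dx. Qed.

Lemma smooth_continuous n u x : (mi_order u <= S)%N -> D n x ->
  {for x, continuous (partial u mu)}.
Proof.
move=> uS /supp_interior Sx; have [_ ck _] := dgp_smooth hdgp.
exact (partial_continuous ck uS Sx).
Qed.

Lemma smooth_partial_in n u x : (mi_order u <= S)%N -> D n x ->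
  partial_in supp u mu x = partial u mu x.
Proof.
move=> uS Dx; apply: inner_lim_continuous; first exact: supp_interior Dx.
exact: smooth_continuous Dx.
Qed.

Lemma smooth_bounded u : (mi_order u <= S)%N ->
  exists C : R, forall x, supp° x -> `|partial u mu x| <= C.
Proof.
move=> uS; have [_ _ lim_ex] := dgp_smooth hdgp.
apply: (limits_bounded (dgp_compact hdgp)); first exact: interior_subset.
move=> x Sx; apply: lim_ex => //.
exact: subset_closure.
Qed.

Lemma near_partial_in n u x : (mi_order u <= S)%N -> D n x ->
  \forall y \near x, partial_in supp u mu y = partial u mu y.
Proof.
move=> uS Dx; have : nbhs x (D n) by exact: open_nbhs_nbhs.
by apply: filterS => y Dy; exact: (smooth_partial_in uS Dy).
Qed.

Lemma partial_in_continuous n u x : (mi_order u <= S)%N -> D n x ->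
  {for x, continuous (partial_in supp u mu)}.
Proof.
move=> uS Dx; apply: (near_eq_continuous_at (near_partial_in uS Dx)).
exact: smooth_continuous Dx.
Qed.

Lemma bm_partial_in n u : (mi_order u <= S)%N ->
  bounded_measurable (D n) (partial_in supp u mu).
Proof.
move=> uS; split; last first.
  have [C hC] := smooth_bounded uS; exists C => x Dx.
  by rewrite (smooth_partial_in uS Dx) hC//; exact: supp_interior Dx.
apply: continuous_measurable_rV => // x Dx; exact: partial_in_continuous Dx.
Qed.

Lemma partial_in_mi0 n x : D n x -> partial_in supp mi0 mu x = mu x.
Proof.
move=> Dx; rewrite (@smooth_partial_in n) ?partial_mi0//.
by rewrite /mi_order big1// => i _; rewrite ffunE.
Qed.

Lemma mi_order_mi0 : mi_order (@mi0 d) = 0%N.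
Proof. by rewrite /mi_order big1// => i _; rewrite ffunE. Qed.

Lemma vs_bounds : (mi_order q <= vs)%N /\ (vs < m)%N.
Proof. exact/andP/(basis_vs hbasis). Qed.

Lemma near_cell n l x : cells n l x -> \forall y \near x, cells n l y.
Proof.
move=> lx; apply: open_nbhs_nbhs; split => //.
exact: partition_open (hpart n) l.
Qed.

(** On a cell the diameter factor is constant, and the one-sided limits of the
    derivatives and of B are their values. *)
Lemma bias_continuous n alpha x : (mi_order alpha <= vs)%N -> D n x ->
  {for x, continuous (bias n alpha)}.
Proof.
move=> av Dx; have [l _ lx] := Dx.
pose g y := - \sum_(u <- Lambda) partial_in supp u mu y *
  diam (cells n l) ^+ (m - mi_order alpha) * B n u alpha y.
apply: (@near_eq_continuous_at _ _ _ g).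
  apply: filterS (near_cell lx) => y ly.
  rewrite /leading_bias /g; congr (- _); apply: eq_big_seq => u uL.
  rewrite /cell_diam /cell_lim (cell_ofE (hpart n) ly).
  rewrite (inner_limE (cell_interior (hpart n) ly))//.
  by apply: (approx_B_lim happrox) => //; exact: subset_closure.
apply: continuousN.
suff term u : u \in Lambda -> {for x, continuous (fun y => partial_in supp u mu y *
    diam (cells n l) ^+ (m - mi_order alpha) * B n u alpha y)}.
  have : {subset enum_fset Lambda <= Lambda} by [].
  elim: (enum_fset Lambda) => [|u r ih] rL.
    apply: (@near_eq_continuous_at _ _ _ (fun=> 0)); last exact: cst_continuous.
    by apply: filterE => y; rewrite big_nil.
  apply: (@near_eq_continuous_at _ _ _ (fun y => partial_in supp u mu y *
    diam (cells n l) ^+ (m - mi_order alpha) * B n u alpha y + \sum_(v <- r)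
    partial_in supp v mu y * diam (cells n l) ^+ (m - mi_order alpha) * B n v alpha y)).
    by apply: filterE => y; rewrite big_cons.
  apply: continuousD; first by apply: term; apply: rL; rewrite mem_head.
  by apply: ih => v vr; apply: rL; rewrite in_cons vr orbT.
move=> uL; have um := approx_Lambda happrox uL.
have uS : (mi_order u <= S)%N by rewrite um; exact: approx_order happrox.
have cB := approx_B_lim happrox uL av (subset_closure lx).
apply: continuousM.
  apply: continuousM; last exact: cst_continuous.
  exact (partial_in_continuous uS Dx).
exact (inner_cvg_continuous (cell_interior (hpart n) lx) cB).
Qed.

Lemma bias_bounded : exists2 C : R, 0 <= C &
  forall n alpha x, (mi_order alpha <= vs)%N -> D n x ->
    `|bias n alpha x| <= C * h n ^+ (m - mi_order alpha).
Proof.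
have [CB hCB] := approx_B_bounded happrox.
have hU u : exists C : R, u \in Lambda -> forall x, supp° x -> `|partial u mu x| <= C.
  have [uL|uL] := boolP (u \in Lambda); last by exists 0.
  have uS : (mi_order u <= S)%N by rewrite (approx_Lambda happrox uL); exact: approx_order happrox.
  by have [C hC] := smooth_bounded uS; exists C => _.
have [CU hCU] := choice hU.
exists (\sum_(u <- Lambda) `|CU u| * `|CB|); first by apply: sumr_ge0 => u _; rewrite mulr_ge0.
move=> n alpha x av Dx; have [l _ lx] := Dx.
rewrite /leading_bias normrN mulr_suml.
apply: (le_trans (ler_norm_sum _ _ _)).
rewrite big_seq [leRHS]big_seq; apply: ler_sum => u uL.
have uS : (mi_order u <= S)%N by rewrite (approx_Lambda happrox uL); exact: approx_order happrox.
rewrite /cell_diam /cell_lim (cell_ofE (hpart n) lx).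
rewrite (inner_limE (cell_interior (hpart n) lx)); last first.
  by apply: (approx_B_lim happrox) => //; exact: subset_closure.
rewrite (smooth_partial_in uS Dx) !normrM mulrAC.
have Sx : supp° x := supp_interior Dx.
apply: ler_pM => //.
- apply: ler_pM => //.
    by rewrite (le_trans (hCU u uL x Sx))// ler_norm.
  by rewrite (le_trans (hCB _ _ _ _ uL av (Dsupp Dx)))// ler_norm.
rewrite normrX ger0_norm ?cell_diam_ge0// lerXn2r ?nnegrE ?cell_diam_ge0 ?(ltW (mesh_gt0 n))//.
exact: le_bigmax.
Qed.

Lemma bm_bias n alpha : (mi_order alpha <= vs)%N -> bounded_measurable (D n) (bias n alpha).
Proof.
move=> av; split; last first.
  by have [C _ hC] := bias_bounded; exists (C * h n ^+ (m - mi_order alpha)) => x; exact: hC.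
apply: continuous_measurable_rV => // x Dx; exact: bias_continuous.
Qed.

(** ** The basis and its derivatives *)

Lemma basis_smooth_S n l (k : 'I_(K n)) : Ck vs.+1 (cells n l) (basis_fun p k).
Proof. exact (basis_smooth hbasis l k). Qed.

Lemma basis_partial_mi0 n x : D n x -> basis_partial cells p n mi0 x = p n x.
Proof.
move=> [l _ lx]; apply/colP => k; rewrite mxE.
rewrite (cell_partial_eq (hpart n) (basis_smooth_S l k) _ lx) ?partial_mi0//.
by rewrite mi_order_mi0.
Qed.

Lemma basis_partial_cell n l alpha x : cells n l x ->
  basis_partial cells p n alpha x = basis_partial_in cells p l alpha x.
Proof.
move=> lx; apply/colP => k; rewrite !mxE /cell_partial /cell_lim.
by rewrite (cell_ofE (hpart n) lx).
Qed.

Lemma basis_upper alpha : (mi_order alpha <= vs)%N -> exists2 M : R, 0 <= M &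
  \forall n \near \oo, forall x, D n x ->
    enorm (basis_partial cells p n alpha x) <= M * h n ^- mi_order alpha.
Proof.
move=> av; have [M hM] := basis_partial_upper hbasis (leqW av).
exists `|M| => //; apply: filterS hM => n hM x [l _ lx].
have hq0 : 0 <= h n ^- mi_order alpha by rewrite invr_ge0 exprn_ge0// ltW// mesh_gt0.
rewrite -lee_fin (basis_partial_cell alpha lx).
apply: (@le_trans _ _ (sup_basis_partial cells p alpha n)).
  apply: (@le_trans _ _ (ereal_sup [set (enorm (basis_partial_in cells p l alpha x))%:E
    | x in closure (cells n l)])).
    by apply: ereal_sup_ubound; exists x => //; exact: subset_closure.
  by apply: ereal_sup_ubound; exists l.
apply: (le_trans (lee_abs _)); apply: (le_trans hM).
by rewrite abse_EFin (ger0_norm hq0) -EFinM lee_fin ler_wpM2r// ler_norm.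
Qed.

Lemma basis_lower alpha : (mi_order alpha <= vs)%N -> exists2 c : R, 0 < c &
  \forall n \near \oo, forall x, D n x ->
    c * h n ^- mi_order alpha <= enorm (basis_partial cells p n alpha x).
Proof.
move=> av; have [M hM] := basis_partial_lower hbasis av.
have M0 : 0 < `|M| + 1 by rewrite ltr_wpDl.
exists (`|M| + 1)^-1; first by rewrite invr_gt0.
apply: filterS hM => n hM x [l _ lx].
have hq0 : 0 <= h n ^- mi_order alpha by rewrite invr_ge0 exprn_ge0// ltW// mesh_gt0.
rewrite ler_pdivrMl// -lee_fin (basis_partial_cell alpha lx).
have i0 : (0 <= inf_basis_partial cells p alpha n)%E.
  apply: le_ereal_inf_tmp => _ [l' _ <-]; apply: le_ereal_inf_tmp => _ [y _ <-].
  by rewrite lee_fin enorm_ge0.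
rewrite -(ger0_norm hq0) -abse_EFin; apply: (le_trans hM).
rewrite (gee0_abs i0) EFinM.
apply: (@le_trans _ _ ((`|M| + 1)%:E * inf_basis_partial cells p alpha n)%E).
  by rewrite lee_wpmul2r// lee_fin (le_trans (ler_norm M))// lerDl.
rewrite lee_wpmul2l ?lee_fin ?(ltW M0)//.
apply: (@le_trans _ _ (ereal_inf [set (enorm (basis_partial_in cells p l alpha x))%:E
    | x in closure (cells n l)])).
  by apply: ereal_inf_lbound; exists l.
by apply: ereal_inf_lbound; exists x => //; exact: subset_closure.
Qed.

Lemma basis_local_functions n alpha (M : R) : (mi_order alpha <= vs)%N ->
  (forall x, D n x -> enorm (basis_partial cells p n alpha x) <= M) ->
  local_functions (cells n) (p n) (fun k x => basis_partial cells p n alpha x k ord0) M.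
Proof.
move=> av hM; split.
- move=> k; apply: continuous_measurable_rV => // x Dx.
  have -> : (fun x => basis_partial cells p n alpha x k ord0) =
      cell_partial (cells n) alpha (basis_fun p k).
    by apply/funext => y; rewrite mxE.
  apply: (cell_partial_continuous (hpart n) (s := vs.+1)) => //; last exact: leqW.
  by move=> l; exact: basis_smooth_S.
- move=> x Dx; have -> : \col_i basis_partial cells p n alpha x i ord0 =
      basis_partial cells p n alpha x by apply/colP => i; rewrite mxE.
  exact: hM.
- move=> k l x lx; rewrite inE => /asboolP nact; rewrite mxE.
  exact: (cell_partial_inactive (hpart n) _ lx).
Qed.

(** ** The approximating spline *)

Lemma mesh_cvg0 (e : R) : 0 < e -> \forall n \near \oo, h n <= e.
Proof.
move=> e0; have [_ _ /cvgrPdist_le/(_ e e0)] := hqu.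
by apply: filterS => n; rewrite sub0r normrN ger0_norm// ltW// mesh_gt0.
Qed.

Lemma mesh_powR_le (M delta : R) : 0 < delta ->
  \forall n \near \oo, M * h n `^ rho <= delta.
Proof.
move=> delta0; have rho0 := dgp_rho_gt0 hdgp.
have M0 : 0 < `|M| + 1 by rewrite ltr_wpDl.
pose e := delta / (`|M| + 1); have e0 : 0 < e by rewrite divr_gt0.
have pe0 : 0 < e `^ rho^-1 by rewrite powR_gt0.
apply: filterS (mesh_cvg0 pe0) => n hn.
have hr : h n `^ rho <= e.
  apply: (@le_trans _ _ ((e `^ rho^-1) `^ rho)).
    by rewrite ge0_ler_powR ?nnegrE ?(ltW rho0) ?(ltW (mesh_gt0 n)) ?(ltW pe0).
  by rewrite -powRrM mulVf ?gt_eqF// powRr1// ltW.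
apply: (@le_trans _ _ ((`|M| + 1) * h n `^ rho)).
  by rewrite ler_wpM2r ?powR_ge0// (le_trans (ler_norm M))// lerDl.
by rewrite (le_trans (ler_wpM2l (ltW M0) hr))// /e mulrCA mulfV ?mulr1// gt_eqF.
Qed.

Lemma mesh_powR_split n (j : nat) :
  h n `^ (m%:R + rho - j%:R) = h n `^ rho * (h n ^+ m * h n ^- j).
Proof.
have h0 := mesh_gt0 n.
have hn : h n != 0 by rewrite gt_eqF.
rewrite powRD; last by rewrite hn implybT.
rewrite powRD; last by rewrite hn implybT.
by rewrite powRN !powR_mulrn ?(ltW h0)//; ring.
Qed.

(** The exponent rho > 0 in the approximation error supplies a factor that tends to
    zero, which is turned here into an arbitrary tolerance delta. *)
Lemma spline_error : exists a : forall n, 'cV[R]_(K n), forall alpha delta,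
  (mi_order alpha <= vs)%N -> 0 < delta ->
  \forall n \near \oo, forall x, D n x ->
    `|partial_in supp alpha mu x - dotc (a n) (basis_partial cells p n alpha x) +
      bias n alpha x| <= delta * (h n ^+ m * h n ^- mi_order alpha).
Proof.
have [a ha] := approx_spline happrox; exists a => alpha delta av delta0.
have [M hM] := ha alpha av.
apply: filterS2 hM (mesh_powR_le M delta0) => n hM1 hM2 x Dx.
have h0 := mesh_gt0 n.
have hh0 : 0 <= h n ^+ m * h n ^- mi_order alpha.
  by rewrite mulr_ge0 ?invr_ge0 ?exprn_ge0 ?(ltW h0).
rewrite -lee_fin; apply: (@le_trans _ _ (M * h n `^ rho * (h n ^+ m * h n ^- mi_order alpha))%:E);
  last by rewrite lee_fin ler_wpM2r.
rewrite -mulrA -mesh_powR_split.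
apply: (@le_trans _ _ (ereal_sup [set `|partial_in supp alpha mu x -
  cell_partial (cells n) alpha (fun y => ((a n)^T *m p n y) ord0 ord0) x +
  bias n alpha x|%:E | x in supp])); last first.
  apply: (le_trans (lee_abs _)); apply: (le_trans hM1).
  by rewrite abse_EFin ger0_norm ?powR_ge0// EFinM.
apply: ereal_sup_ubound; exists x; first exact: Dsupp Dx.
congr (`|_ - _ + _|%:E).
have -> : (fun y => ((a n)^T *m p n y) ord0 ord0) =
    (fun y => \sum_i a n i ord0 * basis_fun p i y).
  by apply/funext => y; rewrite dotcE.
rewrite (cell_partial_linear (hpart n) (s := vs.+1))//.
- by apply: eq_bigr => i _; rewrite mxE.
- by move=> i l; exact: basis_smooth_S.
- exact: leqW.
Qed.

(** ** The estimands as integrals over the cells *)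

Let dens i := @dgp_density _ _ _ _ _ _ _ _ _ _ _ _ _ _ _ hdgp i.

Lemma design_expectation n phi : bounded_measurable (D n) phi ->
  \int[P]_o phi (X 0%N o) = \int[lam]_(x in D n) (phi x * f x).
Proof.
move=> bphi.
have bf : bounded_measurable (D n) f := bm_on_support n (dgp_density_continuous hdgp).
rewrite (expectation_on (measurable_funPT (X 0%N)) (mD n) (outside_cells_null n 0%N)).
exact: (expectation_density (measurable_funPT (X 0%N)) (dgp_density_ge0 hdgp) (dens 0%N)
  (mD n) (cells_finite n) (outside_cells_null n 0%N) bf).
Qed.

Local Notation G n := (wgram (cells n) (fun i x => p n x i ord0) f).
Local Notation Sg n := (wgram (cells n) (fun i x => p n x i ord0) (fun x => sigma2 x * f x)).

Let bsigma2 n : bounded_measurable (D n) sigma2 := bm_on_support n (dgp_variance_continuous hdgp).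
Let bdens n : bounded_measurable (D n) f := bm_on_support n (dgp_density_continuous hdgp).

Lemma wgram_sym n nu : (wgram (cells n) (fun i x => p n x i ord0) nu)^T =
  wgram (cells n) (fun i x => p n x i ord0) nu.
Proof.
apply/matrixP => i j; rewrite !mxE; apply: eq_Rintegral => x _.
by rewrite (mulrC (p n x j ord0)).
Qed.

Section bounded_basis.
Variable n : nat.
Hypothesis bp : forall i, bounded_measurable (D n) (fun x => p n x i ord0).

Lemma gramE : gram p X n = G n.
Proof.
apply/matrixP => i j; rewrite !mxE.
by rewrite (@design_expectation n (fun x => p n x i ord0 * p n x j ord0))//; exact: bmM.
Qed.

Lemma SigmaE : Sigma p X sigma2 n = Sg n.
Proof.
apply/matrixP => i j; rewrite !mxE.
rewrite (@design_expectation n (fun x => p n x i ord0 * p n x j ord0 * sigma2 x)).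
  by apply: eq_Rintegral => x _; rewrite mulrA.
by apply: bmM => //; exact: bmM.
Qed.

Lemma gammaE x : gamma cells p X q n x = invmx (G n) *m psi n x.
Proof. by rewrite /gamma gramE trmx_mul trmx_inv trmxK wgram_sym. Qed.

Hypothesis bpsi : forall i, bounded_measurable (D n) (fun x => psi n x i ord0).
Let bw : bounded_measurable (D n) w := bm_on_support n hw.

Lemma imse_varianceE : imse_variance cells p X supp w sigma2 q n =
  \int[lam]_(x in D n) (sandwich (psi n) (G n) (Sg n) x * w x).
Proof.
have bg i : bounded_measurable (D n) (fun x => (invmx (G n) *m psi n x) i ord0).
  exact: bm_mulmx.
have bt i j : bounded_measurable (D n) (fun x => (invmx (G n) *m psi n x) i ord0 *
    Sg n i j * (invmx (G n) *m psi n x) j ord0 * w x).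
  apply: bmM => //; apply: bmM => //; apply: bmM => //; exact: bm_cst.
rewrite /imse_variance SigmaE.
transitivity (\sum_i \sum_j \int[lam]_(x in D n) ((invmx (G n) *m psi n x) i ord0 *
    Sg n i j * (invmx (G n) *m psi n x) j ord0 * w x)).
  apply: eq_bigr => i _; rewrite mxE; apply: eq_bigr => j _.
  rewrite [X in _ * X]mxE (Rintegral_cells (hpart n)).
  rewrite -RintegralZl//; last first.
    apply: bm_integrable => //; first exact: cells_finite.
    under [X in bounded_measurable _ X]eq_fun do rewrite gammaE.
    by apply: bmM => //; exact: bmM.
  by apply: eq_Rintegral => x _; rewrite gammaE; ring.
have fD := cells_finite n.
under eq_bigr => i _ do rewrite -Rintegral_sum//.
rewrite -Rintegral_sum//; last by move=> i _; apply: bm_sum.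
apply: eq_Rintegral => x _; rewrite /sandwich dotc_mulmx mulr_suml.
by apply: eq_bigr => i _; rewrite mulr_suml.
Qed.

Lemma imse_biasE : imse_bias cells p X supp w (leading_bias cells supp mu m Lambda B) q n =
  \int[lam]_(x in D n) (bias_target (cells n) (p n) (psi n) f (bias n mi0) (bias n q) x ^+ 2 * w x).
Proof.
rewrite /imse_bias (Rintegral_cells (hpart n)); apply: eq_Rintegral => x _.
congr ((_ - _) ^+ 2 * _); rewrite gammaE dotcE dotc_trmx trmx_inv wgram_sym.
congr (dotc _ (_ *m _)); apply/colP => k; rewrite !mxE.
rewrite (@design_expectation n (fun x => p n x k ord0 * bias n mi0 x))//.
by apply: bmM => //; apply: bm_bias; rewrite mi_order_mi0.
Qed.

End bounded_basis.

Lemma ls_estimatorE n x o :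
  ls_estimator cells p X Y q n x o = ls_value X Y n (p n) (psi n) x o.
Proof.
rewrite /ls_estimator /ls_value -mulmxA dotcE; congr (dotc _ (invmx _ *m _)).
apply/matrixP => i j; rewrite !mxE summxE; congr (_ * _); apply: eq_bigr => l _.
by rewrite !mxE big_ord1 mxE mulr1.
Qed.

(** ** Bounds that hold from some index on *)

Local Notation H n := (h n ^+ d).
Local Notation hq n := (h n ^- mi_order q).
Local Notation hm n := (h n ^+ m).

(** Everything that the bounds at a fixed sample size require, with constants that
    do not depend on the sample size. *)
Record regular (c M : R) (C n : nat) : Prop := {
  regular_active : forall i : 'I_(K n),
    (#|active_cells (cells n) (fun x => p n x i ord0)| <= C)%N ;
  regular_neighbours : forall i : 'I_(K n), (#|[pred j : 'I_(K n) |
    `[< active_on (fun x => p n x j ord0)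
          (active_region (cells n) (fun x => p n x i ord0)) >]]| <= C)%N ;
  regular_gram : forall (i : 'I_(K n)) (a : 'cV[R]_(K n)),
    c * (a i ord0 ^+ 2 * H n) <=
    (a^T *m (\matrix_(j, j') \int[lam]_(x in
       active_region (cells n) (fun x => p n x i ord0))
       (p n x j ord0 * p n x j' ord0)) *m a) ord0 ord0 ;
  regular_basis : local_functions (cells n) (p n) (fun i x => p n x i ord0) M ;
  regular_derivative :
    local_functions (cells n) (p n) (fun i x => psi n x i ord0) (M * hq n) ;
  regular_lower : forall x, D n x -> c * hq n <= enorm (psi n x) ;
  regular_density : forall x, D n x -> c <= f x <= M ;
  regular_variance : forall x, D n x -> c <= sigma2 x <= M ;
  regular_weight : forall x, D n x -> c <= w x <= M ;
  regular_bias0 : forall x, D n x -> `|bias n mi0 x| <= M * hm n ;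
  regular_biasq : forall x, D n x -> `|bias n q x| <= M * (hm n * hq n) }.

Let mi0_vs : (mi_order (@mi0 d) <= vs)%N. Proof. by rewrite mi_order_mi0. Qed.

Lemma hm_hq n : h n ^+ (m - mi_order q) = hm n * hq n.
Proof.
have [qv vm] := vs_bounds.
rewrite exprB//; first exact: leq_trans qv (ltnW vm).
by rewrite unitfE gt_eqF// mesh_gt0.
Qed.

Lemma eventually_regular : exists c M C, [/\ 0 < c, 0 <= M &
  \forall n \near \oo, regular c M C n].
Proof.
have [qv vm] := vs_bounds.
have [C hC] := basis_local hbasis.
have [c1 c10 hc1] := basis_gram hbasis.
have [M1 M10 hM1] := basis_upper mi0_vs.
have [M2 M20 hM2] := basis_upper qv.
have [c2 c20 hc2] := basis_lower qv.
have [c3 c30 hc3] := dgp_density_bounded_away hdgp.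
have [c4 c40 hc4] := dgp_variance_bounded_away hdgp.
have [c5 c50 hc5] := hw0.
have [M3 hM3] := on_support_bounded (dgp_density_continuous hdgp).
have [M4 hM4] := on_support_bounded (dgp_variance_continuous hdgp).
have [M5 hM5] := on_support_bounded hw.
have [M6 M60 hM6] := bias_bounded.
pose c := Num.min c1 (Num.min c2 (Num.min c3 (Num.min c4 c5))).
pose M := Num.max M1 (Num.max M2 (Num.max M3 (Num.max M4 (Num.max M5 M6)))).
have c0 : 0 < c by rewrite !lt_min c10 c20 c30 c40 c50.
have M0 : 0 <= M by rewrite le_max M10.
have [cc1 cc2 cc3 cc4 cc5] : [/\ c <= c1, c <= c2, c <= c3, c <= c4 & c <= c5].
  by rewrite /c !ge_min !lexx ?orbT.
have [MM1 MM2 MM3 MM4 [MM5 MM6]] :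
    [/\ M1 <= M, M2 <= M, M3 <= M, M4 <= M & M5 <= M /\ M6 <= M].
  by rewrite /M !le_max !lexx ?orbT.
exists c, M, C; split => //.
near=> n.
have h0 := mesh_gt0 n.
have hq0 : 0 <= hq n by rewrite invr_ge0 exprn_ge0 ?ltW.
have hm0 : 0 <= hm n by rewrite exprn_ge0 ?ltW.
have pE x : D n x -> basis_partial cells p n mi0 x = p n x by exact: basis_partial_mi0.
split.
- by move=> i; have [] := hC n i.
- by move=> i; have [] := hC n i.
- move=> i a; apply: (@le_trans _ _ (c1 * (a i ord0 ^+ 2 * H n))).
    by rewrite ler_wpM2r// mulr_ge0 ?sqr_ge0// exprn_ge0// ltW.
  by move: i a; near: n.
- have hp x : D n x -> enorm (basis_partial cells p n mi0 x) <= M.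
    move=> Dx; apply: (le_trans _ MM1).
    have : forall x, D n x ->
      enorm (basis_partial cells p n mi0 x) <= M1 * h n ^- mi_order (@mi0 d) by near: n.
    by move=> /(_ x Dx); rewrite mi_order_mi0 expr0 invr1 mulr1.
  have [mp bp loc] := basis_local_functions mi0_vs hp; split.
  + move=> i; apply: eq_measurable_fun (mp i) => x; rewrite inE => Dx.
    by rewrite pE.
  + move=> x Dx; have := bp x Dx; congr (enorm _ <= _).
    by apply/colP => i; rewrite !mxE -pE// mxE.
  + move=> i l x lx li; rewrite -pE; last by exists l.
    exact: loc lx li.
- apply: basis_local_functions => // x Dx.
  apply: (@le_trans _ _ (M2 * hq n)); last by rewrite ler_wpM2r.
  by move: x Dx; near: n.
- move=> x Dx; apply: (@le_trans _ _ (c2 * hq n)); first by rewrite ler_wpM2r.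
  by move: x Dx; near: n.
- move=> x /Dsupp Sx; rewrite (le_trans cc3 (hc3 x Sx))/=.
  by rewrite (le_trans (ler_norm _))// (le_trans (hM3 x Sx)).
- move=> x /Dsupp Sx; rewrite (le_trans cc4 (hc4 x Sx))/=.
  by rewrite (le_trans (ler_norm _))// (le_trans (hM4 x Sx)).
- move=> x /Dsupp Sx; rewrite (le_trans cc5 (hc5 x Sx))/=.
  by rewrite (le_trans (ler_norm _))// (le_trans (hM5 x Sx)).
- move=> x Dx; have := hM6 n mi0 x mi0_vs Dx; rewrite mi_order_mi0 subn0 => H6.
  by rewrite (le_trans H6)// ler_wpM2r.
- move=> x Dx; have := hM6 n q x qv Dx; rewrite hm_hq => H6.
  by rewrite (le_trans H6)// ler_wpM2r// mulr_ge0.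
Unshelve. all: by end_near.
Qed.

(** ** Size of the leading terms *)

Local Notation Vn n := (imse_variance cells p X supp w sigma2 q n).
Local Notation Bn n := (imse_bias cells p X supp w (leading_bias cells supp mu m Lambda B) q n).

Lemma variance_rateE n : h n ^- (d + 2 * mi_order q) = (H n)^-1 * hq n ^+ 2.
Proof. by rewrite exprD invfM mulnC exprM exprVn. Qed.

Lemma bias_rateE n : h n ^+ (2 * m - 2 * mi_order q) = (hm n * hq n) ^+ 2.
Proof. by rewrite -mulnBr mulnC exprM hm_hq. Qed.

Let hq0 n : 0 <= hq n. Proof. by rewrite invr_ge0 exprn_ge0 ?ltW ?mesh_gt0. Qed.
Let hm0 n : 0 < hm n. Proof. by rewrite exprn_gt0 ?mesh_gt0. Qed.
Let H0 n : 0 < H n. Proof. by rewrite exprn_gt0 ?mesh_gt0. Qed.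
Let bw n : bounded_measurable (D n) w := bm_on_support n hw.
Let qv : (mi_order q <= vs)%N. Proof. by have [] := vs_bounds. Qed.
Let bB0 n : bounded_measurable (D n) (bias n mi0). Proof. exact: bm_bias. Qed.
Let bBq n : bounded_measurable (D n) (bias n q). Proof. exact: bm_bias. Qed.
Let qS : (mi_order q <= S)%N. Proof. exact: dgp_smooth_order hdgp. Qed.

Lemma variance_bounds c M C n : 0 < c -> 0 <= M -> regular c M C n ->
  @variance_floor R d C c M volume * h n ^- (d + 2 * mi_order q) <= Vn n <=
  @variance_ceil R d C c M volume * h n ^- (d + 2 * mi_order q).
Proof.
move=> c0 M0 reg; have h0 := mesh_gt0 n.
have bp := bm_local (regular_basis reg); have bpsi := bm_local (regular_derivative reg).
rewrite (imse_varianceE bp bpsi) variance_rateE; apply/andP; split.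
  exact: (leading_variance_lower (hpart n) h0 (@cells_diam n) (regular_active reg) (regular_neighbours reg)
    (cells_finite n) (cells_volume n) c0 M0 (regular_basis reg) (regular_gram reg) (hq0 n)
    (regular_derivative reg) (regular_lower reg) (bdens n) (bsigma2 n) (bw n)
    (regular_density reg) (regular_variance reg) (regular_weight reg)).
exact: (leading_variance_upper (hpart n) h0 (@cells_diam n) (regular_active reg) (regular_neighbours reg)
    (cells_finite n) (cells_volume n) c0 M0 (regular_basis reg) (regular_gram reg) (hq0 n)
    (regular_derivative reg) (bdens n) (bsigma2 n) (bw n)
    (regular_density reg) (regular_variance reg) (regular_weight reg)).
Qed.

Lemma variance_asymp : asymp (fun n => (Vn n)%:E) (fun n => (h n ^- (d + 2 * mi_order q))%:E).
Proof.
have [c [M [C [c0 M0 ev]]]] := eventually_regular.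
have L0 := volume_gt0.
have low0 : 0 < @variance_floor R d C c M volume.
  have k0 := @gram_floor_gt0 R C c c0.
  have b1 : 0 < @gram_ceil R d C M + 1.
    by rewrite ltr_wpDl// /gram_ceil !mulr_ge0 ?exprn_ge0.
  by rewrite /variance_floor !mulr_gt0 ?invr_gt0 ?exprn_gt0.
have r0 n : 0 < h n ^- (d + 2 * mi_order q) by rewrite invr_gt0 exprn_gt0 ?mesh_gt0.
have V0 n : regular c M C n -> 0 <= Vn n.
  move=> /(variance_bounds c0 M0)/andP[le1 _]; apply: le_trans le1.
  by rewrite mulr_ge0 ?(ltW low0) ?(ltW (r0 n)).
split.
  exists (@variance_ceil R d C c M volume); apply: filterS ev => n reg.
  rewrite !abse_EFin (ger0_norm (V0 n reg)) gtr0_norm ?r0// -EFinM lee_fin.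
  by have /andP[] := variance_bounds c0 M0 reg.
exists (@variance_floor R d C c M volume)^-1; apply: filterS ev => n reg.
rewrite !abse_EFin (ger0_norm (V0 n reg)) gtr0_norm ?r0// -EFinM lee_fin.
by rewrite ler_pdivlMl//; have /andP[] := variance_bounds c0 M0 reg.
Qed.

Lemma bias_lesssim : lesssim (fun n => (Bn n)%:E)
  (fun n => (h n ^+ (2 * m - 2 * mi_order q))%:E).
Proof.
have [c [M [C [c0 M0 ev]]]] := eventually_regular.
exists (@bias_ceil R d C c M volume); apply: filterS ev => n reg; have h0 := mesh_gt0 n.
have bp := bm_local (regular_basis reg); have bpsi := bm_local (regular_derivative reg).
rewrite (imse_biasE bp) bias_rateE !abse_EFin ger0_norm; last first.
  apply: Rintegral_ge0 => x Dx; rewrite mulr_ge0 ?sqr_ge0//.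
  by have /andP[cw _] := regular_weight reg Dx; rewrite (le_trans _ cw)// ltW.
rewrite ger0_norm ?sqr_ge0// -EFinM lee_fin.
exact: (bias_upper (hpart n) h0 (@cells_diam n) (regular_active reg) (regular_neighbours reg)
    (cells_finite n) (cells_volume n) c0 M0 (regular_basis reg) (regular_gram reg) (hq0 n)
    (ltW (hm0 n)) (regular_derivative reg) (bdens n) (bw n)
    (regular_density reg) (regular_weight reg) (bB0 n) (bBq n)
    (regular_bias0 reg) (regular_biasq reg)).
Qed.

(** ** Deviations of the conditional mean squared error *)

Let iidX : iid P (fun i => X i).
Proof.
exact: (iid_comp (pr := fst) measurable_fst (dgp_iid hdgp)).
Qed.

Lemma sampling_rates (M : R) (C : nat) (ep : R) : 0 <= M -> 0 < ep -> exists2 tau : R,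
  0 < tau & @rate_condition R d C M tau ep (M ^+ 2 + M ^+ 3).
Proof.
move=> M0 ep0; rewrite /rate_condition; set b := M ^+ 2 + M ^+ 3.
have b0 : 0 <= b by rewrite addr_ge0 ?exprn_ge0.
set x := b ^+ 2 * M * _.
have x0 : 0 <= x by rewrite !mulr_ge0 ?exprn_ge0.
exists (Num.min (1 / (2 * (b + 1))) (ep / (4 * (x + 1)))).
  by rewrite lt_min !divr_gt0 ?mulr_gt0// ltr_wpDl.
have b1 : 0 < 2 * (b + 1) by rewrite mulr_gt0// ltr_wpDl.
have x1 : 0 < 4 * (x + 1) by rewrite mulr_gt0// ltr_wpDl.
split.
  apply: (@le_trans _ _ (1 / (2 * (b + 1)) * b)).
    by rewrite ler_wpM2r// ge_min lexx.
  rewrite mulrAC ler_pdivrMr//; lra.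
apply: (@le_trans _ _ (4 * (ep / (4 * (x + 1))) * x)).
  by rewrite ler_wpM2r// ler_pM2l// ge_min lexx orbT.
have -> : 4 * (ep / (4 * (x + 1))) * x = ep * ((4 * x) / (4 * (x + 1))) by ring.
rewrite ler_piMr ?(ltW ep0)// ler_pdivrMr//; lra.
Qed.

Hypothesis hrate : ln n%:R / (n%:R * mesh (cells n) ^+ d) @[n --> \oo] --> (0 : R).

(** One tolerance delta, in terms of e and of the uniform constants, serves the
    Gram matrices, the projected bias and the spline remainder at once; the
    probability of a bad design tends to zero by the rate condition. *)
Lemma good_event (e eta : R) : 0 < e -> 0 < eta ->
  \forall n \near \oo, exists E, [/\ measurable E, (P E <= eta%:E)%E &
    forall o, ~ E o -> (forall l : 'I_n, D n (X l o)) ->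
      let x := fun l : 'I_n => X l o in
      `|\int[lam]_(y in D n) (sandwich (psi n) (egram (p n) (cst 1) x)
          (egram (p n) sigma2 x) y * w y) - Vn n| <= e * h n ^- (d + 2 * mi_order q) /\
      `|\int[lam]_(y in D n) (design_bias (p n) (psi n) x mu (partial_in supp q mu) y ^+ 2 * w y)
          - Bn n| <= e * h n ^+ (2 * m - 2 * mi_order q)].
Proof.
move=> e0 eta0.
have [c [M [C [c0 M0 ev]]]] := eventually_regular.
have k0 := @gram_floor_gt0 R C c c0.
pose aa := `|@variance_slope R d C c M volume| + `|@bias_slope R d C c M volume| + 1.
have aa0 : 0 < aa by rewrite ltr_wpDl// addr_ge0.
pose delta := Num.min 1 (Num.min (gram_floor C c) (e / aa)).
have delta0 : 0 < delta by rewrite !lt_min ltr01 k0 divr_gt0.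
have [delta1 deltak deltae] : [/\ delta <= 1, delta <= gram_floor C c & delta <= e / aa].
  by rewrite /delta !ge_min !lexx ?orbT.
have aVe : @variance_slope R d C c M volume * delta <= e.
  apply: (@le_trans _ _ (aa * delta)); last by rewrite mulrC -ler_pdivlMr.
  rewrite ler_wpM2r ?(ltW delta0)// (le_trans (ler_norm _))// /aa -addrA lerDl addr_ge0//.
have aBe : @bias_slope R d C c M volume * delta <= e.
  apply: (@le_trans _ _ (aa * delta)); last by rewrite mulrC -ler_pdivlMr.
  by rewrite ler_wpM2r ?(ltW delta0)// (le_trans (ler_norm _))// /aa addrAC lerDr addr_ge0.
have ep0 : 0 < delta / C.+1%:R by rewrite divr_gt0.
have [tau tau0 rc] := sampling_rates C M0 ep0.
have a0 : 0 < tau * (delta / C.+1%:R) / 2 by rewrite divr_gt0 ?mulr_gt0.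
have card_le : \forall n \near \oo, (K n)%:R * H n <= dimension_ceil c M volume.
  apply: filterS ev => n reg.
  exact: (card_bound (hpart n) (cells_finite n) (cells_volume n) c0 M0 (regular_basis reg)
    (regular_gram reg)).
have tail := exponential_tail a0 H0 hrate card_le eta0.
have [a ha] := spline_error.
have s0 := ha mi0 delta mi0_vs delta0; have sq := ha q delta qv delta0.
near=> n.
have reg : regular c M C n by near: n.
have n0 : (0 < n)%N by near: n; exact: nbhs_infty_gt.
have h0 := mesh_gt0 n.
have bp := bm_local (regular_basis reg); have bpsi := bm_local (regular_derivative reg).
have fM x : D n x -> f x <= M by move=> /(regular_density reg)/andP[].
have sM x : D n x -> `|sigma2 x| <= M.
  move=> /(regular_variance reg)/andP[cs sx]; rewrite ger0_norm//.
  by rewrite (le_trans _ cs)// ltW.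
have [E [mE PE good]] := good_design_probability (fun i => measurable_funPT (X i)) iidX
  (dgp_density_measurable hdgp) (dgp_density_ge0 hdgp) (dens 0%N) (hpart n) h0 (@cells_diam n)
  (regular_active reg) (cells_finite n) (outside_cells_null n 0%N) M0 (hm0 n) fM n0 tau0
  (regular_basis reg) (bsigma2 n) sM (bB0 n) (regular_bias0 reg) rc.
exists E; split => //.
  by apply: (le_trans PE); rewrite lee_fin; near: n.
move=> o nE XD; pose x (l : 'I_n) := X l o; have [g1 g2 g3] := good o nE XD; split.
  rewrite (imse_varianceE bp bpsi) variance_rateE.
  apply: (le_trans (design_variance (hpart n) h0 (@cells_diam n) (regular_active reg)
    (regular_neighbours reg) (cells_finite n) (cells_volume n) c0 M0 (regular_basis reg)
    (regular_gram reg) (hq0 n) (regular_derivative reg) (bdens n) (bsigma2 n) (bw n)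
    (regular_density reg) (regular_variance reg) (regular_weight reg)
    XD delta0 deltak g1 g2)).
  by rewrite ler_wpM2r// mulr_ge0 ?sqr_ge0// invr_ge0 ltW.
rewrite (imse_biasE bp) bias_rateE.
pose r0 y := mu y - dotc (a n) (p n y) + bias n mi0 y.
pose rq y := partial_in supp q mu y - dotc (a n) (psi n y) + bias n q y.
have muE y : D n y -> mu y = dotc (a n) (p n y) - bias n mi0 y + r0 y.
  by move=> _; rewrite /r0; ring.
have muqE y : D n y -> partial_in supp q mu y = dotc (a n) (psi n y) - bias n q y + rq y.
  by move=> _; rewrite /rq; ring.
have r0_le y : D n y -> `|r0 y| <= delta * hm n.
  move=> Dy; have : forall y, D n y ->
    `|partial_in supp mi0 mu y - dotc (a n) (basis_partial cells p n mi0 y) +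
      bias n mi0 y| <= delta * (hm n * h n ^- mi_order (@mi0 d)) by near: n.
  move=> /(_ y Dy); rewrite (partial_in_mi0 Dy) basis_partial_mi0//.
  by rewrite mi_order_mi0 expr0 invr1 mulr1.
have rq_le y : D n y -> `|rq y| <= delta * (hm n * hq n).
  have bound : forall y, D n y -> `|partial_in supp q mu y -
    dotc (a n) (psi n y) + bias n q y| <= delta * (hm n * hq n) by near: n.
  exact: bound.
have dB i : `|evec (p n) (bias n mi0) x i ord0 - bias_moment (cells n) (p n) f (bias n mi0) i ord0| <=
    delta * H n * hm n.
  apply: (le_trans (g3 i)); rewrite ler_wpM2r ?(ltW (hm0 n))// ler_wpM2r ?(ltW (H0 n))//.
  by rewrite ler_pdivrMr// ler_peMr ?(ltW delta0)// ler1n.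
apply: (le_trans (design_bias_le (hpart n) h0 (@cells_diam n) (regular_active reg)
    (regular_neighbours reg) (cells_finite n) (cells_volume n) c0 M0 (regular_basis reg)
    (regular_gram reg) (hq0 n) (ltW (hm0 n)) (regular_derivative reg) (bdens n) (bw n)
    (regular_density reg) (regular_weight reg) (bB0 n) (bBq n)
    (regular_bias0 reg) (regular_biasq reg) n0 XD delta0 delta1 deltak g1
    (bm_partial_in n qS) muE muqE r0_le rq_le dB)).
by rewrite ler_wpM2r ?sqr_ge0.
Unshelve. all: by end_near.
Qed.


Variable mse : forall n, 'rV[R]_d * n.-tuple 'rV[R]_d -> \bar R.
Arguments mse : clear implicits.
Hypothesis hmse : conditional_mse cells p X Y supp mu q mse.

(** The variance and the bias parts have to be random variables, although the
    formulas for them are only used when all observations are in the cells. *)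
Lemma conditional_imse c M C n : 0 < c -> regular c M C n -> exists v b : Omega -> R,
  [/\ measurable_fun setT v, measurable_fun setT b,
    {ae P, forall o, (\int[lam]_(x in supp) (mse n (x, design X n o) * (w x)%:E))%E =
      (n%:R^-1 * v o + b o)%:E} &
    forall o, (forall l : 'I_n, D n (X l o)) ->
      let x := fun l : 'I_n => X l o in
      v o = \int[lam]_(y in D n) (sandwich (psi n) (egram (p n) (cst 1) x)
        (egram (p n) sigma2 x) y * w y) /\
      b o = \int[lam]_(y in D n)
        (design_bias (p n) (psi n) x mu (partial_in supp q mu) y ^+ 2 * w y)].
Proof.
move=> c0 reg; have [mmse cond] := hmse n.
have sM x : D n x -> 0 <= sigma2 x <= M.
  by move=> /(regular_variance reg)/andP[cs ->]; rewrite (le_trans _ cs)// ltW.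
have w0 x : D n x -> 0 <= w x.
  by move=> /(regular_weight reg)/andP[cw _]; rewrite (le_trans _ cw)// ltW.
have mmu : measurable_fun (D n) mu.
  apply: continuous_measurable_rV => // x Dx.
  have [cmu _ _] := dgp_smooth hdgp.
  exact (within_continuous_at (@oD n) (@Dsupp n) cmu Dx).
have ms2 : measurable_fun setT sigma2.
  by have [/measurable_EFinP] := dgp_eps_variance hdgp 0%N.
have mp k : measurable_fun setT (fun x => p n x k ord0) by exact (basis_measurable hbasis k).
have hcond x : D n x -> cond_expectation P (design_of (sample (fun i => X i) (fun i => Y i)) fst n)
    (fun o => ((ls_value X Y n (p n) (psi n) x o - partial_in supp q mu x) ^+ 2)%:E)
    (fun t => mse n (x, t)).
  move=> Dx; have := cond x (Dsupp Dx).
  congr (cond_expectation _ _ _ _); apply/funext => o.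
  by rewrite ls_estimatorE.
have [v [b [mv mb eq1 eq2]]] := imse_decomposition (fun i => measurable_funPT (X i))
  (fun i => measurable_funPT (Y i)) (fun i => measurable_funPT (eps i)) (dgp_model hdgp)
  (dgp_eps_integrable hdgp) (dgp_eps_mean hdgp) (dgp_eps_variance hdgp) (dgp_iid hdgp)
  (mD n) (outside_cells_null n) mmu ms2 sM msupp (@Dsupp n) (uncovered_null (hpart n))
  (cells_finite n) mp (bm_local (regular_derivative reg)) (bm_partial_in n qS) (bw n) w0
  mmse hcond.
by exists v, b.
Qed.

Let inD_null n : exists N, [/\ measurable N, P N = 0%E &
  forall o, ~ N o -> forall l : 'I_n, D n (X l o)].
Proof.
have mN i : measurable (X i @^-1` ~` D n).
  rewrite -[X in measurable X]setTI; apply: measurable_funPT => //.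
  exact: measurableC.
have [|mU U0] := @null_bigsetU _ _ _ P _ (index_enum 'I_n) (fun l => X l @^-1` ~` D n).
  by move=> l; split; [exact: mN|exact: outside_cells_null].
exists (\big[setU/set0]_(l <- index_enum 'I_n) X l @^-1` ~` D n); split => // o nN l.
by have := @mem_bigsetU _ _ (fun l : 'I_n => X l @^-1` ~` D n) o nN l => /= /contrapT.
Qed.

(** A random sequence whose value is small off an event of small probability is
    small in probability. *)
Let oP_of_event (r : nat -> {RV P >-> R}) (b : nat -> R) :
  (forall n, 0 < b n) ->
  (forall e eta, 0 < e -> 0 < eta -> \forall n \near \oo,
    exists E, [/\ measurable E, (P E <= eta%:E)%E &
      forall o, ~ E o -> (forall l : 'I_n, D n (X l o)) -> `|r n o| <= e * b n]) ->
  oP r b.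
Proof.
move=> b0 H e e0.
have mS n : measurable [set o | e * `|b n| < `|r n o|].
  apply: measurable_lt_set; first exact: measurable_cst.
  by apply: measurableT_comp => //; exact: measurable_funPT.
apply/fine_cvgP; split.
  by apply: nearW => n; rewrite fin_num_measure.
apply/cvgrPdist_le => eta eta0; apply: filterS (H e eta e0 eta0) => n [E [mE PE hE]].
rewrite sub0r normrN ger0_norm ?fine_ge0//.
rewrite -lee_fin fineK ?fin_num_measure//.
have [N [mN N0 hN]] := inD_null n.
apply: le_trans PE; rewrite -[leRHS](measureU0 (mu := P) mE mN N0).
apply: le_measure; rewrite ?inE//; first exact: measurableU.
move=> o /= lt1; apply: contrapT => /not_orP[nE nN].
have := hE o nE (hN o nN); rewrite leNgt => /negP; apply.
by move: lt1; rewrite (gtr0_norm (b0 n)).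
Qed.


Lemma imse_expansion : exists rV rB : nat -> {RV P >-> R},
  [/\ oP rV (fun n => h n ^- (d + 2 * mi_order q)),
      oP rB (fun n => h n ^+ (2 * m - 2 * mi_order q)) &
      \forall n \near \oo, {ae P, forall omega,
        (\int[lam]_(x in supp) (mse n (x, design X n omega) * (w x)%:E))%E =
        (n%:R^-1 * (Vn n + rV n omega) + (Bn n + rB n omega))%:E}].
Proof.
have [c [M [C [c0 M0 ev]]]] := eventually_regular.
have H n : exists r : {RV P >-> R} * {RV P >-> R}, regular c M C n ->
    {ae P, forall o, (\int[lam]_(x in supp) (mse n (x, design X n o) * (w x)%:E))%E =
      (n%:R^-1 * (Vn n + r.1 o) + (Bn n + r.2 o))%:E} /\
    forall o, (forall l : 'I_n, D n (X l o)) ->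
      let x := fun l : 'I_n => X l o in
      r.1 o = \int[lam]_(y in D n) (sandwich (psi n) (egram (p n) (cst 1) x)
        (egram (p n) sigma2 x) y * w y) - Vn n /\
      r.2 o = \int[lam]_(y in D n)
        (design_bias (p n) (psi n) x mu (partial_in supp q mu) y ^+ 2 * w y) - Bn n.
  have [reg|nreg] := pselect (regular c M C n); last first.
    have [r _] := @random_variable_of _ _ _ P _ (measurable_cst (0 : R)).
    by exists (r, r).
  have [v [b [mv mb eq1 eq2]]] := conditional_imse c0 reg.
  have [r1 h1] := @random_variable_of _ _ _ P _ (measurable_funB mv (measurable_cst (Vn n))).
  have [r2 h2] := @random_variable_of _ _ _ P _ (measurable_funB mb (measurable_cst (Bn n))).
  exists (r1, r2) => _; split => /=.
    apply: filterS eq1 => o ->; congr (_%:E).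
    by rewrite h1 h2 /=; congr (_ * _ + _); rewrite addrC subrK.
  by move=> o XD; have [e1 e2] := eq2 o XD; rewrite h1 h2 /= e1 e2.
have [r hr] := choice H.
have event (e eta : R) : 0 < e -> 0 < eta -> \forall n \near \oo, exists E,
    [/\ measurable E, (P E <= eta%:E)%E &
      forall o, ~ E o -> (forall l : 'I_n, D n (X l o)) ->
        `|(r n).1 o| <= e * h n ^- (d + 2 * mi_order q) /\
        `|(r n).2 o| <= e * h n ^+ (2 * m - 2 * mi_order q)].
  move=> e0 eta0; apply: filterS2 ev (good_event e0 eta0) => n reg [E [mE PE hE]].
  exists E; split => // o nE XD; have [_ /(_ o XD) /= [-> ->]] := hr n reg.
  exact: hE.
exists (fun n => (r n).1), (fun n => (r n).2); split.
- apply: oP_of_event => [n|e eta e0 eta0]; first by rewrite invr_gt0 exprn_gt0 ?mesh_gt0.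
  apply: filterS (event e eta e0 eta0) => n [E [mE PE hE]].
  by exists E; split => // o nE XD; have [] := hE o nE XD.
- apply: oP_of_event => [n|e eta e0 eta0]; first by rewrite exprn_gt0 ?mesh_gt0.
  apply: filterS (event e eta e0 eta0) => n [E [mE PE hE]].
  by exists E; split => // o nE XD; have [] := hE o nE XD.
- by apply: filterS ev => n reg; have [] := hr n reg.
Qed.

End regularity.

Theorem theorem4p1 (R : realType) (d : nat) (d_gt0 : (0 < d)%N)
    (disp : measure_display) (Omega : measurableType disp)
    (P : probability Omega R)
    (X : nat -> {RV P >-> 'rV[R]_d}) (Y eps : nat -> {RV P >-> R})
    (mu sigma2 f : 'rV[R]_d -> R) (supp : set 'rV[R]_d)
    (q : multi_index d) (S m vs : nat) (rho : R)
    (kappa K : nat -> nat) (cells : forall n, 'I_(kappa n) -> set 'rV[R]_d)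
    (p : forall n, 'rV[R]_d -> 'cV[R]_(K n))
    (Lambda : {fset multi_index d})
    (B : nat -> multi_index d -> multi_index d -> 'rV[R]_d -> R)
    (w : 'rV[R]_d -> R)
    (mse : forall n, 'rV[R]_d * n.-tuple 'rV[R]_d -> \bar R)
    (hdgp : data_generating_process X Y eps mu sigma2 f supp q S rho)
    (hpart : forall n, is_partition (cells n) supp)
    (hqu : quasi_uniform_partition cells)
    (hbasis : local_basis cells p q m vs)
    (happrox : approximation_error cells p supp mu m Lambda B S vs rho)
    (hrate : ln n%:R / (n%:R * mesh (cells n) ^+ d) @[n --> \oo] --> (0 : R))
    (hw : {within supp, continuous w})
    (hw0 : bounded_away_from_zero supp w)
    (hmse : conditional_mse cells p X Y supp mu q mse) :
  let h n := mesh (cells n) in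
  let V := imse_variance cells p X supp w sigma2 q in
  let Bias := imse_bias cells p X supp w
                (leading_bias cells supp mu m Lambda B) q in
  [/\ exists rV rB : nat -> {RV P >-> R},
        [/\ oP rV (fun n => h n ^- (d + 2 * mi_order q)),
            oP rB (fun n => h n ^+ (2 * m - 2 * mi_order q)) &
            \forall n \near \oo, {ae P, forall omega,
              (\int[lebesgue_rV R d]_(x in supp)
                 (mse n (x, design X n omega) * (w x)%:E))%E =
              (n%:R^-1 * (V n + rV n omega) + (Bias n + rB n omega))%:E}],
      asymp (fun n => (V n)%:E) (fun n => (h n ^- (d + 2 * mi_order q))%:E) &
      lesssim (fun n => (Bias n)%:E)
        (fun n => (h n ^+ (2 * m - 2 * mi_order q))%:E)].
Proof.
split.
- exact: (imse_expansion d_gt0 hdgp hpart hqu hbasis happrox hw hw0 hrate hmse).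
- exact: (variance_asymp d_gt0 hdgp hpart hbasis happrox hw hw0).
- exact: (bias_lesssim d_gt0 hdgp hpart hbasis happrox hw hw0).
Qed.
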